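(* Let $X$ be a real Hausdorff locally convex space, $\gamma$ a Radon centered Gaussian measure on $X$, $p\in[1,\infty)$ and $\alpha\in(0,1]$. For any function $f\in B^\alpha_p(\gamma)$ we have $$\|f-\mathbb{E}f\|_p\le2^{1-2\alpha}\pi^\alpha C(p)^\alpha\,V_\gamma^{p,\alpha}(f),\qquad C(p):=\biggl((2\pi)^{-1/2}\int_{\mathbb{R}}|s|^pe^{-\frac{s^2}{2}}\,ds\biggr)^{1/p},$$ where $\mathbb{E}f$ denotes the integral of $f$ against $\gamma$.
   Context: A Radon centered Gaussian measure is a Radon probability measure $\gamma$ on the Borel $\sigma$-algebra of $X$ such that every $l\in X^*$ is a centered Gaussian random variable (possibly degenerate) on $(X,\gamma)$. $X_\gamma^*$ is the closure of $X^*$ in $L^2(\gamma)$. The Cameron--Martin space $H\subset X$ is the set of vectors $h$ such that $\gamma(\cdot-h)$ is equivalent to $\gamma$; it is a separable Hilbert space with norm $|h|_H=\sup\{l(h):\ l\in X^*,\ \int_Xl^2\,d\gamma\le1\}$ and inner product $\langle\cdot,\cdot\rangle_H$. $\|\cdot\|_p$ is the norm of $L^p(\gamma)$; for an $H$-valued field $\Phi$, $\|\Phi\|_p$ is the $L^p(\gamma)$-norm of $|\Phi|_H$. $\mathcal{FC}_0^\infty(X,H)$ is the set of vector fields $\Phi(x)=\sum_{i=1}^n\Psi_i(g_1(x),\dots,g_n(x))h_i$ with $n\in\mathbb{N}$, $\Psi_i\in C_0^\infty(\mathbb{R}^n)$, $g_i\in X^*$, $h_i\in H$, where the representation is taken with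 $g_1,\dots,g_n$ orthonormal in $X_\gamma^*$, $h_1,\dots,h_n$ orthonormal in $H$ and $g_i(h_j)=\delta_{ij}$. For such $\Phi$ the Gaussian divergence is the bounded function $\mathrm{div}_\gamma\Phi(x)=\sum_{j=1}^n\bigl[\partial_{x_j}\Psi_j(g_1(x),\dots,g_n(x))-g_j(x)\Psi_j(g_1(x),\dots,g_n(x))\bigr]$. A function $f\in L^p(\gamma)$ belongs to the Gaussian Nikolskii--Besov class $B^\alpha_p(\gamma)$ if there is a number $C\ge0$ such that $\int_Xf\,\mathrm{div}_\gamma\Phi\,d\gamma\le C\|\Phi\|_q^\alpha\|\mathrm{div}_\gamma\Phi\|_q^{1-\alpha}$ for all $\Phi\in\mathcal{FC}_0^\infty(X,H)$, where $1/p+1/q=1$ ($q=\infty$ if $p=1$; $0^0=1$). $V_\gamma^{p,\alpha}(f)$ is the infimum of such $C$. *)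

(* Defs.v *)
From HB Require Import structures.
From mathcomp Require Import all_boot all_order all_algebra.
From mathcomp Require Import all_classical all_reals all_analysis.

Set Implicit Arguments.
Unset Strict Implicit.
Unset Printing Implicit Defensive.

Import Order.TTheory GRing.Theory Num.Theory.
Import numFieldNormedType.Exports.

Local Open Scope classical_set_scope.
Local Open Scope ring_scope.

(* [tvsType] (locally convex, not assumed Hausdorff) carries no canonical
   point, which [g_sigma_algebraType] requires: the alias is pointed at 0. *)
Definition pointed_tvs (R : realType) (X : tvsType R) : Type := X.

HB.instance Definition _ (R : realType) (X : tvsType R) :=
  Choice.on (pointed_tvs X).
HB.instance Definition _ (R : realType) (X : tvsType R) :=
  isPointed.Build (pointed_tvs X) (0 : X).

Definition borel (R : realType) (X : tvsType R) :=
  @g_sigma_algebraType (pointed_tvs X) (@open X).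

Section locally_convex_gaussian.
Context (R : realType) (X : tvsType R).
Implicit Types (gamma : probability (borel X) R) (h k : X).

Definition topdual : set (X -> R) := [set l : X -> R | scalar l /\ continuous l].

Definition radon gamma : Prop :=
  forall B : set (borel X), measurable B -> forall e : R, 0 < e ->
    exists K : set X, [/\ compact K, K `<=` B & (gamma (B `\` K) < e%:E)%E].

(* [normal_prob 0 0] is not a Dirac mass in the library, hence the case of
   a degenerate law is treated apart. *)
Definition centered_gaussian_law (mu : set R -> \bar R) : Prop :=
  (forall A, measurable A -> mu A = \d_(0 : R) A) \/
  (exists2 s : R, 0 < s & forall A, measurable A -> mu A = normal_prob 0 s A).

Definition radon_centered_gaussian gamma : Prop :=
  radon gamma /\
  forall l, topdual l -> centered_gaussian_law (fun A => gamma (l @^-1` A)).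

(* The measure gamma(. - h), i.e. A |-> gamma(A - h). *)
Definition shift_measure gamma h : set (borel X) -> \bar R :=
  pushforward gamma (fun x : borel X => (x : X) + h : borel X).

Definition cameron_martin gamma : set X :=
  [set h | shift_measure gamma h `<< gamma /\ gamma `<< shift_measure gamma h].

Definition cm_norm gamma h : \bar R :=
  ereal_sup [set (l h)%:E | l in
    [set l : X -> R | topdual l /\ (\int[gamma]_x ((l x) ^+ 2)%:E <= 1)%E]].

(* The inner product of H, recovered from its norm by polarization. *)
Definition cm_inner gamma h k : R :=
  (fine (cm_norm gamma (h + k)) ^+ 2 - fine (cm_norm gamma (h - k)) ^+ 2) / 4.

End locally_convex_gaussian.

Section smooth_functions.
Context (R : realType) (n : nat).
Implicit Type u : 'rV[R]_n -> R.

Definition partial (j : 'I_n) u : 'rV[R]_n -> R :=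
  fun y => 'D_(delta_mx 0 j) u y.

Definition iter_partial (s : seq 'I_n) u : 'rV[R]_n -> R := foldr partial u s.

Definition smooth u : Prop := forall s : seq 'I_n,
  continuous (iter_partial s u) /\
  forall (j : 'I_n) (y : 'rV[R]_n),
    derivable (iter_partial s u) y (delta_mx 0 j).

Definition smooth_compact_support u : Prop :=
  smooth u /\ compact (closure [set y | u y != 0]).

End smooth_functions.

Section nikolskii_besov.
Context (R : realType) (X : tvsType R).
Implicit Types (gamma : probability (borel X) R) (p alpha : R) (f : X -> R).

Definition coords n (g : 'I_n -> X -> R) (x : X) : 'rV[R]_n :=
  \row_i g i x.

(* The fields of FC_0^oo(X, H) are the [cyl_field Psi g h] with
   [cyl_data gamma Psi g h].  Since g_i belongs to the dual of X, being
   orthonormal in its L^2(gamma)-closure means being orthonormal in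
   L^2(gamma). *)
Definition cyl_field n (Psi : 'I_n -> 'rV[R]_n -> R) (g : 'I_n -> X -> R)
    (h : 'I_n -> X) (x : X) : X :=
  \sum_i Psi i (coords g x) *: h i.

Definition cyl_data gamma n (Psi : 'I_n -> 'rV[R]_n -> R) (g : 'I_n -> X -> R)
    (h : 'I_n -> X) : Prop :=
  [/\ forall i, smooth_compact_support (Psi i),
      (forall i, topdual (g i)) /\
        (forall i j,
          (\int[gamma]_x (g i x * g j x)%:E)%E = ((i == j)%:R : R)%:E),
      (forall i, cameron_martin gamma (h i)) /\
        (forall i j, cm_inner gamma (h i) (h j) = (i == j)%:R) &
      forall i j, g i (h j) = (i == j)%:R].

Definition gauss_div n (Psi : 'I_n -> 'rV[R]_n -> R) (g : 'I_n -> X -> R)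
    (x : X) : R :=
  \sum_j (partial j (Psi j) (coords g x) - g j x * Psi j (coords g x)).

(* The library's powers satisfy 0 `^ 0 = 1, and [hoelder_conjugate 1] is
   +oo, for which 'N[_]_+oo is the essential supremum. *)
Definition besov_bound gamma p alpha f (C : R) : Prop :=
  let q := hoelder_conjugate p%:E in
  forall n (Psi : 'I_n -> 'rV[R]_n -> R) (g : 'I_n -> X -> R) (h : 'I_n -> X),
    cyl_data gamma Psi g h ->
    (\int[gamma]_x (f x * gauss_div Psi g x)%:E <=
      C%:E
      * 'N[gamma]_q [(fun x => cm_norm gamma (cyl_field Psi g h x))] `^ alpha
      * 'N[gamma]_q [(fun x => (gauss_div Psi g x)%:E)] `^ (1 - alpha))%E.

Definition besov gamma p alpha : set (X -> R) :=
  [set f | f \in Lfun gamma p%:E /\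
    exists C : R, 0 <= C /\ besov_bound gamma p alpha f C].

Definition besov_V gamma p alpha f : R :=
  inf [set C : R | 0 <= C /\ besov_bound gamma p alpha f C].

Definition gauss_C p : R :=
  ((2 * pi) `^ (- 2^-1) *
   \int[lebesgue_measure]_s (`|s| `^ p * expR (- (s ^+ 2 / 2)))) `^ p^-1.

End nikolskii_besov.

(* Main.v *)
From HB Require Import structures.
Require Import Defs.
From mathcomp Require Import all_boot all_order all_algebra.
From mathcomp Require Import all_classical all_reals all_analysis.
From mathcomp Require Import measurable_realfun ring lra zify.

(* The proof is by duality, testing F = f - Ef against trigonometric
   polynomials phi = \sum_k a_k cos(l_k + b_k) with l_k in the dual of X.

   Gram-Schmidt gives g_1, ..., g_n orthonormal in L^2(gamma) spanning the l_k
   up to null sets, and each g_j is represented by a Cameron-Martin vector h_j.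
   Interpolating phi along x cos(th) + y sin(th), with y an independent copy of
   x and 0 <= th <= pi/2, one obtains a bounded smooth field Phi with
   div Phi = phi - E phi and
     <c, Phi(x)> = - \int_0^(pi/2) E_y[g_c(y) phi(x cos(th) + y sin(th))] dth.
   By Hoelder's inequality and the rotation invariance of gamma x gamma,
   |Phi|_q <= (pi/2) C(p) |phi|_q, while |phi - E phi|_q <= 2 |phi|_q.  After a
   smooth cut-off of Phi, the hypothesis on f gives
     \int F phi <= C (pi/2)^alpha C(p)^alpha 2^(1-alpha) |phi|_q,
   and trigonometric polynomials are rich enough to recover |F|_p: they
   separate the points of X (Hahn-Banach), hence disjoint compact sets up to
   uniform limits, and gamma is Radon.

   The same separation argument, applied on X x R to the measures gamma and
   e^(g - 1/2) gamma, produces the vector h representing g, and shows that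
   finite Radon measures with the same Fourier transform coincide, so that
   gamma(. - h) = e^(g - 1/2) gamma. *)

Set Implicit Arguments.
Unset Strict Implicit.
Unset Printing Implicit Defensive.
Import Order.TTheory GRing.Theory Num.Theory.
Import numFieldNormedType.Exports.
Local Open Scope classical_set_scope.
Local Open Scope ring_scope.

(** * Trigonometric polynomials and separation of compact sets *)

Section trig.
Context (R : realType) (T : Type) (L : set (T -> R)).
Implicit Types (u v w l m : T -> R).

(** Cosines suit the problem because only the one-dimensional laws of gamma are given. Sums of
    functionals are functionals, so every mean that is needed follows from E cos(l + b) = cos(b)
    exp(-cov(l,l)/2) and its derivatives in parameters; no joint law and no integral over R^n
    appears. Once y is integrated out, the field is a sum of functions of one real variable
    ([smoothed_cos]), and its divergence is the integral of the derivative in th of -E_y phi(x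
    cos(th) + y sin(th)).

    In the constant, pi/2 is the length of the range of th, C(p) the L^p norm of g_c/|c|, and 2
    comes from |phi - E phi|_q <= |phi|_q + |E phi|; finally (pi/2)^alpha 2^(1-alpha) = 2^(1-2
    alpha) pi^alpha.

    Two obstacles shape the rest. For p = 1 the dual norm is a supremum, and bounds are kept at
    every point, although approximation holds only in L^1 and Gram-Schmidt recovers the l_k only
    almost everywhere. And the natural candidate for h, the mean of g(x) x, is not known to lie in
    X: compact sets carrying most of the mass have to produce it. *)

Inductive trig : (T -> R) -> Prop :=
| trig_nil : trig (fun=> 0)
| trig_cons a l b v : L l -> trig v -> trig (fun x => a * cos (l x + b) + v x).

(** The uniform closure of [trig]. Unlike [trig], it is stable under exponentials, and then under
    all continuous functions of one variable. *)
Definition utrig u := forall e : R, 0 < e ->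
  exists2 v, trig v & forall x, `|u x - v x| <= e.

Definition linear_family := [/\ L (fun=> 0),
  forall l m, L l -> L m -> L (fun x => l x + m x) &
  forall a l, L l -> L (fun x => a * l x)].

Lemma eq_trig u v : u =1 v -> trig u -> trig v.
Proof. by move=> /funext ->. Qed.

Lemma trig_bounded u : trig u -> exists2 b, 0 < b & forall x, `|u x| <= b.
Proof.
elim=> [|a l b v _ _ [c c0 vc]]; first by exists 1 => // x; rewrite normr0.
exists (`|a| + c) => [|x]; first by rewrite ltr_wpDl.
rewrite (le_trans (ler_normD _ _))// lerD// normrM ler_piMr//.
by rewrite ler_norml cos_geN1 cos_le1.
Qed.

Lemma trigD u v : trig u -> trig v -> trig (fun x => u x + v x).
Proof.
elim=> [|a l b w Ll _ ih] tv.
  by apply: eq_trig tv => x; rewrite add0r.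
apply: eq_trig (trig_cons a b Ll (ih tv)) => x; exact: addrA.
Qed.

Lemma trigZ a u : trig u -> trig (fun x => a * u x).
Proof.
elim=> [|c l b w Ll _ ih].
  by apply: eq_trig trig_nil => x; rewrite mulr0.
by apply: eq_trig (trig_cons (a * c) b Ll ih) => x; rewrite mulrDr mulrA.
Qed.

Lemma utrig_trig u : trig u -> utrig u.
Proof. by move=> tu e /ltW e0; exists u => // x; rewrite subrr normr0. Qed.

Lemma utrig_bounded u : utrig u -> exists2 b, 0 < b & forall x, `|u x| <= b.
Proof.
move=> /(_ 1 ltr01)[v /trig_bounded[b b0 vb] uv].
exists (1 + b) => [|x]; first by rewrite addr_gt0.
by rewrite -[u x](subrK (v x)) (le_trans (ler_normD _ _))// lerD.
Qed.

Lemma utrig_unif u : (forall e : R, 0 < e ->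
  exists2 v, utrig v & forall x, `|u x - v x| <= e) -> utrig u.
Proof.
move=> h e e0; have e2 : 0 < e / 2 by rewrite divr_gt0.
have [v /(_ _ e2)[w tw vw] uv] := h _ e2; exists w => // x.
by rewrite -[u x](subrK (v x)) -addrA (le_trans (ler_normD _ _))// (splitr e) lerD.
Qed.

Lemma utrigD u v : utrig u -> utrig v -> utrig (fun x => u x + v x).
Proof.
move=> uu uv e e0; have e2 : 0 < e / 2 by rewrite divr_gt0.
have [u' tu uu'] := uu _ e2; have [v' tv vv'] := uv _ e2.
exists (fun x => u' x + v' x) => [|x]; first exact: trigD.
by rewrite opprD addrACA (le_trans (ler_normD _ _))// (splitr e) lerD.
Qed.

Hypothesis Llin : linear_family.

Lemma trig_cst c : trig (fun=> c).
Proof.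
have [L0 _ _] := Llin.
by apply: eq_trig (trig_cons c 0 L0 trig_nil) => x; rewrite !addr0 cos0 mulr1.
Qed.

Lemma trig_cos l b : L l -> trig (fun x => cos (l x + b)).
Proof.
by move=> Ll; apply: eq_trig (trig_cons 1 b Ll trig_nil) => x; rewrite addr0 mul1r.
Qed.

Lemma trig_sin l b : L l -> trig (fun x => sin (l x + b)).
Proof.
move=> Ll; apply: eq_trig (trig_cos (b - pi / 2) Ll) => x.
by rewrite addrA cosB cos_pihalf sin_pihalf mulr0 mulr1 add0r.
Qed.

(** Product-to-sum formula: the frequencies l + m and l - m stay in the linear family [L]. *)
Lemma trigM u v : trig u -> trig v -> trig (fun x => u x * v x).
Proof.
move=> tu tv; elim: tu => [|a l b w Ll _ ih].
  by apply: eq_trig trig_nil => x; rewrite mul0r.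
suff h : trig (fun x => cos (l x + b) * v x).
  by apply: eq_trig (trigD (trigZ a h) ih) => x; rewrite mulrDl mulrA.
elim: tv => [|a' m b' v' Lm _ ih'].
  by apply: eq_trig trig_nil => x; rewrite mulr0.
have [_ LD LZ] := Llin.
have h : trig (fun x => cos (l x + b) * cos (m x + b')).
  have t1 := trig_cos (b + b') (LD _ _ Ll Lm).
  have t2 := trig_cos (b - b') (LD _ _ Ll (LZ (-1) _ Lm)).
  apply: eq_trig (trigZ 2^-1 (trigD t1 t2)) => x.
  have -> : l x + m x + (b + b') = (l x + b) + (m x + b') by ring.
  have -> : l x + -1 * m x + (b - b') = (l x + b) - (m x + b') by ring.
  by rewrite cosD cosB; field.
by apply: eq_trig (trigD (trigZ a' h) ih') => x /=; ring.
Qed.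

Lemma utrig_cst c : utrig (fun=> c).
Proof. exact/utrig_trig/trig_cst. Qed.

Lemma utrigM u v : utrig u -> utrig v -> utrig (fun x => u x * v x).
Proof.
move=> uu uv e e0.
have [b b0 ub] := utrig_bounded uu; have [c c0 vc] := utrig_bounded uv.
(* The error of the product is at most b d + d c + d^2 <= d (b + c + 1), where d <= 1 gives d^2 <=
   d. *)
have d0 : 0 < Num.min 1 (e / (b + c + 1)) by rewrite lt_min ltr01 divr_gt0// !addr_gt0.
set d := Num.min _ _ in d0.
have [u' tu uu'] := uu _ d0; have [v' tv vv'] := uv _ d0.
exists (fun x => u' x * v' x) => [|x]; first exact: trigM.
have -> : u x * v x - u' x * v' x =
   u x * (v x - v' x) + (u x - u' x) * v x - (u x - u' x) * (v x - v' x) by ring.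
rewrite (@le_trans _ _ (b * d + d * c + d * d))//.
  rewrite (le_trans (ler_normB _ _))// lerD//; last by rewrite normrM ler_pM.
  by rewrite (le_trans (ler_normD _ _))// lerD// normrM ler_pM.
have dd : d * d <= d by rewrite ler_piMr ?(ltW d0)// /d ge_min lexx.
have : d * (b + c + 1) <= e.
  by rewrite -ler_pdivlMr ?addr_gt0// /d ge_min lexx orbT.
by nra.
Qed.

Lemma utrigX u n : utrig u -> utrig (fun x => u x ^+ n).
Proof.
move=> uu; elim: n => [|n ih]; first exact: utrig_cst.
rewrite (_ : (fun _ => _) = fun x => u x * u x ^+ n); first exact: utrigM.
by apply/funext => x; rewrite exprS.
Qed.

Lemma utrig_sum (I : Type) (r : seq I) (F : I -> T -> R) :
  (forall i, utrig (F i)) -> utrig (fun x => \sum_(i <- r) F i x).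
Proof.
move=> h; elim: r => [|i r ih].
  rewrite (_ : (fun _ => _) = fun=> 0); first exact: utrig_cst.
  by apply/funext => x; rewrite big_nil.
rewrite (_ : (fun _ => _) = fun x => F i x + \sum_(i <- r) F i x); first exact: utrigD.
by apply/funext => x; rewrite big_cons.
Qed.

End trig.

(** For |x| <= b the tail of the series at x is dominated term by term by the tail at b, so an index
    that is good for b is good for all such x. The index m below depends on x, but only serves to
    compare with [expR x]. *)
Lemma exp_series_unif (R : realType) (b e : R) : 0 < e ->
  exists n : nat, forall x, `|x| <= b ->
    `|expR x - series (exp_coeff x) n| <= e.
Proof.
move=> e0.
have cvgx (x : R) : series (exp_coeff x) @ \oo --> expR x.
  rewrite expRE /pseries -exp_coeffE; exact: is_cvg_series_exp_coeff.
have e20 : 0 < e / 4 by rewrite divr_gt0.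
have /cvgrPdist_le/(_ _ e20)[n _ h] := cvgx b.
exists n => x xb.
have /cvgrPdist_le/(_ _ e20)[m _ hx] := cvgx x.
have b0 : 0 <= b by rewrite (le_trans _ xb).
have nk : (n <= maxn m n)%N by rewrite leq_maxr.
have mk : (m <= maxn m n)%N by rewrite leq_maxl.
set k := maxn m n in nk mk.
have sub (y : R) : series (exp_coeff y) k - series (exp_coeff y) n =
    \sum_(n <= i < k) exp_coeff y i.
  by rewrite /series/= (big_cat_nat (leq0n n) nk)/= [X in X - _]addrC addrK.
have le1 : `|series (exp_coeff x) k - series (exp_coeff x) n| <=
    series (exp_coeff b) k - series (exp_coeff b) n.
  rewrite !sub (le_trans (ler_norm_sum _ _ _))// ler_sum// => i _.
  rewrite /exp_coeff/= normrM normrX (ger0_norm (x := _^-1)) ?invr_ge0//.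
  by rewrite ler_wpM2r ?invr_ge0// lerXn2r.
have le2 : series (exp_coeff b) k - series (exp_coeff b) n <= e / 4 + e / 4.
  have := h k nk; have := h n (leqnn n).
  rewrite !ler_norml => /andP[_ +] /andP[+ _]; lra.
have := hx k mk; move: le1 le2; rewrite /= !ler_norml.
set a := series _ _; set c := series _ _.
move=> /andP[? ?] ? /andP[? ?]; apply/andP; split; lra.
Qed.

Section uexp.
Context (R : realType) (T : Type) (L : set (T -> R)).
Hypothesis Llin : linear_family L.

Lemma utrig_exp u : utrig L u -> utrig L (fun x => expR (u x)).
Proof.
move=> uu; apply: utrig_unif => e e0.
have [b b0 ub] := utrig_bounded uu.
have [n hn] := exp_series_unif b e0.
exists (fun x => series (exp_coeff (u x)) n) => [|x]; last exact/hn/ub.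
rewrite (_ : (fun _ => _) = fun x => \sum_(0 <= i < n) i`!%:R^-1 * u x ^+ i).
  apply: utrig_sum => // i; apply: utrigM => //; first exact: utrig_cst.
  exact: utrigX.
by apply/funext => x; rewrite exp_coeffE.
Qed.

End uexp.
(** Induction over compact sets: a property that is inherited by subsets and finite unions passes
    from small neighbourhoods to the whole of K. Finite subcovers never have to be named. *)
Lemma compact_ind (T : topologicalType) (K : set T) (Phi : set T -> Prop) :
  compact K -> Phi set0 ->
  (forall A B, Phi A -> Phi B -> Phi (A `|` B)) ->
  (forall A B, A `<=` B -> Phi B -> Phi A) ->
  (forall x, K x -> exists2 N, nbhs x N & Phi N) -> Phi K.
Proof.
move=> /compact_near_coveringP cK Phi0 PhiU PhiS Phin.
(* A family of sets is in [F] when it contains all supersets of some set satisfying [Phi].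
   Near-covering compactness then says that eventually along [F] the whole of K is covered. *)
pose F : set_system (set T) := filter_from Phi (fun A => [set B | A `<=` B]).
have FF : Filter F.
  apply: filter_from_filter; first by exists set0.
  move=> A B PA PB; exists (A `|` B); first exact: PhiU.
  by move=> C /= ABC; split; apply: subset_trans ABC; [left|right].
have [x Kx|B PhiB /(_ B (@subset_refl _ B)) KB] := cK _ F (fun B x => B x) FF.
  have [N xN PN] := Phin _ Kx.
  exists (N, [set B | N `<=` B]) => /=.
    by split => //; exists N.
  by move=> [y B] /= [Ny]; apply.
exact: PhiS KB PhiB.
Qed.

Section separation.
Context (R : realType) (T : topologicalType) (P : set (T -> R)).
Hypothesis Pcst : forall c, P (fun=> c).
Hypothesis PD : forall u v, P u -> P v -> P (fun x => u x + v x).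
Hypothesis PM : forall u v, P u -> P v -> P (fun x => u x * v x).
Hypothesis Pexp : forall u, P u -> P (fun x => expR (u x)).

(** A Urysohn function inside an algebra closed under exponentials. Continuity is asked only of the
    functions that separate pairs of points; the bounds 0 and 1 hold on the whole space, which
    matters when integrating off the compact sets. *)
Lemma compact_separation (K K' : set T) : compact K -> compact K' ->
  (forall x y, K x -> K' y -> exists u, [/\ P u, continuous u & u x <> u y]) ->
  forall e : R, 0 < e -> exists w, [/\ P w, (forall z, 0 <= w z <= 1),
    (forall z, K z -> 1 - e <= w z) & forall z, K' z -> w z <= e].
Proof.
move=> cK cK' sep.
(* Sums of squares: each point y of K' contributes a square that vanishes at x and equals 1 at y. *)
have step1 x : K x -> exists u, [/\ P u, continuous u, u x = 0,
    forall z, 0 <= u z & forall z, K' z -> 1 / 2 <= u z].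
  move=> Kx; apply: (compact_ind (Phi := fun A => exists u, [/\ P u, continuous u,
    u x = 0, forall z, 0 <= u z & forall z, A z -> 1 / 2 <= u z])) cK' _ _ _ _.
  - by exists (fun=> 0); split => // y; exact: cvg_cst.
  - move=> A B [u [Pu cu ux u0 uA]] [v [Pv cv vx v0 vB]].
    exists (fun x => u x + v x); split => //.
    + exact: PD.
    + by move=> y; apply: cvgD; [exact: cu|exact: cv].
    + by rewrite ux vx addr0.
    + by move=> z; rewrite addr_ge0.
    + by move=> z [/uA|/vB] h; have := u0 z; have := v0 z; lra.
  - by move=> A B AB [u [? ? ? ? h]]; exists u; split => // z /AB /h.
  - move=> y K'y; have [u [Pu cu uxy]] := sep _ _ Kx K'y.
    pose c := (u y - u x)^-1.
    pose v z := (c * (u z - u x)) * (c * (u z - u x)).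
    have cv : continuous v.
      move=> z; apply: cvgM; apply: cvgM; try exact: cvg_cst;
        apply: cvgB; try exact: cvg_cst; exact: cu.
    have vy : v y = 1.
      rewrite /v /c mulVf ?mulr1// subr_eq0; apply/eqP => h; exact: uxy.
    exists [set z | 1 / 2 < v z].
      have : v z @[z --> y] --> v y by exact: cv.
      move=> /cvgr_gt /(_ (1/2)); rewrite vy; apply; lra.
    exists v; split => //.
    + by apply: PM; apply: PM => //; apply: PD.
    + by rewrite /v subrr mulr0 mulr0.
    + by move=> z; rewrite /v -expr2 sqr_ge0.
    + by move=> z /= /ltW.
(* The function exp(t (1/8 - u)) is at least 1 where u < 1/8 and tiny where u >= 1/2, for t large.
   The quantifier on e lies inside the inductive property, since a union splits e in two. *)
have step2 : forall e : R, 0 < e -> exists w, [/\ P w, (forall z, 0 <= w z),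
    (forall z, K z -> 1 <= w z) & forall z, K' z -> w z <= e].
  apply: (compact_ind (Phi := fun A => forall e : R, 0 < e -> exists w, [/\ P w,
    (forall z, 0 <= w z), (forall z, A z -> 1 <= w z) &
    forall z, K' z -> w z <= e])) cK _ _ _ _.
  - by move=> e e0; exists (fun=> 0); split => // z _; exact: ltW.
  - move=> A B hA hB e e0; have e2 : 0 < e / 2 by rewrite divr_gt0.
    have [u [Pu u0 uA uK]] := hA _ e2; have [v [Pv v0 vA vK]] := hB _ e2.
    exists (fun x => u x + v x); split => //.
    + exact: PD.
    + by move=> z; rewrite addr_ge0.
    + by move=> z [/uA|/vA] h; have := u0 z; have := v0 z; lra.
    + by move=> z K'z; rewrite (splitr e) lerD ?uK ?vK.
  - move=> A B AB h e /h[w [? ? wB ?]]; exists w; split => // z /AB; exact: wB.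
  - move=> x /step1[u [Pu cu ux u0 uK]].
    exists [set z | u z < 1 / 8].
      have : u z @[z --> x] --> u x by exact: cu.
      move=> /cvgr_lt /(_ (1/8)); rewrite ux; apply; lra.
    move=> e e0; pose t := 4 / e.
    have t0 : 0 < t by rewrite divr_gt0.
    exists (fun z => expR (t / 8 + (- t) * u z)); split.
    + by apply: Pexp; apply: PD => //; apply: PM.
    + by move=> z; exact: expR_ge0.
    + move=> z /= uz; apply: le_trans (expR_ge1Dx _); rewrite lerDl.
      by nra.
    + move=> z /uK h; apply: (@le_trans _ _ (expR (- (t / 4)))).
        by rewrite ler_expR; nra.
      rewrite expRN -[leRHS]invrK lef_pV2 ?posrE ?expR_gt0 ?invr_gt0//.
      apply: le_trans (expR_ge1Dx _); rewrite /t -mulrA mulrCA divff// mulr1.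
      by rewrite lerDr.
move=> e e0.
have [w [Pw w0 wK wK']] := step2 (e * e) (mulr_gt0 e0 e0).
(* The map w -> 1 - exp(-w/e) brings the values into [0, 1]; it exceeds 1 - e for w >= 1 and stays
   below e for w <= e^2, whence the tolerance e^2 just above. *)
exists (fun z => 1 + (-1) * expR ((- e^-1) * w z)); split.
- by apply: PD => //; apply: PM => //; apply: Pexp; apply: PM.
- move=> z; rewrite mulN1r subr_ge0 gerBl expR_ge0 andbT -[leRHS]expR0 ler_expR.
  by rewrite mulNr oppr_le0 mulr_ge0// invr_ge0 ltW.
- move=> z /wK h; rewrite mulN1r lerD2l lerN2.
  apply: (@le_trans _ _ (expR (- e^-1))).
    by rewrite ler_expR mulNr lerN2 ler_peMr// invr_ge0 ltW.
  rewrite expRN -[leRHS]invrK lef_pV2 ?posrE ?expR_gt0 ?invr_gt0//.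
  by apply: le_trans (expR_ge1Dx _); rewrite lerDr.
- move=> z /wK' h; rewrite mulN1r.
  have : e^-1 * w z <= e.
    by rewrite mulrC ler_pdivrMr.
  have := expR_ge1Dx (- e^-1 * w z); rewrite mulNr; lra.
Qed.

End separation.

(** Discrete layer-cake formula: the sum counts the thresholds k + 1 below N y, so it is the integer
    part j of N y. *)
Lemma layer_approx (R : realType) (N : nat) (y : R) : (0 < N)%N -> 0 <= y <= 1 ->
  exists j : nat, (forall k : nat, (k.+1%:R <= N%:R * y) = (k < j)%N) /\
  `|y - N%:R^-1 * \sum_(k < N) (k.+1%:R <= N%:R * y)%R%:R| <= N%:R^-1.
Proof.
move=> N0 /andP[y0 y1].
have N0' : 0 < N%:R :> R by rewrite ltr0n.
have Ny0 : 0 <= N%:R * y by rewrite mulr_ge0.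
set j := Num.truncn (N%:R * y).
have hj : forall k : nat, (k.+1%:R <= N%:R * y) = (k < j)%N.
  by move=> k; rewrite -truncn_ge_nat.
exists j; split => //.
have jN : (j <= N)%N.
  rewrite leqNgt -hj -ltNge (@le_lt_trans _ _ N%:R)//; first by rewrite ler_piMr.
  by rewrite ltr_nat.
under eq_bigr do rewrite hj.
have -> : \sum_(k < N) ((k < j)%N)%:R = j%:R :> R.
  have sumE n : (\sum_(k < n) (k < j) = minn n j)%N.
    elim: n => [|n ih]; first by rewrite big_ord0 min0n.
    by rewrite big_ord_recr/= ih; case: (ltngtP n j) => /= ?; lia.
  by rewrite -natr_sum sumE (minn_idPr jN).
have /andP[j1 j2] := truncn_itv Ny0.
rewrite -/j in j1 j2.
have -> : y - N%:R^-1 * j%:R = N%:R^-1 * (N%:R * y - j%:R).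
  by rewrite mulrBr mulKf// gt_eqF.
rewrite normrM ger0_norm ?invr_ge0// ler_piMr ?invr_ge0// ger0_norm ?subr_ge0//.
by rewrite lerBlDl natr1 ltW.
Qed.

(** * Continuous functions of uniform limits of trigonometric polynomials *)

Section calculus.
Context (R : realType) (T : Type) (L : set (T -> R)).
Hypothesis Llin : linear_family L.

(** Layer-cake with smoothed layers: the indicator of N G >= k + 1 is replaced by a function
    separating the compact sets N G >= k + 1 and N G <= k of the interval [-b, b]. *)
Let utrig_comp01 (u : T -> R) (b : R) (G : R -> R) : utrig L u -> (forall x, `|u x| <= b) ->
  continuous G -> (forall t, `|t| <= b -> 0 <= G t <= 1) -> utrig L (G \o u).
Proof.
move=> uu ub cG G01; apply: utrig_unif => e e0.
(* Separation takes place on the real line, in the algebra of those v for which v(u) lies in the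
   closure; the identity is one of them and separates points. *)
pose P := [set v : R -> R | utrig L (v \o u)].
have [N N0 Ne] : exists2 N : nat, (0 < N)%N & 3 * N%:R^-1 <= e.
  exists (Num.truncn (3 / e)).+1 => //.
  rewrite ler_pdivrMr ?ltr0n// mulrC -ler_pdivrMr//.
  by apply: ltW; apply: truncnS_gt.
have N0' : 0 < N%:R :> R by rewrite ltr0n.
have cpt (A : set R) : closed A -> compact ([set t : R | `|t| <= b] `&` A).
  move=> cA; apply: compact_closedI => //.
  have -> : [set t : R | `|t| <= b] = `[- b, b]%classic.
    by apply/seteqP; split=> t /=; rewrite in_itv/= ler_norml.
  exact: segment_compact.
have cNG : continuous (fun t => N%:R * G t).
  by move=> t; apply: cvgM; [exact: cvg_cst|exact: cG].
have hv (k : nat) : exists v, [/\ P v, (forall z, 0 <= v z <= 1),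
    (forall z, `|z| <= b -> k.+1%:R <= N%:R * G z -> 1 - N%:R^-1 <= v z) &
    forall z, `|z| <= b -> N%:R * G z <= k%:R -> v z <= N%:R^-1].
  have c1 := cpt _ (closed_comp (in1W cNG) (@closed_ge _ k.+1%:R)).
  have c2 := cpt _ (closed_comp (in1W cNG) (@closed_le _ k%:R)).
  have := @compact_separation _ _ P _ _ _ _ _ _ c1 c2 _ N%:R^-1.
  case.
  - move=> c; exact: utrig_cst.
  - by move=> v w Pv Pw; exact: utrigD.
  - by move=> v w Pv Pw; exact: utrigM.
  - by move=> v Pv; exact: utrig_exp.
  - move=> x y [/= _ kx] [/= _ ky]; exists idfun; split => //=.
      by move=> z; exact: cvg_id.
    by move=> xy; move: ky; rewrite -xy leNgt (lt_le_trans _ kx)// ltr_nat.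
  - by rewrite invr_gt0.
  - move=> v [Pv v01 v1 v2]; exists v; split => // z zb h; [exact: v1|exact: v2].
have {hv}[v hv] := choice hv.
exists (fun x => N%:R^-1 * \sum_(k < N) v k (u x)).
  apply: utrigM; [by []|exact: utrig_cst|].
  by apply: utrig_sum => // k; have [] := hv k.
move=> x /=; set y := G (u x).
have [j [hj le1]] := layer_approx N0 (G01 _ (ub x)); rewrite -/y in hj le1.
set S := \sum_(k < N) _ in le1.
(* Only the layer k = j falls in the gap between the two compact sets, where [v k] is not
   controlled; it costs at most 1, and the others cost at most 1/N each. *)
have le2 : `|S - \sum_(k < N) v k (u x)| <= 2.
  rewrite /S -sumrB (le_trans (ler_norm_sum _ _ _))//.
  apply: (@le_trans _ _ (\sum_(k < N) (N%:R^-1 + (k == j :> nat)%:R))).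
    apply: ler_sum => k _; have [_ v01 v1 v2] := hv k.
    have /andP[v0 v1'] := v01 (u x).
    rewrite hj; have [kj|jk|kj] := ltngtP k j; rewrite /= ?addr0.
    - rewrite ger0_norm ?subr_ge0// lerBlDl -lerBlDr; apply: v1 => //.
      by rewrite hj.
    - rewrite sub0r normrN ger0_norm//; apply: v2 => //.
      by apply: ltW; rewrite ltNge -(prednK (leq_ltn_trans (leq0n j) jk)) hj -ltnNge prednK// (leq_ltn_trans _ jk).
    - by rewrite sub0r normrN ger0_norm// (le_trans v1')// lerDr invr_ge0.
  rewrite big_split/= sumr_const card_ord -[X in X + _]mulr_natl divff ?gt_eqF//.
  rewrite -natr_sum -[leRHS]/(2%:R) -[X in X + _]/(1%:R) -natrD ler_nat ltnS.
  have [jN|jN] := ltnP j N.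
    rewrite (bigD1 (Ordinal jN))//= eqxx big1// => i.
    by rewrite -val_eqE/= => /negbTE ->.
  rewrite big1// => i _; case: eqP => // ij; move: (ltn_ord i).
  by rewrite ij ltnNge jN.
apply: le_trans Ne.
have -> : y - N%:R^-1 * \sum_(k < N) v k (u x) =
  (y - N%:R^-1 * S) + N%:R^-1 * (S - \sum_(k < N) v k (u x)) by ring.
rewrite (le_trans (ler_normD _ _))// normrM (ger0_norm (x := _^-1)) ?invr_ge0//.
have : N%:R^-1 * `|S - \sum_(k < N) v k (u x)| <= N%:R^-1 * 2.
  by rewrite ler_wpM2l ?invr_ge0.
by lra.
Qed.

(** As u is bounded, an affine rescaling brings F into [0, 1] on the range of u. It is applied below
    to F = |.|^q. *)
Lemma utrig_comp u (F : R -> R) : utrig L u -> continuous F -> utrig L (F \o u).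
Proof.
move=> uu cF; have [b b0 ub] := utrig_bounded uu.
have [M M0 FM] : exists2 M, 0 < M & forall t, `|t| <= b -> `|F t| <= M.
  have bb : - b <= b by rewrite ge0_cp// ltW.
  have cF' : {within `[- b, b], continuous (fun t => `|F t|)}.
    by apply: continuous_subspaceT => t; apply: cvg_norm; exact: cF.
  have [c _ hc] := EVT_max bb cF'.
  exists (1 + `|F c|) => [|t tb]; first by rewrite ltr_pwDl.
  by rewrite (le_trans (hc t _)) ?lerDr// in_itv/= -ler_norml.
pose G t := (2 * M)^-1 * (F t + M).
have M20 : 0 < 2 * M by rewrite mulr_gt0.
have cG : continuous G.
  by move=> t; apply: cvgM; [exact: cvg_cst|apply: cvgD; [exact: cF|exact: cvg_cst]].
have : utrig L (G \o u).
  apply: (utrig_comp01 uu ub cG) => t /FM; rewrite ler_norml => /andP[h1 h2].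
  rewrite /G mulr_ge0 ?invr_ge0 ?(ltW M20)//=; last by lra.
  by rewrite mulrC ler_pdivrMr//; lra.
move=> h.
have -> : F \o u = fun x => 2 * M * (G \o u) x + - M.
  by apply/funext => x; rewrite /G/= mulrA divff ?gt_eqF// mul1r addrK.
by apply: utrigD; [apply: utrigM|]; try exact: utrig_cst.
Qed.

End calculus.

(** * The Hahn-Banach theorem *)

Section sublinear.
Context (R : realType) (E : lmodType R).
Implicit Types (p q : E -> R) (x y z : E).

Definition sublinear q := (forall x y, q (x + y) <= q x + q y) /\
  (forall t x, 0 < t -> q (t *: x) = t * q x).

Lemma sublinear0 q : sublinear q -> q 0 = 0.
Proof.
move=> [_ /(_ 2 0 (ltr0n _ 2))]; rewrite scaler0 => h; lra.
Qed.

Lemma sublinearZ q t x : sublinear q -> 0 <= t -> q (t *: x) = t * q x.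
Proof.
move=> sq; rewrite le_eqVlt => /predU1P[<-|]; last exact: sq.2.
by rewrite scale0r mul0r sublinear0.
Qed.

Lemma sublinearN q x : sublinear q -> - q (- x) <= q x.
Proof.
by move=> sq; have := sq.1 x (- x); rewrite subrr sublinear0// => h; lra.
Qed.

Lemma sublinear_homog q : (forall x y, q (x + y) <= q x + q y) ->
  (forall t x, 0 < t -> q (t *: x) <= t * q x) -> sublinear q.
Proof.
move=> qD qZ; split=> // t x t0; apply/eqP; rewrite eq_le qZ//=.
have := qZ t^-1 (t *: x); rewrite invr_gt0 scalerA mulVf ?gt_eqF// scale1r => /(_ t0).
by rewrite mulrC ler_pdivlMr// mulrC.
Qed.

(* dir q z is sublinear and at most q; so if q is minimal, dir q z = q, which
   says q x <= q (x + z) - q z, and q is additive. *)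
Let dir_set q z x := [set q (x + t *: z) - t * q z | t in [set t | 0 <= t]].

Definition dir q z x := inf (dir_set q z x).

Let dir_set_lb q z x : sublinear q -> lbound (dir_set q z x) (- q (- x)).
Proof.
move=> sq _ [t /= t0 <-]; have := sq.1 (x + t *: z) (- x).
by rewrite addrAC subrr add0r sublinearZ// => h; lra.
Qed.

Let dir_set0 q z x : dir_set q z x !=set0.
Proof. by exists (q (x + 0 *: z) - 0 * q z); exists 0 => /=. Qed.

Lemma dir_le q z x t : sublinear q -> 0 <= t -> dir q z x <= q (x + t *: z) - t * q z.
Proof.
by move=> sq t0; apply: ge_inf; [exists (- q (- x)); exact: dir_set_lb|exists t].
Qed.

Lemma sublinear_dir q z : sublinear q -> sublinear (dir q z).
Proof.
move=> sq; apply: sublinear_homog => [x y|r x r0].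
- rewrite -lerBlDr; apply: lb_le_inf => // _ [s /= s0 <-].
  rewrite lerBlDr -lerBlDl; apply: lb_le_inf => // _ [t /= t0 <-].
  have := @dir_le q z (x + y) (s + t) sq (addr_ge0 s0 t0).
  have := sq.1 (x + s *: z) (y + t *: z).
  by rewrite addrACA -scalerDl => h1 h2; lra.
- rewrite mulrC -ler_pdivrMr//; apply: lb_le_inf => // _ [t /= t0 <-].
  rewrite ler_pdivrMr//.
  have rt0 : 0 <= r * t by rewrite mulr_ge0// ltW.
  have := @dir_le q z (r *: x) (r * t) sq rt0.
  rewrite -scalerA -scalerDr sq.2// => h.
  apply: le_trans h _; nra.
Qed.

(** Zorn's lemma is applied, downwards, to sublinear functionals on the whole space rather than to
    linear ones on subspaces: a minimal sublinear functional is linear, by comparison with [dir]. *)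
Lemma hahn_banach p : sublinear p -> exists l : E -> R,
  [/\ (forall x y, l (x + y) = l x + l y), (forall t x, l (t *: x) = t * l x) &
  forall x, l x <= p x].
Proof.
move=> sp.
pose S := {q : E -> R | sublinear q /\ forall x, q x <= p x}.
pose le (q r : S) : bool := `[< forall x, sval r x <= sval q x >].
have [||||[q [sq qp]] qmin] := @Zorn S le.
- by move=> q; apply/asboolP.
- move=> q r s /asboolP qr /asboolP rs; apply/asboolP => x.
  exact: le_trans (rs x) (qr x).
- move=> [q hq] [r hr] /asboolP /= qr /asboolP /= rq; apply: eq_exist.
  by apply/funext => x; apply/eqP; rewrite eq_le qr rq.
- move=> A tA; have [A0|/set0P/negP/negPn/eqP A0] := pselect (A !=set0); last first.
    by exists (exist _ p (conj sp (fun x => lexx _))) => s; rewrite A0.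
  pose V x := [set sval s x | s in A].
  pose m x := inf (V x).
  have V0 x : V x !=set0 by have [s As] := A0; exists (sval s x), s.
  have Vlb x : lbound (V x) (- p (- x)).
    move=> _ [s As <-]; have [ss sp'] := svalP s.
    by apply: le_trans (sublinearN x ss); rewrite lerN2.
  have mle s x : A s -> m x <= sval s x.
    by move=> As; apply: ge_inf; [exists (- p (- x)); exact: Vlb|exists s].
  have sm : sublinear m.
    apply: sublinear_homog => [x y|r x r0].
    + rewrite -lerBlDr; apply: lb_le_inf => // _ [s As <-].
      rewrite lerBlDr -lerBlDl; apply: lb_le_inf => // _ [t At <-].
      have [[sD _] _] := svalP s; have [[tD _] _] := svalP t.
      have := mle _ (x + y) As; have := mle _ (x + y) At.
      (* An infimum of sublinear functionals is subadditive along a chain: of the two competitors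
         for x and for y, the smaller one serves for both. *)
      have [/asboolP h|/asboolP h] := tA _ _ As At.
      * by have := tD x y; have := h x; have := h y; lra.
      * by have := sD x y; have := h x; have := h y; lra.
    + rewrite mulrC -ler_pdivrMr//; apply: lb_le_inf => // _ [s As <-].
      by rewrite ler_pdivrMr// mulrC; have [[_ <-//] _] := svalP s; exact: mle.
  have mp x : m x <= p x.
    by have [s As] := A0; apply: le_trans (mle _ x As) _; have [_] := svalP s.
  by exists (exist _ m (conj sm mp)) => s As; apply/asboolP => x /=; exact: mle.
have qD x z : q (x + z) = q x + q z.
  have sd := sublinear_dir z sq.
  have dq y : dir q z y <= q y.
    by have := @dir_le q z y 0 sq (lexx _); rewrite scale0r addr0 mul0r subr0.
  have dp y : dir q z y <= p y by exact: le_trans (dq y) (qp y).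
  have := qmin (exist _ (dir q z) (conj sd dp)).
  have h : le (exist _ q (conj sq qp)) (exist _ (dir q z) (conj sd dp)) by apply/asboolP.
  move=> /(_ h)/(congr1 sval)/= /(congr1 (fun f => f x)) dqx.
  have := @dir_le q z x 1 sq ler01; rewrite scale1r mul1r dqx.
  by have := sq.1 x z; lra.
have qN x : q (- x) = - q x.
  by have := qD x (- x); rewrite subrr sublinear0//; lra.
exists q; split=> // t x; have [t0|t0] := leP 0 t; first exact: sublinearZ.
by rewrite -[t]opprK scaleNr qN sublinearZ ?mulNr// oppr_ge0 ltW.
Qed.

(** Dominating by [dir p z] instead of p forces l(-z) <= p(-z + z) - p(z) = -p(z). This replaces the
    extension of a functional given on the line through z. *)
Lemma hahn_banach_pos p z : sublinear p -> 0 < p z -> exists l : E -> R,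
  [/\ (forall x y, l (x + y) = l x + l y), (forall t x, l (t *: x) = t * l x),
  (forall x, l x <= p x) & 0 < l z].
Proof.
move=> sp pz.
have [l [lD lZ ld]] := hahn_banach (sublinear_dir z sp).
exists l; split=> // [x|].
  apply: le_trans (ld x) _.
  by have := @dir_le p z x 0 sp (lexx _); rewrite scale0r addr0 mul0r subr0.
have := ld (- z); have := @dir_le p z (- z) 1 sp ler01.
rewrite scale1r addNr sublinear0// mul1r -scaleN1r lZ; lra.
Qed.

End sublinear.

(** * Continuous functionals separate points *)

Section separate_points.
Context (R : realType) (X : tvsType R).

(** The positive Hahn-Banach theorem for the Minkowski gauge of a convex neighbourhood U of 0 that
    misses x - y, where the gauge is therefore at least 1. *)
Lemma topdual_separates (x y : X) : hausdorff_space X -> x <> y ->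
  exists2 l : X -> R, topdual l & l x <> l y.
Proof.
rewrite open_hausdorff => hX /eqP xy.
have xy0 : 0 != x - y by rewrite eq_sym subr_eq0.
have [[A B] /= [A0 Bxy] [oA oB AB]] := hX _ _ xy0.
have nA : nbhs 0 A by apply: open_nbhs_nbhs; split => //; exact: set_mem.
have [BB convB [oBB bB]] := @locally_convex R X.
have [U [BU U0] UA] := bB 0 _ nA.
have nU : nbhs 0 U by apply: open_nbhs_nbhs; split => //; exact: oBB.
have cU a b t : U a -> U b -> 0 <= t <= 1 -> U (t *: a + (1 - t) *: b).
  move=> Ua Ub /andP[t0 t1]; have := convB U (mem_set BU) a b (Itv01 t0 t1).
  by rewrite !inE; apply.
have nUz : ~ U (x - y).
  move=> /UA Az; move/eqP/seteqP : AB => [+ _] => /(_ (x - y)); apply; split => //.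
  exact: set_mem.
(* The gauge of U at z is the infimum of [V z], which is nonempty because U absorbs z. *)
pose V z := [set t : R | 0 < t /\ U (t^-1 *: z)].
have Vup z t s : V z t -> t <= s -> V z s.
  move=> [t0 Ut] ts; have s0 := lt_le_trans t0 ts; split => //.
  have -> : s^-1 *: z = (t / s) *: (t^-1 *: z) + (1 - t / s) *: 0.
    by rewrite scaler0 addr0 scalerA mulrAC divff ?gt_eqF// mul1r.
  by apply: cU => //; rewrite divr_ge0 ?(ltW t0) ?(ltW s0)//= ler_pdivrMr// mul1r.
have V0 z : V z !=set0.
  have h : t *: z @[t --> (0 : R)] --> (0 : R) *: z.
    apply: (@continuous_comp R (R^o * X)%type X (fun t => (t, z)) (fun u => u.1 *: u.2)).
      by apply: (@cvg_pair _ _ _ _ (nbhs (0 : R^o))); [exact: cvg_id|exact: cvg_cst].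
    exact: scale_continuous.
  rewrite scale0r in h; have /nbhs_ballP[e /= e0 he] := h _ nU.
  exists (e / 2)^-1; split; first by rewrite invr_gt0 divr_gt0.
  rewrite invrK; apply: he; rewrite /ball/= sub0r normrN gtr0_norm ?divr_gt0//.
  by rewrite ltr_pdivrMr// ltr_pMr// ltr1n.
pose p z := inf (V z).
have Vlb z : lbound (V z) 0 by move=> t [/ltW].
have ple z t : V z t -> p z <= t by move=> Vt; apply: ge_inf => //; exists 0; exact: Vlb.
have sp : sublinear p.
  apply: sublinear_homog => [a b|r a r0].
  - rewrite -lerBlDr; apply: lb_le_inf => // s [s0 Us].
    rewrite lerBlDr -lerBlDl; apply: lb_le_inf => // t [t0 Ut].
    rewrite lerBlDr; apply: ple; split; first exact: addr_gt0.
    have st0 : 0 < t + s by exact: addr_gt0.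
    have -> : (t + s)^-1 *: (a + b) = (s / (t + s)) *: (s^-1 *: a) + (1 - s / (t + s)) *: (t^-1 *: b).
      have -> : 1 - s / (t + s) = t / (t + s) by field; rewrite gt_eqF.
      by rewrite !scalerA ![_ / (t + s) / _]mulrAC !divff ?gt_eqF// !mul1r -scalerDr.
    apply: cU => //; rewrite divr_ge0 ?(ltW s0) ?(ltW st0)//= ler_pdivrMr// mul1r.
    by rewrite lerDr ltW.
  - rewrite mulrC -ler_pdivrMr//; apply: lb_le_inf => // t [t0 Ut].
    rewrite ler_pdivrMr//; apply: ple; split; first exact: mulr_gt0.
    by rewrite scalerA invfM -mulrA mulVf ?gt_eqF// mulr1.
have pz : 0 < p (x - y).
  apply: (@lt_le_trans _ _ 1) => //; apply: lb_le_inf => // t Vt.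
  rewrite leNgt; apply/negP => /ltW t1; apply: nUz.
  by have [_] := Vup _ _ _ Vt t1; rewrite invr1 scale1r.
have [l [lD lZ lp lz]] := hahn_banach_pos sp pz.
have lB a b : l (a - b) = l a - l b by rewrite lD -scaleN1r lZ mulN1r.
exists l; last by move=> lxy; move: lz; rewrite lB lxy subrr ltxx.
split; first by move=> a u v; rewrite lD lZ.
have lU a : U a -> l a <= 1.
  by move=> Ua; apply: le_trans (lp a) _; apply: ple; split => //; rewrite invr1 scale1r.
move=> z; apply/cvgrPdist_le => e e0.
have e0' : e != 0 by rewrite gt_eqF.
have nW : nbhs 0 (U `&` (-%R @` U)) by apply: filterI => //; exact: nbhs0N.
(* Continuity: l is bounded by 1 in absolute value on U and -U together, so it varies by at most e
   on the corresponding neighbourhood of z. *)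
have := nbhsT z (nbhs0Z e0' nW); apply: filterS => _ [_ [w [Uw [w' Uw' ww']] <-] <-].
have -> : l z - l (z + e *: w) = - (e * l w) by rewrite lD lZ opprD addNKr.
rewrite normrN normrM gtr0_norm// ler_piMr ?(ltW e0)// ler_norml lU// andbT.
by have := lU _ Uw'; rewrite -(opprK w') ww' -scaleN1r lZ; lra.
Qed.

End separate_points.

(** * Integration and one-dimensional Gaussian laws *)

Section integral_facts.
Context d (T : measurableType d) (R : realType) (mu : {measure set T -> \bar R}).
Implicit Types (f g h : T -> R).

Local Notation integrable f := (mu.-integrable setT (EFin \o f)).

Lemma le_integrable_norm f g : measurable_fun setT f ->
  (forall x, `|f x| <= g x) -> integrable g -> integrable f.
Proof.
move=> mf fg; apply: le_integrable => //; first exact/measurable_EFinP.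
by move=> x _ /=; rewrite lee_fin (le_trans (fg x))// ler_norm.
Qed.

Lemma integrableM_bounded f h (b : R) : integrable f -> measurable_fun setT h ->
  (forall x, `|h x| <= b) -> integrable (fun x => h x * f x).
Proof.
move=> intf mh hb; have mf : measurable_fun setT f.
  by have /measurable_EFinP := measurable_int mu intf.
apply: (@le_integrable_norm _ (fun x => b * `|f x|)).
- exact: measurable_funM.
- by move=> x; rewrite normrM ler_wpM2r.
- apply: (@eq_integrable _ _ _ mu _ measurableT (fun x => b%:E * (`|f x|)%:E)%E) => //.
  exact/integrableZl/integrable_norm.
Qed.

Lemma integrable_add f g : integrable f -> integrable g ->
  integrable (fun x => f x + g x).
Proof. by move=> intf intg; exact: (integrableD measurableT intf intg). Qed.

Lemma integrable_scale (a : R) f : integrable f -> integrable (fun x => a * f x).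
Proof. by move=> intf; exact: (integrableZl measurableT a intf). Qed.

Lemma integrable_sub f g : integrable f -> integrable g ->
  integrable (fun x => f x - g x).
Proof. by move=> intf intg; exact: (integrableB measurableT intf intg). Qed.

Lemma integrable_sumr (I : Type) (r : seq I) (F : I -> T -> R) :
  (forall i, integrable (F i)) -> integrable (fun x => \sum_(i <- r) F i x).
Proof.
move=> h; elim: r => [|i r ih].
  by apply: eq_integrable (integrable0 mu setT) => // x _; rewrite /= big_nil.
apply: eq_integrable (integrable_add (h i) ih) => // x _.
by rewrite /= big_cons.
Qed.

Lemma Rintegral_sum (I : Type) (r : seq I) (F : I -> T -> R) :
  (forall i, integrable (F i)) ->
  \int[mu]_x (\sum_(i <- r) F i x) = \sum_(i <- r) \int[mu]_x F i x.
Proof.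
move=> h; elim: r => [|i r ih].
  under eq_Rintegral do rewrite big_nil.
  by rewrite big_nil Rintegral_cst// mul0r.
under eq_Rintegral do rewrite big_cons.
by rewrite RintegralD// ?ih ?big_cons//; exact: integrable_sumr.
Qed.

Lemma derive_under_Rintegral (f f' : R -> T -> R) (G : T -> R) (a u v : R) :
  u < a < v ->
  (forall x, u < x < v -> integrable (f x)) ->
  (forall x y, u < x < v -> is_derive x 1 (f ^~ y) (f' x y)) ->
  integrable G -> (forall x y, u < x < v -> `|f' x y| <= G y) ->
  is_derive a 1 (fun x => \int[mu]_y f x y) (\int[mu]_y f' a y).
Proof.
move=> auv intf df intG leG.
have Ia : `]u, v[%classic a by rewrite /= in_itv.
have dfE x y : u < x < v -> (partial1of2 f) x y = f' x y.
  by move=> xuv; rewrite partial1of2E; have /@derive_val := df x y xuv.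
have intf' x : `]u, v[%classic x -> integrable (f x).
  by rewrite /= in_itv/= => /intf.
have df' x y : `]u, v[%classic x -> setT y -> derivable (f ^~ y) x 1.
  by rewrite /= in_itv/= => xuv _; have [] := df x y xuv.
have G0 y : 0 <= G y by apply: le_trans (leG a y auv).
have leG' x y : `]u, v[%classic x -> setT y -> `|partial1of2 f x y| <= G y.
  by rewrite /= in_itv/= => xuv _; rewrite dfE// leG.
have := @derivable_under_integral R d T mu f setT measurableT a u v Ia intf' df' G G0 intG leG'.
have := @differentiation_under_integral R d T mu f setT measurableT a u v Ia intf' df' G G0 intG leG'.
rewrite derive1E => h1 h2.
apply: DeriveDef => //; rewrite h1; apply: eq_Rintegral => y _.
exact: dfE.
Qed.

End integral_facts.

Lemma Rintegral_prob_cst d (T : measurableType d) (R : realType)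
  (P : probability T R) (c : R) : \int[P]_x c = c.
Proof. by rewrite /Rintegral integral_cst//= probability_setT mule1. Qed.

Section density.
Context d (T : measurableType d) (R : realType) (mu nu : {measure set T -> \bar R})
  (w : T -> R).
Hypotheses (mw : measurable_fun setT w) (w0 : forall x, 0 <= w x).
Hypothesis nuE : forall A, measurable A -> nu A = (\int[mu]_(x in A) (w x)%:E)%E.
Local Open Scope ereal_scope.
Import HBNNSimple.

Let ge0_integral_density_nnsfun (f : {nnsfun T >-> R}) :
  \int[nu]_x (f x)%:E = \int[mu]_x (f x * w x)%:E.
Proof.
under [LHS]eq_integral do rewrite fimfunE -fsumEFin//.
rewrite [LHS]ge0_integral_fsum//; last 2 first.
  - by move=> r; exact/measurable_EFinP/measurableT_comp.
  - by move=> n x _; rewrite EFinM nnfun_muleindic_ge0.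
under [RHS]eq_integral.
  move=> x xD; rewrite EFinM fimfunE -fsumEFin// muleC ge0_mule_fsumr; last first.
    by move=> r; rewrite EFinM nnfun_muleindic_ge0.
  over.
rewrite [RHS]ge0_integral_fsum//; last 2 first.
  - move=> r; under eq_fun do rewrite -EFinM.
    by apply/measurable_EFinP; apply: measurable_funM => //; exact: measurableT_comp.
  - by move=> n x _; rewrite EFinM mule_ge0//; [rewrite lee_fin|rewrite nnfun_muleindic_ge0].
apply: eq_fsbigr => r _.
rewrite integralZl_indic_nnsfun//=.
have [r0|r0] := leP 0%R r; last first.
  rewrite preimage_nnfun0// integral_indic// setIT measure0 mule0.
  by rewrite integral0_eq// => x _; rewrite indicE in_set0 mulr0 mule0.
under [RHS]eq_integral do rewrite EFinM muleCA.
rewrite ge0_integralZl//; last 2 first.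
  - under eq_fun do rewrite -EFinM.
    by apply/measurable_EFinP; apply: measurable_funM => //.
  - by move=> x _; rewrite mule_ge0// lee_fin.
congr *%E; rewrite integral_indic// setIT nuE//.
rewrite integral_mkcond; apply: eq_integral => x _.
by rewrite patchE indicE; case: ifPn => _; rewrite ?mule1 ?mule0.
Qed.

Lemma ge0_integral_density f : measurable_fun setT f -> (forall x, 0 <= f x) ->
  \int[nu]_x f x = \int[mu]_x (f x * (w x)%:E).
Proof.
move=> mf f0; pose f_ := nnsfun_approx measurableT mf.
transitivity (limn (fun n => \int[nu]_x (f_ n x)%:E)).
  rewrite -monotone_convergence//=.
  - apply: eq_integral => x _; apply/esym/cvg_lim => //=.
    exact: cvg_nnsfun_approx.
  - by move=> n; exact/measurable_EFinP/measurable_funTS.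
  - by move=> n ? _; rewrite lee_fin.
  - by move=> ? _ ? ? mn; rewrite lee_fin; exact/lefP/nd_nnsfun_approx.
rewrite (_ : (fun n => _) = fun n => \int[mu]_x ((f_ n x)%:E * (w x)%:E)); last first.
  by apply/funext => n; rewrite ge0_integral_density_nnsfun.
rewrite -monotone_convergence//=.
- apply: eq_integral => x _; apply/cvg_lim => //=.
  apply: cvgeMr => //; exact: cvg_nnsfun_approx.
- move=> n; apply/emeasurable_funM; exact/measurable_EFinP.
- by move=> n x _; rewrite mule_ge0// lee_fin.
- move=> x _ m n mn; rewrite lee_wpmul2r ?lee_fin//.
  exact/lefP/nd_nnsfun_approx.
Qed.

Lemma Rintegral_density (f : T -> R) : measurable_fun setT f ->
  (\int[nu]_x f x = \int[mu]_x (f x * w x))%R.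
Proof.
move=> mf; have mf' : measurable_fun setT (EFin \o f) by exact/measurable_EFinP.
rewrite /Rintegral; congr fine; rewrite integralE [RHS]integralE.
rewrite !ge0_integral_density//; last 2 first.
- exact: measurable_funeneg.
- exact: measurable_funepos.
congr (_ - _); apply: eq_integral => x _.
- by rewrite !funeposE/= EFinM -!EFin_max -EFinM maxr_pMl// mul0r.
- by rewrite !funenegE/= -!EFin_max -EFinM maxr_pMl// mul0r mulNr.
Qed.

End density.

Section transfer.
Context d (T : measurableType d) d' (T' : measurableType d') (R : realType)
  (mu : {measure set T -> \bar R}) (nu : {measure set T' -> \bar R}) (l : T -> T').
Hypothesis ml : measurable_fun setT l.
Hypothesis law : forall A : set T', measurable A -> mu (l @^-1` A) = nu A.

Lemma ge0_integral_law (F : T' -> \bar R) : measurable_fun setT F ->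
  (forall x, 0 <= F x)%E -> (\int[mu]_x F (l x) = \int[nu]_x F x)%E.
Proof.
move=> mF F0; transitivity (\int[pushforward mu l]_x F x)%E.
  rewrite (ge0_integral_pushforward ml)//.
by apply: eq_measure_integral => A mA _; exact: law.
Qed.

Lemma integrable_law (F : T' -> R) : measurable_fun setT F ->
  mu.-integrable setT (EFin \o (fun x => F (l x))) <->
  nu.-integrable setT (EFin \o F).
Proof.
move=> mF; have e := @ge0_integral_law (fun x => `|F x|%:E).
split=> /integrableP[_ h]; apply/integrableP; split.
- exact/measurable_EFinP.
- by rewrite /= -e//; exact/measurable_EFinP/measurableT_comp.
- exact/measurable_EFinP/measurableT_comp.
- by rewrite /= e//; exact/measurable_EFinP/measurableT_comp.
Qed.

Lemma Rintegral_law (F : T' -> R) : measurable_fun setT F ->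
  \int[mu]_x F (l x) = \int[nu]_x F x.
Proof.
move=> mF; have mF' : measurable_fun setT (EFin \o F) by exact/measurable_EFinP.
rewrite /Rintegral integralE [in RHS]integralE -!ge0_integral_law//.
- congr (fine (_ - _)); apply: eq_integral => x _; by rewrite ?funeposE ?funenegE.
- exact: measurable_funeneg.
- exact: measurable_funepos.
Qed.

End transfer.

Section normal.
Context (R : realType) (s : R).
Hypothesis s0 : 0 < s.
Local Notation N := (normal_prob 0 s).
Local Notation leb := (@lebesgue_measure R).

Let sn0 : s != 0. Proof. by rewrite gt_eqF. Qed.

Lemma ge0_integral_normal (f : R -> R) : measurable_fun setT f ->
  (forall x, 0 <= f x) ->
  (\int[N]_x (f x)%:E = \int[leb]_x (f x * normal_pdf 0 s x)%:E)%E.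
Proof.
move=> mf f0.
rewrite (@ge0_integral_density _ _ _ leb N (normal_pdf 0 s))//.
- exact: measurable_normal_pdf.
- by move=> x; exact: normal_pdf_ge0.
- exact/measurable_EFinP.
Qed.

(** The density of the normal law of mean t with respect to the centered one, both of variance
    s^2. *)
Let tilt t (x : R) := expR (t * x / s ^+ 2 - t ^+ 2 / (2 * s ^+ 2)).

Let normal_pdf_shift t x : normal_pdf 0 s x * tilt t x = normal_pdf 0 s (x - t).
Proof.
rewrite normal_pdfE// -mulrA; congr (_ * _).
rewrite /normal_fun/tilt -expRD; congr expR; field; exact: sn0.
Qed.

(** One-dimensional Cameron-Martin formula: complete the square, then translate Lebesgue measure.
    The exponential moments, the integration by parts and the Fourier transform below are all drawn
    from it. *)
Lemma ge0_integral_normal_shift t (v : R -> R) : continuous v ->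
  (forall x, 0 <= v x) ->
  (\int[N]_x (v x * expR (t * x / s ^+ 2 - t ^+ 2 / (2 * s ^+ 2)))%:E =
   \int[N]_x (v (x + t))%:E)%E.
Proof.
move=> cv v0.
have ct : continuous (fun x : R => x + t).
  by move=> x; apply: cvgD; [exact: cvg_id|exact: cvg_cst].
have c1 : continuous (fun x => v (x + t)).
  by move=> x; apply: continuous_comp; [exact: ct|exact: cv].
have ctilt : continuous (tilt t).
  move=> x; apply: continuous_comp; last exact: continuous_expR.
  by apply: cvgB; [apply: cvgM; [apply: cvgM; [exact: cvg_cst|exact: cvg_id]|]|]; exact: cvg_cst.
rewrite !ge0_integral_normal//; last 3 first.
- by apply: measurable_funM; exact: continuous_measurable_fun.
- by move=> x; rewrite mulr_ge0// expR_ge0.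
- exact: continuous_measurable_fun.
have dE : (fun x : R => x + t)^`()%classic = cst 1.
  by apply/funext => x; rewrite derive1E derive_val addr0.
under eq_integral do rewrite -mulrA (mulrC (expR _)) normal_pdf_shift.
rewrite (@increasing_ge0_integration_by_substitutionT R (fun x => x + t)).
- by apply: eq_integral => x _; rewrite dE !fctE /= mulr1 addrK.
- by move=> x y xy; rewrite ltrD2r.
- by rewrite dE => x; exact: cvg_cst.
- by rewrite dE; exact: is_cvg_cst.
- by rewrite dE; exact: is_cvg_cst.
- by move=> x.
- exact: cvg_addrr_Ny.
- exact: cvg_addrr.
- move=> x; apply: cvgM; first exact: cv.
  apply: (@continuous_comp _ _ _ (fun x => x - t) (normal_pdf 0 s)).
    by apply: cvgB; [exact: cvg_id|exact: cvg_cst].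
  exact: continuous_normal_pdf.
- by move=> x; rewrite mulr_ge0// normal_pdf_ge0.
Qed.

(** The shift formula for v = 1 and t = a s^2: a positive multiple of the integral equals 1. *)
Lemma normal_expR_integrable a : N.-integrable setT (EFin \o (fun x => expR (a * x))).
Proof.
have me : measurable_fun setT (fun x : R => expR (a * x)).
  by apply: measurableT_comp => //; exact: measurable_funM.
apply/integrableP; split; first exact/measurable_EFinP.
pose t := a * s ^+ 2.
have c1 : continuous (fun _ : R => 1 : R) by move=> x; exact: cvg_cst.
have := @ge0_integral_normal_shift t (fun _ => 1) c1 (fun _ => ler01).
under eq_integral.
  move=> x _.
  have -> : 1 * expR (t * x / s ^+ 2 - t ^+ 2 / (2 * s ^+ 2)) =
    expR (- (t ^+ 2 / (2 * s ^+ 2))) * expR (a * x).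
    by rewrite mul1r -expRD addrC /t; congr expR; congr (_ + _); field.
  over.
rewrite integral_cst//= probability_setT mule1.
under eq_integral do rewrite EFinM.
rewrite ge0_integralZl//=; last exact/measurable_EFinP.
under [X in _ -> (X < _)%E]eq_integral do rewrite ger0_norm ?expR_ge0//.
case: (integral _ _ _) => //.
- by move=> r; rewrite ltry.
- by rewrite mulry gtr0_sg ?expR_gt0// mul1e.
Qed.

Lemma normal_expR_norm_integrable a :
  N.-integrable setT (EFin \o (fun x => expR (a * `|x|))).
Proof.
apply: le_integrable_norm (integrable_add (normal_expR_integrable a) (normal_expR_integrable (- a))).
  by apply: measurableT_comp => //; apply: measurable_funM => //; exact: measurableT_comp.
move=> x; rewrite ger0_norm ?expR_ge0//; have [x0|x0] := leP 0 x.
  by rewrite ger0_norm// lerDl expR_ge0.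
by rewrite ltr0_norm// mulrN -mulNr lerDr expR_ge0.
Qed.

Lemma normal_cst_integrable (c : R) : N.-integrable setT (EFin \o (fun _ => c)).
Proof. exact: finite_measure_integrable_cst. Qed.

Let tilt_integrable t : N.-integrable setT (EFin \o tilt t).
Proof.
apply: eq_integrable (integrable_scale (expR (- (t ^+ 2 / (2 * s ^+ 2))))
  (normal_expR_integrable (t / s ^+ 2))) => // x _ /=.
by rewrite /tilt -expRD; congr (expR _)%:E; ring.
Qed.

(** The nonnegative case, for v + b and for the constant b, followed by subtraction. *)
Lemma Rintegral_normal_shift t (v : R -> R) (b : R) : continuous v ->
  (forall x, `|v x| <= b) ->
  \int[N]_x (v x * expR (t * x / s ^+ 2 - t ^+ 2 / (2 * s ^+ 2))) =
  \int[N]_x (v (x + t)).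
Proof.
move=> cv vb.
have cvb : continuous (fun x => v x + b) by move=> x; apply: cvgD; [exact: cv|exact: cvg_cst].
have vb0 x : 0 <= v x + b by have := vb x; rewrite ler_norml => /andP[]; lra.
have b0 : 0 <= b by rewrite (le_trans _ (vb 0)).
have cb : continuous (fun _ : R => b) by move=> x; exact: cvg_cst.
have mv : measurable_fun setT v by exact: continuous_measurable_fun.
have iv : N.-integrable setT (EFin \o (fun x => v (x + t))).
  apply: le_integrable_norm (normal_cst_integrable b) => //.
  apply: measurableT_comp => //; exact: measurable_funD.
have ivt : N.-integrable setT (EFin \o (fun x => v x * tilt t x)).
  exact: integrableM_bounded (tilt_integrable t) mv vb.
have ibt := integrable_scale b (tilt_integrable t).
have := congr1 fine (@ge0_integral_normal_shift t _ cvb vb0).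
have := congr1 fine (@ge0_integral_normal_shift t _ cb (fun _ => b0)).
rewrite -[LHS]/(\int[N]_x (b * tilt t x)) -[RHS]/(\int[N]_x b) => e1.
rewrite -[LHS]/(\int[N]_x ((v x + b) * tilt t x)) -[RHS]/(\int[N]_x (v (x + t) + b)).
rewrite RintegralD//; last exact: normal_cst_integrable.
under eq_Rintegral do rewrite mulrDl.
by rewrite RintegralD// e1 => /addIr.
Qed.

Let dtilt (t x : R) : is_derive t 1 (tilt ^~ x) ((x - t) / s ^+ 2 * tilt t x).
Proof.
by apply: is_derive_eq; rewrite /GRing.scale/= /tilt; field; exact: sn0.
Qed.

Let dcos (t b x y : R) :
  is_derive y 1 (fun y => cos (t * (x + y) + b)) (- t * sin (t * (x + y) + b)).
Proof. by apply: is_derive_eq; rewrite /GRing.scale/=; ring. Qed.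

Let cont_cos (t b : R) : continuous (fun x : R => cos (t * x + b)).
Proof.
move=> x; apply: continuous_comp; last exact: continuous_cos.
by apply: cvgD; [apply: cvgM; [exact: cvg_cst|exact: cvg_id]|exact: cvg_cst].
Qed.

Let cos_le (x : R) : `|cos x| <= 1.
Proof. by rewrite ler_norml cos_geN1 cos_le1. Qed.

Let sin_le (x : R) : `|sin x| <= 1.
Proof. by rewrite ler_norml sin_geN1 sin_le1. Qed.

Let bounded_integrable (f : R -> R) (b : R) : measurable_fun setT f ->
  (forall x, `|f x| <= b) -> N.-integrable setT (EFin \o f).
Proof. by move=> mf fb; exact: le_integrable_norm (normal_cst_integrable b). Qed.

Lemma normal_norm_integrable : N.-integrable setT (EFin \o (fun x => `|x|)).
Proof.
apply: le_integrable_norm (normal_expR_norm_integrable 1); first exact: measurableT_comp.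
move=> x; rewrite normr_id mul1r; apply: le_trans (expR_ge1Dx _).
by rewrite lerDr.
Qed.

Lemma normal_id_integrable : N.-integrable setT (EFin \o (fun x : R => x)).
Proof. exact: le_integrable_norm normal_norm_integrable. Qed.

Let mcos (t b : R) : measurable_fun setT (fun x : R => cos (t * x + b)).
Proof. exact: continuous_measurable_fun. Qed.

Let icos (t b : R) : N.-integrable setT (EFin \o (fun x : R => cos (t * x + b))).
Proof. exact: bounded_integrable (mcos t b) (fun x => cos_le _). Qed.

(** Stein's identity E[x F(x)] = s^2 E F'(x) for a cosine. Both sides of the shift formula are
    differentiated in the shift r at 0: the tilt produces the factor x / s^2, the translation the
    derivative of F. *)
Lemma normal_x_cos (t b : R) :
  \int[N]_x (x * cos (t * x + b)) = - s ^+ 2 * t * \int[N]_x sin (t * x + b).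
Proof.
pose f (r x : R) := cos (t * x + b) * tilt r x.
(* For |r| < 1, |x - r| <= 1 + |x| <= e^|x| and the tilt is at most e^(|x| / s^2). *)
pose G (x : R) := s ^- 2 * expR ((1 + s ^- 2) * `|x|).
have s2 : 0 < s ^- 2 by rewrite invr_gt0 exprn_gt0.
have h1 : is_derive (0 : R) 1 (fun r : R => \int[N]_x (f r x))
    (\int[N]_x (cos (t * x + b) * ((x - 0) / s ^+ 2 * tilt 0 x))).
  apply: (@derive_under_Rintegral _ _ _ N f (fun r x => cos (t * x + b) *
    ((x - r) / s ^+ 2 * tilt r x)) G 0 (-1) 1).
  - by rewrite ltrN10 ltr01.
  - move=> r _; exact: integrableM_bounded (tilt_integrable r) (mcos t b) (fun x => cos_le _).
  - move=> r x _; have := dtilt r x => h; rewrite /f.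
    by apply: is_derive_eq; rewrite /GRing.scale/=; ring.
  - exact: integrable_scale (normal_expR_norm_integrable _).
  - move=> r x /andP[r1 r2]; rewrite normrM -[leRHS]mul1r ler_pM//.
    have -> : `|(x - r) / s ^+ 2 * tilt r x| = s ^- 2 * (`|x - r| * `|tilt r x|).
      by rewrite !normrM (gtr0_norm s2); ring.
    apply: ler_wpM2l; first exact: ltW.
    rewrite mulrDl mul1r expRD ler_pM//.
    + apply: le_trans (expR_ge1Dx _); apply: le_trans (ler_normB _ _) _.
      rewrite addrC lerD2r.
      by rewrite ler_norml !ltW.
    + rewrite ger0_norm ?expR_ge0// ler_expR.
      apply: (@le_trans _ _ (r * x / s ^+ 2)).
        by rewrite gerBl divr_ge0 ?sqr_ge0// mulr_ge0// sqr_ge0.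
      rewrite mulrC; apply: ler_wpM2l; first exact: ltW.
      apply: le_trans (ler_norm _) _; rewrite normrM.
      by rewrite ler_piMl// ler_norml !ltW.
have h2 : is_derive (0 : R) 1 (fun r : R => \int[N]_x (f r x))
    (\int[N]_x (- t * sin (t * (x + 0) + b))).
  have -> : (fun r : R => \int[N]_x (f r x)) = (fun r => \int[N]_x cos (t * (x + r) + b)).
    apply/funext => r; rewrite /f /tilt.
    exact: (@Rintegral_normal_shift r _ 1 (@cont_cos t b) (fun x => cos_le (t * x + b))).
  apply: (@derive_under_Rintegral _ _ _ N (fun r x => cos (t * (x + r) + b))
    (fun r x => - t * sin (t * (x + r) + b)) (fun=> `|t|) 0 (-1) 1).
  - by rewrite ltrN10 ltr01.
  - move=> r _; have -> : (fun x => cos (t * (x + r) + b)) = (fun x => cos (t * x + (t * r + b))).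
      by apply/funext => x; congr cos; ring.
    exact: icos.
  - by move=> r x _; exact: dcos.
  - exact: normal_cst_integrable.
  - by move=> r x _; rewrite normrM normrN ler_piMr.
have := @derive_val _ _ _ _ _ _ _ h1; rewrite (@derive_val _ _ _ _ _ _ _ h2) => e.
have msin : measurable_fun setT (fun x : R => sin (t * x + b)).
  apply: continuous_measurable_fun => x; apply: continuous_comp; last exact: continuous_sin.
  by apply: cvgD; [apply: cvgM; [exact: cvg_cst|exact: cvg_id]|exact: cvg_cst].
transitivity (s ^+ 2 * \int[N]_x (- t * sin (t * (x + 0) + b))); last first.
  under eq_Rintegral do rewrite addr0.
  rewrite RintegralZl//; first by ring.
  exact: bounded_integrable msin (fun x => sin_le _).
have tilt0 x : tilt 0 x = 1 by rewrite /tilt !mul0r expr0n/= !mul0r subr0 expR0.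
rewrite e -RintegralZl//.
  apply: eq_Rintegral => x _; rewrite tilt0.
  by field; exact: sn0.
have -> : (fun x => cos (t * x + b) * ((x - 0) / s ^+ 2 * tilt 0 x)) =
    fun x => cos (t * x + b) * (s ^- 2 * x).
  by apply/funext => x; rewrite tilt0 subr0 mulr1 (mulrC x).
exact: integrableM_bounded (integrable_scale _ normal_id_integrable) (mcos t b) (fun x => cos_le _).
Qed.

(** Stein's identity with the phase b + pi/2 is the equation c'(u) = -s^2 u c(u), so c(u) exp(s^2
    u^2 / 2) is constant. *)
Lemma Rintegral_normal_cos (t b : R) :
  \int[N]_x cos (t * x + b) = cos b * expR (- (s ^+ 2 * t ^+ 2) / 2).
Proof.
pose c (t : R) := \int[N]_x cos (t * x + b).
have dc (u : R) : is_derive u 1 c (- s ^+ 2 * u * c u).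
  have h : is_derive u 1 c (\int[N]_x (- x * sin (u * x + b))).
    apply: (@derive_under_Rintegral _ _ _ N (fun u x => cos (u * x + b))
      (fun u x => - x * sin (u * x + b)) (fun x => `|x|) u (u - 1) (u + 1)).
    - by rewrite ltrBlDr ltrDl ltr01.
    - by move=> r _; exact: icos.
    - by move=> r x _; apply: is_derive_eq; rewrite /GRing.scale/=; ring.
    - exact: normal_norm_integrable.
    - by move=> r x _; rewrite normrM normrN ler_piMr.
  apply: is_derive_eq h _.
  have := normal_x_cos u (b + pi / 2).
  under eq_Rintegral do rewrite addrA cosDpihalf mulrN -mulNr.
  under [in X in _ = X -> _]eq_Rintegral do rewrite addrA sinDpihalf.
  by move=> ->.
pose g (u : R) := c u * expR (s ^+ 2 * u ^+ 2 / 2).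
have dg (u : R) : is_derive u 1 g 0.
  have := dc u => h; rewrite /g.
  by apply: is_derive_eq; rewrite /GRing.scale/=; field.
have gt0 : g t = g 0.
  have := @is_derive_0_is_cst R g t 0; apply; exact: dg.
have : g 0 = cos b.
  rewrite /g /c expr0n/= mulr0 mul0r expR0 mulr1.
  under eq_Rintegral do rewrite mul0r add0r.
  exact: Rintegral_prob_cst.
move=> e0; rewrite -e0 -gt0 /g -[RHS]mulrA -expRD.
by rewrite mulNr subrr expR0 mulr1.
Qed.

(** Stein's identity and the Fourier transform give E[x sin(t x)] = s^2 t exp(-s^2 t^2 / 2); the
    derivative at t = 0 is computed from either side. *)
Lemma Rintegral_normal_sqr : \int[N]_x (x ^+ 2) = s ^+ 2.
Proof.
have isq : N.-integrable setT (EFin \o (fun x : R => x ^+ 2)).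
  apply: le_integrable_norm (integrable_scale 2 (normal_expR_norm_integrable 1)).
    exact: measurable_funX.
  move=> x; rewrite mul1r normrX.
  have := @expR_ge1Dxn _ `|x| 1 (normr_ge0 _).
  by rewrite -[2`!%:R]/(2 : R) => h; nra.
have h1 : is_derive (0 : R) 1 (fun t => \int[N]_x (x * sin (t * x)))
    (\int[N]_x (x * (cos (0 * x) * x))).
  apply: (@derive_under_Rintegral _ _ _ N (fun t x => x * sin (t * x))
      (fun t x => x * (cos (t * x) * x)) (fun x => x ^+ 2) 0 (-1) 1) => //.
  - by rewrite ltrN10 ltr01.
  - move=> r _; have -> : (fun x : R => x * sin (r * x)) = (fun x : R => sin (r * x) * x).
      by apply/funext => x; rewrite mulrC.
    have mrsin : measurable_fun setT (fun x : R => sin (r * x)).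
      apply: continuous_measurable_fun => x; apply: continuous_comp; last exact: continuous_sin.
      by apply: cvgM; [exact: cvg_cst|exact: cvg_id].
    exact: integrableM_bounded normal_id_integrable mrsin (fun x => sin_le _).
  - by move=> r x _; apply: is_derive_eq; rewrite /GRing.scale/=; ring.
  - move=> r x _; rewrite mulrCA normrM -expr2 (ger0_norm (sqr_ge0 x)).
    by rewrite ler_piMl// sqr_ge0.
have h2 : is_derive (0 : R) 1 (fun t => \int[N]_x (x * sin (t * x))) (s ^+ 2).
  have -> : (fun t => \int[N]_x (x * sin (t * x))) =
      (fun t => s ^+ 2 * (t * expR (- (s ^+ 2 * t ^+ 2) / 2))).
    apply/funext => t; have := normal_x_cos t (- (pi / 2)).
    under eq_Rintegral do rewrite cosBpihalf.
    under [in X in _ = X -> _]eq_Rintegral do rewrite sinBpihalf.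
    move=> ->.
    have := Rintegral_normal_cos t pi.
    under eq_Rintegral do rewrite cosDpi.
    by move=> ->; rewrite cospi; ring.
  apply: is_derive_eq; rewrite /GRing.scale/= expr0n/= mulr0 oppr0 !mul0r.
  by rewrite expR0; ring.
have := @derive_val _ _ _ _ _ _ _ h1; rewrite (@derive_val _ _ _ _ _ _ _ h2) => ->.
by apply: eq_Rintegral => x _; rewrite mul0r cos0 mul1r expr2.
Qed.

End normal.

(** * Fourier transform of a Gaussian measure *)

Lemma Rintegral_dominated_cvg d (T : measurableType d) (R : realType)
    (mu : {measure set T -> \bar R}) (f_ : nat -> T -> R) (f g : T -> R) :
  (forall n, measurable_fun setT (f_ n)) ->
  (forall x, f_ n x @[n --> \oo] --> f x) ->
  mu.-integrable setT (EFin \o g) -> (forall n x, `|f_ n x| <= g x) ->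
  mu.-integrable setT (EFin \o f) /\
  \int[mu]_x f_ n x @[n --> \oo] --> \int[mu]_x f x.
Proof.
move=> mf cf ig fg.
have mfl : measurable_fun setT f by apply: measurable_fun_cvg mf _ => x _; exact: cf.
have fle x : `|f x| <= g x.
  rewrite leNgt; apply/negP => gx.
  have e0 : 0 < `|f x| - g x by rewrite subr_gt0.
  have /cvgrPdist_lt/(_ _ e0)[n _ /(_ n (leqnn n))] := cf x.
  have := ler_normD (f_ n x) (f x - f_ n x); rewrite [f_ n x + _]addrC subrK.
  by have := fg n x; rewrite /=; lra.
have intf : mu.-integrable setT (EFin \o f) by exact: le_integrable_norm fle ig.
split => //; apply: fine_cvg.
rewrite fineK; last exact: integrable_fin_num.
apply: (@dominated_cvg _ _ _ mu setT measurableT (fun n x => (f_ n x)%:E) (EFin \o f) (EFin \o g)) => //.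
- by move=> n; exact/measurable_EFinP.
- by move=> x _; apply: cvg_EFin; [exact: nearW|exact: cf].
- by move=> n x _; rewrite lee_fin.
Qed.

Lemma measurable_cos_comp d (T : measurableType d) (R : realType) (l : T -> R) (b : R) :
  measurable_fun setT l -> measurable_fun setT (fun x => cos (l x + b)).
Proof.
move=> ml; have mc : measurable_fun setT (@cos R).
  by apply: continuous_measurable_fun; exact: continuous_cos.
exact: (measurableT_comp mc (measurable_funD ml (measurable_cst b))).
Qed.

Lemma prob_bounded_integrable d (T : measurableType d) (R : realType)
  (P : probability T R) (f : T -> R) (b : R) : measurable_fun setT f ->
  (forall x, `|f x| <= b) -> P.-integrable setT (EFin \o f).
Proof.
move=> mf fb; apply: le_integrable_norm mf fb _.
exact: finite_measure_integrable_cst.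
Qed.

Lemma norm_cos_le1 (R : realType) (x : R) : `|cos x| <= 1.
Proof. by rewrite ler_norml cos_geN1 cos_le1. Qed.

Lemma integrable_cosM d (T : measurableType d) (R : realType)
    (mu : {measure set T -> \bar R}) (f l : T -> R) (b : R) :
  mu.-integrable setT (EFin \o f) -> measurable_fun setT l ->
  mu.-integrable setT (EFin \o (fun x => cos (l x + b) * f x)).
Proof.
move=> intf ml; apply: (integrableM_bounded (h := fun x => cos (l x + b)) intf).
  exact: measurable_cos_comp.
by move=> x; exact: norm_cos_le1.
Qed.

Lemma integrable_cos d (T : measurableType d) (R : realType) (P : probability T R)
    (l : T -> R) (b : R) : measurable_fun setT l ->
  P.-integrable setT (EFin \o (fun x => cos (l x + b))).
Proof.
move=> ml; apply: prob_bounded_integrable (measurable_cos_comp b ml) _.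
by move=> x; exact: norm_cos_le1.
Qed.

Section utrig_integral.
Context (R : realType) (T : Type) (L : set (T -> R)).

Lemma trig_measurable d (S : measurableType d) (U : S -> T) (u : T -> R) :
  (forall l, L l -> measurable_fun setT (l \o U)) ->
  trig L u -> measurable_fun setT (u \o U).
Proof.
move=> mL; elim=> [|a l b v Ll _ ih]; first exact: measurable_cst.
apply: measurable_funD => //; apply: measurable_funM => //.
apply: measurable_cos_comp; exact: mL.
Qed.

Lemma utrig_measurable d (S : measurableType d) (U : S -> T) (u : T -> R) :
  (forall l, L l -> measurable_fun setT (l \o U)) ->
  utrig L u -> measurable_fun setT (u \o U).
Proof.
move=> mL uu.
have h n : exists v, trig L v /\ forall x, `|u x - v x| <= n.+1%:R^-1.
  by have [|v tv uv] := uu n.+1%:R^-1; [rewrite invr_gt0|exists v].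
have [v hv] := choice h.
apply: (@measurable_fun_cvg _ _ _ _ (fun n => v n \o U)).
  by move=> n; apply: trig_measurable => //; have [] := hv n.
move=> x _; apply/cvgrPdist_le => e e0.
have [N _ hN] := near_infty_natSinv_lt (PosNum e0).
exists N => // n /hN /= ne; apply: le_trans (ltW ne); exact: (hv n).2.
Qed.

(** Equal Fourier transforms of two weighted images of measures give equal integrals, by linearity
    and uniform approximation. Maps and weights are kept general: they serve for independence, for
    the tilted measure on the two slices of X x R, and for rotations. *)
Lemma utrig_integral_eq d1 (S1 : measurableType d1) d2 (S2 : measurableType d2)
    (mu1 : {measure set S1 -> \bar R}) (mu2 : {measure set S2 -> \bar R})
    (U1 : S1 -> T) (U2 : S2 -> T) (w1 : S1 -> R) (w2 : S2 -> R) (u : T -> R) :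
  (forall l, L l -> measurable_fun setT (l \o U1)) ->
  (forall l, L l -> measurable_fun setT (l \o U2)) ->
  mu1.-integrable setT (EFin \o w1) -> mu2.-integrable setT (EFin \o w2) ->
  (forall l b, L l -> \int[mu1]_x (cos (l (U1 x) + b) * w1 x) =
                      \int[mu2]_x (cos (l (U2 x) + b) * w2 x)) ->
  utrig L u ->
  \int[mu1]_x (u (U1 x) * w1 x) = \int[mu2]_x (u (U2 x) * w2 x).
Proof.
move=> m1 m2 i1 i2 h uu.
have cosle (x : R) : `|cos x| <= 1 by rewrite ler_norml cos_geN1 cos_le1.
have icos d (S : measurableType d) (mu : {measure set S -> \bar R}) (U : S -> T) w l b :
    (forall l, L l -> measurable_fun setT (l \o U)) ->
    mu.-integrable setT (EFin \o w) -> L l ->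
    mu.-integrable setT (EFin \o (fun x => cos (l (U x) + b) * w x)).
  move=> mL iw Ll; apply: (integrableM_bounded (h := fun x => cos (l (U x) + b)) (b := 1)) => //.
  apply: measurable_cos_comp; exact: mL.
have iu d (S : measurableType d) (mu : {measure set S -> \bar R}) (U : S -> T) w v :
    (forall l, L l -> measurable_fun setT (l \o U)) ->
    mu.-integrable setT (EFin \o w) -> utrig L v ->
    mu.-integrable setT (EFin \o (fun x => v (U x) * w x)).
  move=> mL iw uv; have [b _ vb] := utrig_bounded uv.
  apply: (integrableM_bounded (h := v \o U) (b := b)) => //; last by move=> x; exact: vb.
  exact: utrig_measurable.
have ht v : trig L v -> \int[mu1]_x (v (U1 x) * w1 x) = \int[mu2]_x (v (U2 x) * w2 x).
  elim=> [|a l b v' Ll tv' ih].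
    under eq_Rintegral do rewrite mul0r.
    under [RHS]eq_Rintegral do rewrite mul0r.
    by rewrite !Rintegral_cst// !mul0r.
  under eq_Rintegral do rewrite mulrDl -mulrA.
  under [RHS]eq_Rintegral do rewrite mulrDl -mulrA.
  have uv' := utrig_trig tv'.
  rewrite !RintegralD ?ih ?RintegralZl ?h//.
  - exact: icos.
  - exact: icos.
  - by apply: integrable_scale; exact: icos.
  - exact: iu.
  - by apply: integrable_scale; exact: icos.
  - exact: iu.
have dist d (S : measurableType d) (mu : {measure set S -> \bar R}) (U : S -> T) w v e :
    (forall l, L l -> measurable_fun setT (l \o U)) ->
    mu.-integrable setT (EFin \o w) -> utrig L v -> (forall x, `|u x - v x| <= e) ->
    `|\int[mu]_x (u (U x) * w x) - \int[mu]_x (v (U x) * w x)| <= e * \int[mu]_x `|w x|.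
  move=> mL iw uv uve.
  have iuw := iu _ _ _ _ _ _ mL iw uu; have ivw := iu _ _ _ _ _ _ mL iw uv.
  rewrite -RintegralB// (le_trans (le_normr_Rintegral _ (integrable_sub iuw ivw)))//.
  rewrite -RintegralZl//; last exact: integrable_norm.
  apply: le_Rintegral => //.
  - exact/integrable_norm/integrable_sub.
  - exact/integrable_scale/integrable_norm.
  - by move=> x _; rewrite -mulrBl normrM ler_wpM2r.
apply/eqP; rewrite -subr_eq0 -normr_le0; apply/ler_addgt0Pr => e e0; rewrite add0r.
set C := \int[mu1]_x `|w1 x| + \int[mu2]_x `|w2 x| + 1.
have C0 : 0 < C by rewrite ltr_wpDl// addr_ge0// Rintegral_ge0.
have eC : 0 < e / C by rewrite divr_gt0.
have [v tv uv] := uu _ eC.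
have h1 := dist _ _ _ _ _ v _ m1 i1 (utrig_trig tv) uv.
have h2 := dist _ _ _ _ _ v _ m2 i2 (utrig_trig tv) uv.
rewrite -(ht _ tv) in h2.
set I1 := \int[mu1]_x (u _ * _) in h1 *; set I2 := \int[mu2]_x (u _ * _) in h2 *.
set J := \int[mu1]_x (v _ * _) in h1 h2.
have -> : I1 - I2 = (I1 - J) - (I2 - J) by ring.
apply: le_trans (ler_normB _ _) _; apply: le_trans (lerD h1 h2) _.
rewrite -mulrDr mulrAC ler_pdivrMr// ler_wpM2l ?ltW//.
by rewrite /C ltrDl.
Qed.

End utrig_integral.

Section borel_functions.
Context (R : realType) (X : tvsType R).

Lemma continuous_measurable_borel (f : X -> R) : continuous f ->
  measurable_fun setT (f : borel X -> R).
Proof.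
move=> /continuousP cf; apply: (measurability _ (RGenOpens.measurableE R)).
move=> _ [_ [a [b ->] <-]]; rewrite setTI; apply: sub_sigma_algebra.
exact/cf/interval_open.
Qed.

Lemma topdual_measurable (l : X -> R) : topdual l ->
  measurable_fun setT (l : borel X -> R).
Proof. by move=> [_ /continuous_measurable_borel]. Qed.

Lemma topdualD (l : X -> R) x y : topdual l -> l (x + y) = l x + l y.
Proof. by move=> [ll _]; have := ll 1 x y; rewrite scale1r mul1r. Qed.

Lemma topdual0 (l : X -> R) : topdual l -> l 0 = 0.
Proof.
by move=> tl; have := topdualD 0 0 tl; rewrite addr0 => /eqP; rewrite -subr_eq0 opprD addNKr oppr_eq0 => /eqP.
Qed.

Lemma topdualZ (l : X -> R) a x : topdual l -> l (a *: x) = a * l x.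
Proof. by move=> tl; have := tl.1 a x 0; rewrite addr0 topdual0// addr0. Qed.

Lemma topdual_linear : linear_family (@topdual R X).
Proof.
split=> [|l m [ll cl] [lm cm]|a l [ll cl]].
- by split=> [a x y|x]; [rewrite mulr0 addr0|exact: cvg_cst].
- split=> [a x y|x]; first by rewrite ll lm mulrDr addrACA.
  by apply: cvgD; [exact: cl|exact: cm].
- split=> [b x y|x]; first by rewrite ll mulrDr mulrCA.
  by apply: cvgM; [exact: cvg_cst|exact: cl].
Qed.

Lemma topdual_sum (n : nat) (c : 'I_n -> R) (g : 'I_n -> X -> R) :
  (forall i, topdual (g i)) -> topdual (fun x => \sum_i c i * g i x).
Proof.
have [L0 LD LZ] := topdual_linear.
elim: n c g => [|n ih] c g tg.
  by rewrite (_ : (fun _ => _) = fun=> 0)//; apply/funext => x; rewrite big_ord0.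
rewrite (_ : (fun _ => _) = fun x => c ord0 * g ord0 x + \sum_i c (lift ord0 i) * g (lift ord0 i) x).
  by apply: LD; [exact: LZ|exact: ih].
by apply/funext => x; rewrite big_ord_recl.
Qed.

End borel_functions.

Section gaussian.
Context (R : realType) (X : tvsType R) (gamma : probability (borel X) R).
Hypothesis hgamma : radon_centered_gaussian gamma.
Implicit Types (l m g : X -> R).

Local Notation integrable f := (gamma.-integrable setT (EFin \o (f : borel X -> R))).

Definition cov l m : R := \int[gamma]_x (l x * m x).

Lemma covC l m : cov l m = cov m l.
Proof. by apply: eq_Rintegral => x _; rewrite mulrC. Qed.

Let law_cases l : topdual l ->
  (forall F : R -> R, measurable_fun setT F -> integrable (F \o l) /\
     \int[gamma]_x (F (l x)) = F 0) \/
  (exists2 s : R, 0 < s & (forall A : set R, measurable A ->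
     gamma (l @^-1` A) = normal_prob 0 s A)).
Proof.
move=> tl; have [_ /(_ _ tl)] := hgamma; case; last by right.
move=> law; left => F mF.
have ml := topdual_measurable tl.
have mF0 : measurable_fun setT (fun x => `|F x|%:E).
  exact/measurable_EFinP/measurableT_comp.
split.
- rewrite (integrable_law (nu := \d_(0 : R)) ml)//.
  apply/integrableP; split; first exact/measurable_EFinP.
  rewrite integral_dirac//= ?diracT ?mul1e ?ltry//.
- rewrite (Rintegral_law (nu := \d_(0 : R)) ml)//.
  rewrite /Rintegral integral_dirac//=; last exact/measurable_EFinP.
  by rewrite indicE in_setT mul1r.
Qed.

Lemma topdual_expR_integrable l (a : R) : topdual l ->
  integrable (fun x => expR (a * `|l x|)).
Proof.
move=> tl; have ml := topdual_measurable tl.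
have me : measurable_fun setT (fun t : R => expR (a * `|t|)).
  by apply: measurableT_comp => //; apply: measurable_funM => //; exact: measurableT_comp.
have [h|[s s0 h]] := law_cases tl; first by have [] := h _ me.
have /(@integrable_law _ _ _ _ _ gamma (normal_prob 0 s) l ml h _ me) := normal_expR_norm_integrable s0 a.
exact.
Qed.

Lemma topdual_integrable l : topdual l -> integrable l.
Proof.
move=> tl; apply: le_integrable_norm (topdual_expR_integrable 1 tl).
  exact: topdual_measurable.
by move=> x; rewrite mul1r; apply: le_trans (expR_ge1Dx _); rewrite lerDr.
Qed.

Lemma topdual_sqr_integrable l : topdual l -> integrable (fun x => l x ^+ 2).
Proof.
move=> tl; apply: le_integrable_norm (integrable_scale 2 (topdual_expR_integrable 1 tl)).
  by apply: measurable_funX; exact: topdual_measurable.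
move=> x; rewrite mul1r normrX.
have := @expR_ge1Dxn _ `|l x| 1 (normr_ge0 _).
by rewrite -[2`!%:R]/(2 : R) => h; nra.
Qed.

Lemma topdual_mul_integrable l m : topdual l -> topdual m ->
  integrable (fun x => l x * m x).
Proof.
move=> tl tm; apply: le_integrable_norm (integrable_add (topdual_sqr_integrable tl) (topdual_sqr_integrable tm)).
  by apply: measurable_funM; exact: topdual_measurable.
move=> x; rewrite normrM -(real_normK (num_real (l x))) -(real_normK (num_real (m x))).
by have := sqr_ge0 (`|l x| - `|m x|); rewrite sqrrB; nra.
Qed.

Lemma covDl l l' m : topdual l -> topdual l' -> topdual m ->
  cov (fun x => l x + l' x) m = cov l m + cov l' m.
Proof.
move=> tl tl' tm; rewrite /cov; under eq_Rintegral do rewrite mulrDl.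
by rewrite RintegralD//; exact: topdual_mul_integrable.
Qed.

Lemma covZl a l m : topdual l -> topdual m -> cov (fun x => a * l x) m = a * cov l m.
Proof.
move=> tl tm; rewrite /cov; under eq_Rintegral do rewrite -mulrA.
by rewrite RintegralZl//; exact: topdual_mul_integrable.
Qed.

Lemma covDr l m m' : topdual l -> topdual m -> topdual m' ->
  cov l (fun x => m x + m' x) = cov l m + cov l m'.
Proof. by move=> tl tm tm'; rewrite covC covDl// !(covC _ l). Qed.

Lemma covZr a l m : topdual l -> topdual m -> cov l (fun x => a * m x) = a * cov l m.
Proof. by move=> tl tm; rewrite covC covZl// covC. Qed.

Lemma cov_ge0 l : 0 <= cov l l.
Proof. by apply: Rintegral_ge0 => x _; rewrite -expr2 sqr_ge0. Qed.

Lemma covDD l m t : topdual l -> topdual m ->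
  cov (fun x => l x + t * m x) (fun x => l x + t * m x) =
  cov l l + 2 * t * cov l m + t ^+ 2 * cov m m.
Proof.
move=> tl tm; have [_ LD LZ] := @topdual_linear R X.
have tz := LZ t _ tm.
rewrite covDl ?covDr ?covZl ?covZr//; last exact: LD.
by rewrite (covC m l); ring.
Qed.

Let cov_law l s : 0 < s -> topdual l ->
  (forall A : set R, measurable A -> gamma (l @^-1` A) = normal_prob 0 s A) ->
  cov l l = s ^+ 2.
Proof.
move=> s0 tl law; rewrite -(Rintegral_normal_sqr s0).
rewrite -(Rintegral_law (nu := normal_prob 0 s) (topdual_measurable tl) law)//.
Qed.

Lemma Rintegral_cos l (b : R) : topdual l ->
  \int[gamma]_x cos (l x + b) = cos b * expR (- (cov l l) / 2).
Proof.
move=> tl; have ml := topdual_measurable tl.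
have mF : measurable_fun setT (fun t : R => cos (t + b)).
  exact: measurable_cos_comp.
have [h|[s s0 h]] := law_cases tl.
  have [_ ->] := h _ mF.
  have -> : cov l l = 0.
    have mF2 : measurable_fun setT (fun t : R => t * t) by exact: measurable_funM.
    by have [_] := h _ mF2; rewrite mul0r.
  by rewrite oppr0 mul0r expR0 mulr1 add0r.
rewrite (Rintegral_law (nu := normal_prob 0 s) ml h mF) (cov_law s0 tl h).
have := Rintegral_normal_cos s0 1 b.
by under eq_Rintegral do rewrite mul1r; move=> ->; rewrite expr1n mulr1.
Qed.

Lemma topdual_std_law l : topdual l -> cov l l = 1 ->
  forall A : set R, measurable A -> gamma (l @^-1` A) = normal_prob 0 1 A.
Proof.
move=> tl l1.
have [h|[s s0 h]] := law_cases tl.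
  have mF2 : measurable_fun setT (fun t : R => t * t) by exact: measurable_funM.
  have [_] := h _ mF2; rewrite mul0r => c0.
  by move: l1; rewrite /cov c0 => /esym/eqP; rewrite oner_eq0.
have : s ^+ 2 = 1 by rewrite -(cov_law s0 tl h).
move=> /eqP; rewrite sqrf_eq1 => /orP[|] /eqP s1; last lra.
by move: h; rewrite s1.
Qed.

Lemma cov_eq0 l : topdual l -> cov l l = 0 -> {ae gamma, forall x, l x = 0}.
Proof.
move=> tl l0.
have ml := topdual_measurable tl.
have isq := topdual_sqr_integrable tl.
have e0 : (\int[gamma]_x `|(l x ^+ 2)%:E| = 0)%E.
  rewrite -[LHS]fineK; last first.
    exact: (integrable_fin_num measurableT (integrable_norm isq)).
  rewrite -[X in X%:E]/(\int[gamma]_x `|l x ^+ 2|).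
  transitivity (cov l l)%:E; last by rewrite l0.
  congr EFin; apply: eq_Rintegral => x _.
  by rewrite -expr2 ger0_norm// sqr_ge0.
have msq : measurable_fun setT (fun x : borel X => (l x ^+ 2)%:E).
  by apply/measurable_EFinP; exact: measurable_funX.
have := (@ae_eq_integral_abs _ _ _ gamma setT measurableT (fun x => (l x ^+ 2)%:E) msq).1 e0.
apply: filterS => x /(_ I) [] /eqP; rewrite expf_eq0/= => /eqP.
exact.
Qed.

(** Gaussian integration by parts for two functionals. Since l + t m is again a functional, E cos(l
    + t m + b) is explicit for every t, and its derivative at 0 is computed both under the integral
    and on the formula. *)
Lemma Rintegral_mul_sin l m (b : R) : topdual l -> topdual m ->
  \int[gamma]_x (m x * sin (l x + b)) = cov l m * cos b * expR (- (cov l l) / 2).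
Proof.
move=> tl tm; have [_ LD LZ] := @topdual_linear R X.
have tlm t : topdual (fun x => l x + t * m x) by apply: LD => //; exact: LZ.
have sinle (x : R) : `|sin x| <= 1 by rewrite ler_norml sin_geN1 sin_le1.
have h1 : is_derive (0 : R) 1 (fun t => \int[gamma]_x cos (l x + t * m x + b))
    (\int[gamma]_x (- (m x * sin (l x + 0 * m x + b)))).
  apply: (@derive_under_Rintegral _ _ _ gamma (fun t x => cos (l x + t * m x + b))
    (fun t x => - (m x * sin (l x + t * m x + b))) (fun x => `|m x|) 0 (-1) 1).
  - by rewrite ltrN10 ltr01.
  - move=> r _; apply: (@prob_bounded_integrable _ _ _ _ _ 1).
      by apply: measurable_cos_comp; exact: topdual_measurable.
    by move=> x; rewrite ler_norml cos_geN1 cos_le1.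
  - by move=> r x _; apply: is_derive_eq; rewrite /GRing.scale/=; ring.
  - exact/integrable_norm/topdual_integrable.
  - by move=> r x _; rewrite normrN normrM ler_piMr.
have h2 : is_derive (0 : R) 1 (fun t => \int[gamma]_x cos (l x + t * m x + b))
    (- (cov l m * cos b * expR (- (cov l l) / 2))).
  have -> : (fun t => \int[gamma]_x cos (l x + t * m x + b)) =
     (fun t => cos b * expR (- (cov l l + 2 * t * cov l m + t ^+ 2 * cov m m) / 2)).
    by apply/funext => t; rewrite (Rintegral_cos _ (tlm t)) covDD.
  apply: is_derive_eq; rewrite /GRing.scale/= expr0n/= mulr0 !mul0r !addr0.
  by field.
have := @derive_val _ _ _ _ _ _ _ h1; rewrite (@derive_val _ _ _ _ _ _ _ h2) => e.
apply: oppr_inj; rewrite e -[LHS]mulN1r -RintegralZl//.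
  by apply: eq_Rintegral => x _; rewrite mul0r addr0 mulN1r.
apply: le_integrable_norm (integrable_norm (topdual_integrable tm)).
  apply: measurable_funM; first exact: topdual_measurable.
  have -> : (fun x : borel X => sin (l x + b)) = (fun x => cos (l x + (b - pi / 2))).
    by apply/funext => x; rewrite addrA cosBpihalf.
  by apply: measurable_cos_comp; exact: topdual_measurable.
by move=> x; rewrite normrM ler_piMr.
Qed.

Let powR_le_expR (p t : R) : 0 < p -> `|t| `^ p <= expR (p * `|t|).
Proof.
move=> p0; rewrite mulrC expRM; apply: ge0_ler_powR; rewrite ?nnegrE ?expR_ge0//.
  exact: ltW.
by apply: le_trans (expR_ge1Dx _); rewrite lerDr.
Qed.

Lemma measurable_norm_powR (p : R) : measurable_fun setT (fun t : R => `|t| `^ p).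
Proof.
have := measurableT_comp (measurable_powR p) (@normr_measurable R setT).
exact.
Qed.

Lemma std_normal_powR (p : R) : 0 < p ->
  (\int[normal_prob 0 1]_t (`|t| `^ p)%:E = (gauss_C p `^ p)%:E)%E.
Proof.
move=> p0; have mp := measurable_norm_powR p.
have ip : (normal_prob (0 : R) 1).-integrable setT (EFin \o (fun t : R => `|t| `^ p)).
  apply: le_integrable_norm (normal_expR_norm_integrable (ltr01 : 0 < 1 :> R) p) => // t.
  by rewrite ger0_norm ?powR_ge0// powR_le_expR.
have fin := integrable_fin_num measurableT ip.
rewrite /gauss_C -powRrM mulVf ?gt_eqF// powRr1; last first.
  by rewrite mulr_ge0 ?powR_ge0// Rintegral_ge0// => t _; rewrite mulr_ge0 ?powR_ge0 ?expR_ge0.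
have pdfE (t : R) : normal_pdf 0 1 t = (2 * pi) `^ (- 2^-1) * expR (- (t ^+ 2 / 2)).
  rewrite normal_pdfE ?oner_eq0// /normal_peak /normal_fun subr0 expr1n mul1r mulNr.
  congr (_ * _); rewrite powRN; congr (_^-1).
  by rewrite powR12_sqrt ?mulr_ge0 ?pi_ge0// mulr_natl.
have e : (\int[normal_prob 0 1]_t (`|t| `^ p)%:E =
   ((2 * pi) `^ (- 2^-1))%:E * \int[lebesgue_measure]_t (`|t| `^ p * expR (- (t ^+ 2 / 2)))%:E)%E.
  rewrite ge0_integral_normal//.
  rewrite -ge0_integralZl//.
  - by apply: eq_integral => t _; rewrite pdfE -EFinM mulrCA.
  - apply/measurable_EFinP/measurable_funM => //.
    apply: measurableT_comp => //; apply: measurableT_comp => //.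
    by apply: measurable_funM => //; exact: measurable_funX.
  - by rewrite lee_fin powR_ge0.
rewrite e EFinM; congr (_ * _)%E; rewrite /Rintegral fineK//.
move: fin; rewrite /= e.
have I0 : (0 <= \int[lebesgue_measure]_t (`|t| `^ p * expR (- (t ^+ 2 / 2)))%:E)%E.
  by apply: integral_ge0 => t _; rewrite lee_fin mulr_ge0 ?powR_ge0 ?expR_ge0.
have c0 : 0 < (2 * pi) `^ (- 2^-1) :> R by rewrite powR_gt0// mulr_gt0// pi_gt0.
(* The Lebesgue integral cannot be infinite, as a positive multiple of it is a finite normal
   moment. *)
case: (integral _ _ _) I0 => // _.
by rewrite mulry gtr0_sg// mul1e.
Qed.

Lemma integral_powR_topdual l (p : R) : 0 < p -> topdual l ->
  (\int[gamma]_x (`|l x| `^ p)%:E = ((Num.sqrt (cov l l) * gauss_C p) `^ p)%:E)%E.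
Proof.
move=> p0 tl; have ml := topdual_measurable tl; have mp := measurable_norm_powR p.
have [l0|l0] := eqVneq (cov l l) 0.
  rewrite l0 sqrtr0 mul0r powR0 ?gt_eqF//.
  rewrite (ae_eq_integral (cst 0%E)) ?integral0//.
  - by apply/measurable_EFinP; exact: (measurableT_comp mp ml).
  - have := cov_eq0 tl l0; apply: filterS; first exact: (ae_filter_ringOfSetsType gamma).
    move=> x lx _.
    by rewrite lx normr0 powR0// gt_eqF.
have V0 : 0 < cov l l by rewrite lt_neqAle eq_sym l0 cov_ge0.
set s := Num.sqrt _; have s0 : 0 < s by rewrite sqrtr_gt0.
have [_ _ LZ] := @topdual_linear R X.
have tm := LZ s^-1 _ tl.
have m1 : cov (fun x => s^-1 * l x) (fun x => s^-1 * l x) = 1.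
  rewrite covZl// covZr// mulrA -invfM -expr2 sqr_sqrtr ?(ltW V0)// mulVf//.
rewrite powRM ?powR_ge0 ?(ltW s0)// EFinM -std_normal_powR//.
rewrite -(ge0_integral_law (nu := normal_prob 0 1) (topdual_measurable tm) (topdual_std_law tm m1)); last 2 first.
- exact/measurable_EFinP.
- by move=> t; rewrite lee_fin powR_ge0.
rewrite -ge0_integralZl//.
- apply: eq_integral => x _; rewrite -EFinM -{1}(gtr0_norm s0).
  by rewrite -powRM// -normrM mulrA divff ?gt_eqF// mul1r.
- by apply/measurable_EFinP; exact: (measurableT_comp mp (topdual_measurable tm)).
- by rewrite lee_fin powR_ge0.
Qed.

End gaussian.

(** * Exponential tilting and uniqueness of Radon measures *)

Lemma norm_sin_le (R : realType) (x : R) : `|sin x| <= `|x|.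
Proof.
wlog x0 : x / 0 <= x.
  move=> h; have [/h//|/ltW x0] := leP 0 x.
  by rewrite -normrN -sinN -[leRHS]normrN; apply: h; rewrite oppr_ge0.
have [c _] : exists2 c, c \in `[0, x] & sin x - sin 0 = cos c * (x - 0).
  apply: MVT_segment => //.
  by apply: continuous_subspaceT => t; exact: continuous_sin.
rewrite sin0 !subr0 => ->; rewrite normrM ler_piMl//.
by rewrite ler_norml cos_geN1 cos_le1.
Qed.

(** A bounded substitute for t: n sin(t/n) is a trigonometric polynomial, so its exponential lies in
    the uniform closure, tends to e^t and is dominated by e^|t|. *)
Lemma cvg_sin_scale (R : realType) (t : R) :
  n.+1%:R * sin (t / n.+1%:R) @[n --> \oo] --> t.
Proof.
have d : is_derive (0 : R) 1 (fun h => sin (t * h)) t.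
  by apply: is_derive_eq; rewrite /GRing.scale/= mulr0 cos0; ring.
have [dr dv] := d.
have c : (fun h : R => h^-1 *: (((fun h => sin (t * h)) \o shift 0) (h *: 1) - sin (t * 0))) h
    @[h --> 0^'] --> t by rewrite -[X in _ --> X]dv; exact: dr.
move/cvgr_dnbhsP : c => /(_ (fun n => n.+1%:R^-1)) c.
have {c} := c (conj (fun n => _) (@cvg_harmonic R)).
rewrite mulr0 sin0 => c.
under eq_fun.
  move=> n.
  have -> : n.+1%:R * sin (t / n.+1%:R) = n.+1%:R^-1^-1 *: (((fun h => sin (t * h)) \o shift 0) (n.+1%:R^-1 *: 1) - 0).
    by rewrite /= invrK subr0 addr0 /GRing.scale/= mulr1.
  over.
by apply: c => n; rewrite invr_eq0 pnatr_eq0.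
Qed.

Lemma cos_mul_cos (R : realType) (x y : R) :
  cos x * cos y = 2^-1 * cos (x + y) + 2^-1 * cos (x - y).
Proof. by rewrite cosD cosB; field. Qed.

Section linear_functions.
Context (R : realType).

Definition linear_functions : set (R -> R) := [set l | exists s, l = fun t => s * t].

Lemma linear_functions_linear : linear_family linear_functions.
Proof.
split.
- by exists 0; apply/funext => t; rewrite mul0r.
- by move=> _ _ [s ->] [r ->]; exists (s + r); apply/funext => t; rewrite mulrDl.
- by move=> a _ [s ->]; exists (a * s); apply/funext => t; rewrite mulrA.
Qed.

Lemma utrig_exp_sin_cos (a b : R) (n : nat) : utrig linear_functions
  (fun t => expR (n.+1%:R * sin (t / n.+1%:R)) * cos (a * t + b)).
Proof.
have lin := linear_functions_linear.
apply: (utrigM lin).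
  apply: (utrig_exp lin); apply: (utrigM lin); first exact: utrig_cst.
  have -> : (fun t : R => sin (t / n.+1%:R)) = (fun t => sin (n.+1%:R^-1 * t + 0)).
    by apply/funext => t; rewrite addr0 mulrC.
  by apply: utrig_trig; apply: trig_sin => //; exists n.+1%:R^-1.
by apply: utrig_trig; apply: trig_cos => //; exists a.
Qed.

End linear_functions.

Section tilt.
Context (R : realType) (X : tvsType R) (gamma : probability (borel X) R).
Hypothesis hgamma : radon_centered_gaussian gamma.
Implicit Types (l m g : X -> R).

Local Notation integrable f := (gamma.-integrable setT (EFin \o (f : borel X -> R))).

(** Uncorrelated functionals are independent. For v a cosine this is the product-to-sum formula, the
    variances of s g + m and s g - m being equal; the rest follows by uniform approximation. *)
Let utrig_indep g m b v : topdual g -> topdual m -> cov gamma g m = 0 ->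
  utrig (@linear_functions R) v ->
  \int[gamma]_x (v (g x) * cos (m x + b)) =
  \int[gamma]_x (v (g x) * (cos b * expR (- (cov gamma m m) / 2))).
Proof.
move=> tg tm gm.
have [_ LD LZ] := @topdual_linear R X.
have mg (l : R -> R) : @linear_functions R l -> measurable_fun setT (l \o g : borel X -> R).
  by move=> [s ->]; apply: measurable_funM => //; exact: topdual_measurable.
apply: utrig_integral_eq => //.
- by apply: integrable_cos; exact: topdual_measurable.
- exact: finite_measure_integrable_cst.
move=> _ c [s ->].
have tp t : topdual (fun x => s * g x + t * m x) by apply: LD; exact: LZ.
have V t : cov gamma (fun x => s * g x + t * m x) (fun x => s * g x + t * m x) =
    s ^+ 2 * cov gamma g g + t ^+ 2 * cov gamma m m.
  rewrite covDD//; last exact: LZ.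
  by rewrite !covZl ?covZr ?gm//; [ring|exact: LZ].
have icos l d : topdual l -> integrable (fun x => cos (l x + d)).
  by move=> tl; apply: integrable_cos; exact: topdual_measurable.
transitivity (\int[gamma]_x (2^-1 * cos ((s * g x + 1 * m x) + (c + b)) +
                             2^-1 * cos ((s * g x + (-1) * m x) + (c - b)))).
  apply: eq_Rintegral => x _.
  have -> : s * g x + 1 * m x + (c + b) = (s * g x + c) + (m x + b) by ring.
  have -> : s * g x + (-1) * m x + (c - b) = (s * g x + c) - (m x + b) by ring.
  exact: cos_mul_cos.
rewrite RintegralD//; [|by apply: integrable_scale; exact: icos..].
rewrite !RintegralZl//; [|exact: icos..].
rewrite !(Rintegral_cos hgamma _ (tp _)) !V.
rewrite RintegralZr//; last by apply: icos; exact: LZ.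
rewrite (Rintegral_cos hgamma _ (LZ s _ tg)) covZl ?covZr//; last exact: LZ.
rewrite (cosD c) (cosB c).
have -> : - (s * (s * cov gamma g g)) / 2 = - (s ^+ 2 * cov gamma g g) / 2 by ring.
have E t : - (s ^+ 2 * cov gamma g g + t * cov gamma m m) / 2 =
  - (s ^+ 2 * cov gamma g g) / 2 + - (t * cov gamma m m) / 2 by ring.
rewrite !E !expRD expr1n sqrrN expr1n !mul1r; by field.
Qed.

Lemma expR_topdual_integrable g : topdual g -> integrable (fun x => expR (g x)).
Proof.
move=> tg; apply: le_integrable_norm (topdual_expR_integrable hgamma 1 tg).
  by apply: measurableT_comp => //; exact: topdual_measurable.
by move=> x; rewrite ger0_norm ?expR_ge0// ler_expR mul1r ler_norm.
Qed.

(** The exponential is unbounded, hence out of reach of uniform approximation; it is the limit of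
    exp(n sin(g/n)) by dominated convergence. *)
Let exp_indep a b' g m b : topdual g -> topdual m -> cov gamma g m = 0 ->
  \int[gamma]_x (expR (g x) * cos (a * g x + b') * cos (m x + b)) =
  \int[gamma]_x (expR (g x) * cos (a * g x + b')) * (cos b * expR (- (cov gamma m m) / 2)).
Proof.
move=> tg tm gm.
have mg := topdual_measurable tg.
have [_ LD LZ] := @topdual_linear R X.
pose v n (t : R) := expR (n.+1%:R * sin (t / n.+1%:R)) * cos (a * t + b').
have uv n : utrig (@linear_functions R) (v n) by exact: utrig_exp_sin_cos.
have cv t : v n t @[n --> \oo] --> expR t * cos (a * t + b').
  apply: cvgM; last exact: cvg_cst.
  apply: continuous_cvg; first exact: continuous_expR.
  exact: cvg_sin_scale.
have vle n t : `|v n t| <= expR `|t|.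
  rewrite /v normrM (ger0_norm (expR_ge0 _)) -[leRHS]mulr1 ler_pM ?expR_ge0//; last first.
    by rewrite ler_norml cos_geN1 cos_le1.
  rewrite ler_expR (le_trans (ler_norm _))// normrM normr_nat -ler_pdivlMl ?ltr0n//.
  by rewrite (le_trans (norm_sin_le _))// normrM mulrC ger0_norm.
have ie : integrable (fun x => expR `|g x|).
  by have := topdual_expR_integrable hgamma 1 tg; under eq_fun do rewrite mul1r.
have mvg n : measurable_fun setT ((fun x => v n (g x)) : borel X -> R).
  apply: (@utrig_measurable R R (@linear_functions R) _ (borel X) g (v n)) => //.
  by move=> _ [s ->]; apply: measurable_funM.
have mcosm : measurable_fun setT ((fun x => cos (m x + b)) : borel X -> R).
  by apply: measurable_cos_comp; exact: topdual_measurable.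
have cosle (x : R) : `|cos x| <= 1 by rewrite ler_norml cos_geN1 cos_le1.
have [_ c1] : integrable (fun x => expR (g x) * cos (a * g x + b') * cos (m x + b)) /\
    \int[gamma]_x (v n (g x) * cos (m x + b)) @[n --> \oo] -->
    \int[gamma]_x (expR (g x) * cos (a * g x + b') * cos (m x + b)).
  apply: Rintegral_dominated_cvg ie _.
  - by move=> n; exact: measurable_funM.
  - by move=> x; apply: cvgM; [exact: cv|exact: cvg_cst].
  - by move=> n x; rewrite normrM (le_trans _ (vle n (g x)))// ler_piMr.
have [_ c2] : integrable (fun x => expR (g x) * cos (a * g x + b')) /\
    \int[gamma]_x (v n (g x)) @[n --> \oo] -->
    \int[gamma]_x (expR (g x) * cos (a * g x + b')).
  apply: Rintegral_dominated_cvg ie _.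
  - exact: mvg.
  - by move=> x; exact: cv.
  - by move=> n x; exact: vle.
set K := cos b * _.
have c3 : \int[gamma]_x (v n (g x)) * K @[n --> \oo] -->
    \int[gamma]_x (expR (g x) * cos (a * g x + b')) * K.
  by apply: cvgM c2 _; exact: cvg_cst.
have e : (fun n => \int[gamma]_x (v n (g x) * cos (m x + b))) =
    (fun n => \int[gamma]_x (v n (g x)) * K).
  apply/funext => n; rewrite (utrig_indep b tg tm gm (uv n)) /= RintegralZr//.
  by apply: le_integrable_norm ie => // x; exact: vle.
rewrite e in c1.
exact: (cvg_unique _ c1 c3).
Qed.

Let std_tilt a b g : topdual g -> cov gamma g g = 1 ->
  \int[gamma]_x (expR (g x) * cos (a * g x + b)) =
  expR (2^-1) * (cos (a + b) * expR (- a ^+ 2 / 2)).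
Proof.
move=> tg g1.
have mF : measurable_fun setT (fun t : R => expR t * cos (a * t + b)).
  by apply: measurable_funM => //; apply: measurable_cos_comp; exact: measurable_funM.
rewrite (Rintegral_law (nu := normal_prob 0 1) (topdual_measurable tg) (topdual_std_law hgamma tg g1) mF).
have cc : continuous (fun x : R => cos (a * x + b)).
  move=> x; apply: continuous_comp; last exact: continuous_cos.
  by apply: cvgD; [apply: cvgM; [exact: cvg_cst|exact: cvg_id]|exact: cvg_cst].
have cosle (x : R) : `|cos (a * x + b)| <= 1 by rewrite ler_norml cos_geN1 cos_le1.
have := @Rintegral_normal_shift R 1 ltr01 1 _ 1 cc cosle.
have -> : \int[normal_prob 0 1]_x cos (a * (x + 1) + b) =
    \int[normal_prob 0 1]_x cos (a * x + (a + b)).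
  by apply: eq_Rintegral => x _; congr cos; ring.
rewrite (Rintegral_normal_cos ltr01) => e0.
have -> : - a ^+ 2 / 2 = - (1 ^+ 2 * a ^+ 2) / 2 by rewrite expr1n mul1r.
rewrite -e0.
rewrite -RintegralZl//.
  apply: eq_Rintegral => x _; rewrite mulrCA -expRD mulrC; congr (_ * expR _).
  by field.
have h := integrable_scale (expR (- 2^-1)) (normal_expR_integrable (ltr01 : 0 < 1 :> R) 1).
have h2 : (normal_prob (0 : R) 1).-integrable setT
    (EFin \o (fun x : R => expR (1 * x / 1 ^+ 2 - 1 ^+ 2 / (2 * 1 ^+ 2)))).
  apply: eq_integrable h => // x _ /=.
  by rewrite -expRD; congr (expR _)%:E; field.
exact: integrableM_bounded h2 (continuous_measurable_fun cc) cosle.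
Qed.

(** If l(h) = cov(l, g) for all l, the right-hand side is E cos(l(x + h) + b): the tilted measure
    has the Fourier transform of a translate. With l = a g + m, a = cov(l, g), the part m is
    independent of g, and a one-dimensional shift by 1 remains. *)
Lemma Rintegral_cos_tilt l g b : topdual l -> topdual g -> cov gamma g g = 1 ->
  \int[gamma]_x (cos (l x + b) * expR (g x - 2^-1)) =
  cos (cov gamma l g + b) * expR (- (cov gamma l l) / 2).
Proof.
move=> tl tg g1; have [_ LD LZ] := @topdual_linear R X.
set a := cov gamma l g.
pose m (x : X) := l x + (- a) * g x.
have tm : topdual m by apply: LD => //; exact: LZ.
have gm : cov gamma g m = 0.
  by rewrite covDr ?covZr ?g1//; [rewrite covC -/a; ring|exact: LZ].
have Vm : cov gamma m m = cov gamma l l - a ^+ 2.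
  by rewrite covDD// g1 -/a; ring.
have ieg := expR_topdual_integrable tg.
have icos l' c : topdual l' -> integrable (fun x => cos (l' x + c) * expR (g x)).
  by move=> tl'; apply: integrable_cosM => //; exact: topdual_measurable.
have i2 c d : integrable (fun x => expR (g x) * cos (a * g x + c) * cos (m x + d)).
  have := icos _ c (LZ a _ tg) => h.
  apply: (@eq_integrable _ _ _ gamma setT measurableT (fun x => (cos (m x + d) * (cos (a * g x + c) * expR (g x)))%:E)).
    by move=> x _ /=; congr EFin; ring.
  by apply: integrable_cosM => //; exact: topdual_measurable.
(* Addition formula for a g + (m + b), with both sines written as cosines of phase -pi/2 so that the
   previous lemmas apply. *)
transitivity (expR (- 2^-1) * \int[gamma]_x
   (expR (g x) * cos (a * g x + 0) * cos (m x + b) +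
    (-1) * (expR (g x) * cos (a * g x + (- (pi / 2))) * cos (m x + (b - pi / 2))))).
  rewrite -RintegralZl//; last first.
    by apply: integrable_add; [exact: i2|apply: integrable_scale; exact: i2].
  apply: eq_Rintegral => x _; rewrite addr0 addrA !cosBpihalf.
  have -> : l x + b = a * g x + (m x + b) by rewrite /m; ring.
  by rewrite (cosD (a * g x)) expRD; ring.
have i3 := integrable_scale (-1) (i2 (- (pi / 2)) (b - pi / 2)).
rewrite (RintegralD _ (i2 0 b) i3)//.
rewrite (RintegralZl (-1) measurableT (i2 _ _)).
rewrite !exp_indep// !std_tilt// !cosBpihalf addr0 (cosD a) Vm.
have -> : - (cov gamma l l - a ^+ 2) / 2 = - cov gamma l l / 2 + a ^+ 2 / 2 by field.
rewrite expRD.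
have e1 : expR (- 2^-1) * expR 2^-1 = 1 :> R by rewrite -expRD addNr expR0.
have e2 : expR (- a ^+ 2 / 2) * expR (a ^+ 2 / 2) = 1 by rewrite -expRD mulNr addNr expR0.
transitivity ((expR (- 2^-1) * expR 2^-1) * (expR (- a ^+ 2 / 2) * expR (a ^+ 2 / 2)) *
  ((cos a * cos b - sin a * sin b) * expR (- cov gamma l l / 2))).
  by ring.
by rewrite e1 e2 !mul1r.
Qed.

End tilt.

(** * Compact inner regularity and its consequences *)

Section inner_compact.
Context (R : realType) (X : tvsType R).

(** The condition of [radon] for any set function, so that it also applies to weighted and
    translated measures. *)
Definition inner_compact (mu : set (borel X) -> \bar R) :=
  forall B : set (borel X), measurable B -> forall e : R, 0 < e ->
    exists K : set X, [/\ compact K, K `<=` B & (mu (B `\` K) < e%:E)%E].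

Hypothesis hX : hausdorff_space X.

Lemma compact_measurable (K : set X) : compact K -> measurable (K : set (borel X)).
Proof.
move=> /(compact_closed hX) cK; rewrite -[K]setCK; apply: measurableC.
by apply: sub_sigma_algebra; exact: closed_openC.
Qed.

Lemma utrig_separation (K K' : set X) : compact K -> compact K' ->
  K `&` K' = set0 -> forall e : R, 0 < e ->
  exists u, [/\ utrig (@topdual R X) u, (forall z, 0 <= u z <= 1),
    (forall z, K z -> 1 - e <= u z) & forall z, K' z -> u z <= e].
Proof.
move=> cK cK' KK' e e0; have lin := @topdual_linear R X.
apply: (compact_separation _ _ _ _ cK cK') => //.
- by move=> c; exact: utrig_cst.
- by move=> u v; exact: utrigD.
- by move=> u v; exact: utrigM.
- by move=> u; exact: utrig_exp.
move=> x y Kx K'y.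
have xy : x <> y by move=> xy; have : set0 x by rewrite -KK'; split => //; rewrite xy.
have [l [ll cl] lxy] := topdual_separates hX xy.
have lxy0 : l x - l y != 0 by rewrite subr_eq0; apply/eqP.
(* The scaling makes m(x) - m(y) = pi, so that cos(m - m(y)) is -1 at x and 1 at y. *)
pose m z := pi / (l x - l y) * l z.
have tm : topdual m by have [_ _ LZ] := lin; apply: LZ.
exists (fun z => cos (m z + (- m y))); split.
- by apply: utrig_trig; apply: trig_cos.
- move=> z; apply: continuous_comp; last exact: continuous_cos.
  by apply: cvgD; [exact: tm.2|exact: cvg_cst].
- rewrite subrr cos0 /m -mulrBr divfK// cospi => h; clear -h; lra.
Qed.

Lemma inner_compact_pair (mu : {finite_measure set (borel X) -> \bar R})
    (A : set (borel X)) (e : R) :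
  inner_compact mu -> measurable A -> 0 < e ->
  exists K K' : set X, [/\ compact K, compact K', K `<=` A, K' `<=` ~` A &
    (mu (~` (K `|` K')) < e%:E)%E].
Proof.
move=> imu mA e0; have e2 : 0 < e / 2 by rewrite divr_gt0.
have [K [cK KA muK]] := imu _ mA _ e2.
have [K' [cK' KA' muK']] := imu _ (measurableC mA) _ e2.
exists K, K'; split => //.
have mK := compact_measurable cK; have mK' := compact_measurable cK'.
apply: le_lt_trans (_ : (mu ((A `\` K) `|` (~` A `\` K')) < _)%E).
  apply: le_measure; rewrite ?inE.
  - exact/measurableC/measurableU.
  - by apply: measurableU; apply: measurableD => //; exact: measurableC.
  - move=> x /= h; have [xA|xA] := pselect (A x); [left|right]; split => //.
      by move=> Kx; apply: h; left.
    by move=> Kx; apply: h; right.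
rewrite (splitr e) EFinD; apply: le_lt_trans (lteD muK muK').
apply: measureU2; apply: measurableD => //; exact: measurableC.
Qed.

Lemma setI_sub_compl (A K K' : set X) : K `<=` A -> K' `<=` ~` A -> K `&` K' = set0.
Proof. by move=> KA KA'; apply/seteqP; split => // x [/KA Ax /KA']. Qed.

Lemma utrig_borel (u : X -> R) : utrig (@topdual R X) u ->
  measurable_fun setT (u : borel X -> R).
Proof.
move=> uu; apply: (@utrig_measurable R X (@topdual R X) _ (borel X) idfun u) => //.
by move=> l tl; exact: topdual_measurable.
Qed.

Lemma topdual_borel (l : X -> R) : topdual l ->
  measurable_fun setT (l \o idfun : borel X -> R).
Proof. exact: topdual_measurable. Qed.

Lemma finite_bounded_integrable (mu : {finite_measure set (borel X) -> \bar R})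
    (f : X -> R) (b : R) : measurable_fun setT (f : borel X -> R) ->
  (forall x, `|f x| <= b) -> mu.-integrable setT (EFin \o (f : borel X -> R)).
Proof.
move=> mf fb; apply: le_integrable_norm mf fb _.
exact: finite_measure_integrable_cst.
Qed.

Let indic_approx (mu : {finite_measure set (borel X) -> \bar R})
    (A : set (borel X)) (K K' : set X) (u : X -> R) (d : R) :
  measurable A -> compact K -> compact K' -> K `<=` A -> K' `<=` ~` A -> 0 < d ->
  utrig (@topdual R X) u -> (forall z, 0 <= u z <= 1) ->
  (forall z, K z -> 1 - d <= u z) -> (forall z, K' z -> u z <= d) ->
  \int[mu]_x `|\1_A x - u x| <= d * fine (mu setT) + fine (mu (~` (K `|` K'))).
Proof.
move=> mA cK cK' KA KA' d0 uu u01 uK uK'.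
have mK := compact_measurable cK; have mK' := compact_measurable cK'.
set N := ~` (K `|` K').
have mN : measurable (N : set (borel X)) by exact/measurableC/measurableU.
have mAu : measurable_fun setT ((fun x => \1_A x - u x) : borel X -> R).
  by apply: measurable_funB; [exact: measurable_indic|exact: utrig_borel].
have le1 x : `|\1_A x - u x| <= d + \1_N x.
  have /andP[u0 u1] := u01 x.
  have [xN|/contrapT] := pselect (N x).
    rewrite [\1_N x]indicE mem_set//= indicE.
    case: (x \in A); rewrite ler_norml /=; clear -d0 u0 u1; lra.
  have N0 : 0 <= \1_N x :> R by rewrite indicE.
  case=> [Kx|K'x].
    rewrite [\1_A x]indicE mem_set; last exact: KA.
    rewrite ler_norml /=; have := uK _ Kx; clear -N0 d0 u0 u1; lra.
  rewrite [\1_A x]indicE memNset; last exact: KA'.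
  rewrite ler_norml /=; have := uK' _ K'x; clear -N0 d0 u0 u1; lra.
have i1 : mu.-integrable setT (EFin \o (fun x : borel X => `|\1_A x - u x|)).
  apply: (@finite_bounded_integrable mu _ (d + 1)); first exact: measurableT_comp.
  move=> x; rewrite normr_id (le_trans (le1 x))// lerD2l indicE.
  by case: (x \in N).
have i2 : mu.-integrable setT (EFin \o (\1_N : borel X -> R)) by exact: integrable_indic.
have i3 : mu.-integrable setT (EFin \o (fun _ : borel X => d)).
  exact: finite_measure_integrable_cst.
apply: (@le_trans _ _ (\int[mu]_x (d + \1_N x))).
  by apply: le_Rintegral => //; exact: (integrable_add i3 i2).
rewrite RintegralD// Rintegral_cst// lerD2l /Rintegral integral_indic// setIT.
exact: lexx.
Qed.

Lemma utrig_dense_indic (mu : {finite_measure set (borel X) -> \bar R})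
    (A : set (borel X)) (e : R) : inner_compact mu -> measurable A -> 0 < e ->
  exists u, [/\ utrig (@topdual R X) u, (forall z, 0 <= u z <= 1) &
    \int[mu]_x `|\1_A x - u x| <= e].
Proof.
move=> imu mA e0.
set M := fine (mu setT); have M0 : 0 <= M by exact: fine_ge0.
have d0 : 0 < e / (M + 1) by rewrite divr_gt0// ltr_wpDl.
set d := e / (M + 1) in d0.
have [K [K' [cK cK' KA KA' muKK]]] := inner_compact_pair imu mA d0.
have [u [uu u01 uK uK']] := utrig_separation cK cK' (setI_sub_compl KA KA') d0.
exists u; split => //.
apply: le_trans (indic_approx mu mA cK cK' KA KA' d0 uu u01 uK uK') _.
have h : fine (mu (~` (K `|` K'))) <= d.
  rewrite -lee_fin fineK ?ltW//; apply: fin_num_measure.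
  by apply/measurableC/measurableU; exact: compact_measurable.
have -> : e = d * (M + 1) by rewrite /d divfK// gt_eqF// ltr_wpDl.
by rewrite mulrDr mulr1 lerD2l.
Qed.

(** One function u has to approximate the indicator of A for both measures; it is therefore built
    from the unions of the compact sets chosen for mu and for nu. *)
Lemma radon_unique (mu nu : {finite_measure set (borel X) -> \bar R}) :
  inner_compact mu -> inner_compact nu ->
  (forall l b, topdual l -> \int[mu]_x cos (l x + b) = \int[nu]_x cos (l x + b)) ->
  forall A : set (borel X), measurable A -> mu A = nu A.
Proof.
move=> imu inu h A mA.
have hu u : utrig (@topdual R X) u -> \int[mu]_x u x = \int[nu]_x u x.
  move=> uu.
  have i1 (m : {finite_measure set (borel X) -> \bar R}) :
    m.-integrable setT (EFin \o (fun _ : borel X => 1 : R)).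
    exact: finite_measure_integrable_cst.
  have := @utrig_integral_eq R X (@topdual R X) _ (borel X) _ (borel X) mu nu
    idfun idfun (fun=> 1) (fun=> 1) u topdual_borel topdual_borel (i1 mu) (i1 nu) _ uu.
  under [X in (_ -> X = _) -> _]eq_Rintegral do rewrite mulr1.
  under [X in (_ -> _ = X) -> _]eq_Rintegral do rewrite mulr1.
  apply=> l b tl.
  under eq_Rintegral do rewrite mulr1.
  under [RHS]eq_Rintegral do rewrite mulr1.
  exact: h.
suff : fine (mu A) = fine (nu A).
  move=> e; rewrite -[LHS]fineK ?e ?fineK//; exact: fin_num_measure.
set M := fine (mu setT); have M0 : 0 <= M by exact: fine_ge0.
set M' := fine (nu setT); have M0' : 0 <= M' by exact: fine_ge0.
apply/eqP; rewrite -subr_eq0 -normr_le0; apply/ler_addgt0Pr => e e0; rewrite add0r.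
(* The two errors are d M + d and d M' + d. *)
set C := M + M' + 2; have C0 : 0 < C by rewrite /C; lra.
have d0 : 0 < e / C by rewrite divr_gt0.
set d := e / C in d0.
have [K1 [K1' [cK1 cK1' KA1 KA1' mu1]]] := inner_compact_pair imu mA d0.
have [K2 [K2' [cK2 cK2' KA2 KA2' mu2]]] := inner_compact_pair inu mA d0.
have cK := compactU cK1 cK2; have cK' := compactU cK1' cK2'.
have KA : K1 `|` K2 `<=` A by move=> x [/KA1|/KA2].
have KA' : K1' `|` K2' `<=` ~` A by move=> x [/KA1'|/KA2'].
have [u [uu u01 uK uK']] := utrig_separation cK cK' (setI_sub_compl KA KA') d0.
have bound (m : {finite_measure set (borel X) -> \bar R}) (J J' : set X) :
    compact J -> compact J' -> J `<=` K1 `|` K2 -> J' `<=` K1' `|` K2' ->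
    (m (~` (J `|` J')) < d%:E)%E -> `|fine (m A) - \int[m]_x u x| <= d * fine (m setT) + d.
  move=> cJ cJ' JK JK' mJ.
  have iA : m.-integrable setT (EFin \o (\1_A : borel X -> R)) by exact: integrable_indic.
  have iu : m.-integrable setT (EFin \o (u : borel X -> R)).
    apply: (@finite_bounded_integrable m _ 1); first exact: utrig_borel.
    by move=> x; have /andP[u0 u1] := u01 x; rewrite ger0_norm.
  have -> : fine (m A) = \int[m]_x (\1_A x : R).
    by rewrite /Rintegral integral_indic// setIT.
  rewrite -RintegralB//; apply: le_trans (le_normr_Rintegral _ (integrable_sub iA iu)) _ => //.
  apply: le_trans (indic_approx m mA cJ cJ' (subset_trans JK KA) (subset_trans JK' KA') d0 uu u01 _ _) _.
  - by move=> z /JK; exact: uK.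
  - by move=> z /JK'; exact: uK'.
  rewrite lerD2l -lee_fin fineK ?ltW//; apply: fin_num_measure.
  by apply/measurableC/measurableU; exact: compact_measurable.
have b1 := bound mu _ _ cK1 cK1' (@subsetUl _ _ _) (@subsetUl _ _ _) mu1.
have b2 := bound nu _ _ cK2 cK2' (@subsetUr _ _ _) (@subsetUr _ _ _) mu2.
rewrite -(hu _ uu) in b2.
set I := \int[mu]_x u x in b1 b2.
have -> : fine (mu A) - fine (nu A) = (fine (mu A) - I) - (fine (nu A) - I) by ring.
apply: le_trans (ler_normB _ _) _; apply: le_trans (lerD b1 b2) _.
have -> : e = d * C by rewrite /d divfK// gt_eqF.
by rewrite /C /M /M'; lra.
Qed.

End inner_compact.

(** * Cameron-Martin vectors *)

Section weighted.
Context d (T : measurableType d) (R : realType) (mu : {measure set T -> \bar R}).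

(* The proofs are arguments so that the measure structure can be inferred. *)
Definition weighted (w : T -> R) (_ : forall x, 0 <= w x)
    (_ : mu.-integrable setT (EFin \o w)) (A : set T) : \bar R :=
  (\int[mu]_(x in A) (w x)%:E)%E.

Context (w : T -> R) (w0 : forall x, 0 <= w x) (iw : mu.-integrable setT (EFin \o w)).

Let weighted0 : weighted w0 iw set0 = 0%E.
Proof. by rewrite /weighted integral_set0. Qed.

Let weighted_ge0 A : (0 <= weighted w0 iw A)%E.
Proof. by apply: integral_ge0 => x _; rewrite lee_fin. Qed.

Let weighted_sigma_additive : semi_sigma_additive (weighted w0 iw).
Proof.
move=> F mF tF mUF; rewrite /weighted ge0_integral_bigcup//=.
- by apply: is_cvg_ereal_nneg_natsum_cond => n _ _; exact: weighted_ge0.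
- by apply: measurable_funS (measurable_int mu iw).
- by move=> x _; rewrite lee_fin.
Qed.

HB.instance Definition _ := isMeasure.Build _ _ _ (weighted w0 iw)
  weighted0 weighted_ge0 weighted_sigma_additive.

Let weighted_fin : fin_num_fun (weighted w0 iw).
Proof.
move=> A mA; apply: integrable_fin_num => //.
exact: integrableS iw.
Qed.

HB.instance Definition _ := @Measure_isFinite.Build _ _ _ (weighted w0 iw) weighted_fin.

End weighted.

Section image_measure.
Context d (T : measurableType d) d' (T' : measurableType d') (R : realType)
  (mu : {finite_measure set T -> \bar R}).

Definition image_measure (f : T -> T') (_ : measurable_fun setT f) (A : set T') : \bar R :=
  mu (f @^-1` A).

Context (f : T -> T') (mf : measurable_fun setT f).

Let image0 : image_measure mf set0 = 0%E.
Proof. by rewrite /image_measure preimage_set0 measure0. Qed.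

Let image_ge0 A : (0 <= image_measure mf A)%E.
Proof. exact: measure_ge0. Qed.

Let image_sigma_additive : semi_sigma_additive (image_measure mf).
Proof.
rewrite -[image_measure mf]/(pushforward mu f).
by apply: measure_semi_sigma_additive.
Qed.

HB.instance Definition _ := isMeasure.Build _ _ _ (image_measure mf)
  image0 image_ge0 image_sigma_additive.

Let image_fin : fin_num_fun (image_measure mf).
Proof.
move=> A mA; apply: fin_num_measure.
by rewrite -[X in measurable X]setTI; exact: mf.
Qed.

HB.instance Definition _ := @Measure_isFinite.Build _ _ _ (image_measure mf) image_fin.

End image_measure.

Lemma not_both_le_quarter (R : realFieldType) (a : R) :
  1 - a <= 8^-1 + 8^-1 -> a <= 8^-1 + 8^-1 -> False.
Proof. lra. Qed.

Section cameron_martin_vectors.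
Context (R : realType) (X : tvsType R).
Hypothesis hX : hausdorff_space X.

(** Absolute continuity of the integral: what is small for gamma is small for the weighted
    measure. *)
Lemma inner_compact_weighted (gamma : {finite_measure set (borel X) -> \bar R})
    (w : borel X -> R) (w0 : forall x, 0 <= w x)
    (iw : gamma.-integrable setT (EFin \o w)) :
  inner_compact gamma -> inner_compact (weighted w0 iw).
Proof.
move=> ig B mB e e0.
have [d [d0 wd]] := integral_normr_continuous iw e0.
have [K [cK KB gK]] := ig B mB d d0.
exists K; split => //.
have mK := compact_measurable hX cK.
have mBK : measurable (B `\` K : set (borel X)) by exact: measurableD.
rewrite -[ltLHS]fineK ?lte_fin; last exact: fin_num_measure.
apply: le_lt_trans (wd _ mBK gK); rewrite /Rintegral/= /weighted.
rewrite le_eqVlt; apply/orP; left; apply/eqP; congr fine.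
by apply: eq_integral => x _; rewrite ger0_norm.
Qed.

Context (gamma : probability (borel X) R).
Hypothesis hgamma : radon_centered_gaussian gamma.

Lemma tilt_integrable g : topdual g ->
  gamma.-integrable setT (EFin \o (fun x : borel X => expR (g x - 2^-1))).
Proof.
move=> tg; have := integrable_scale (expR (- 2^-1)) (expR_topdual_integrable hgamma tg).
by apply: eq_integrable => // x _ /=; rewrite -expRD addrC.
Qed.

Let tilt_ge0 (g : X -> R) (x : borel X) : 0 <= expR (g x - 2^-1).
Proof. exact: expR_ge0. Qed.

Definition tilted g (tg : topdual g) := weighted (tilt_ge0 g) (tilt_integrable tg).

Lemma Rintegral_tilted g (tg : topdual g) (f : X -> R) :
  measurable_fun setT (f : borel X -> R) ->
  \int[tilted tg]_x f x = \int[gamma]_x (f x * expR (g x - 2^-1)).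
Proof.
move=> mf; apply: (@Rintegral_density _ _ _ gamma (tilted tg) (fun x : borel X => expR (g x - 2^-1))) => //.
apply: measurableT_comp => //; apply: measurable_funB => //.
exact: topdual_measurable.
Qed.

Lemma tilted_inner_compact g (tg : topdual g) : inner_compact (tilted tg).
Proof. by apply: inner_compact_weighted; exact: hgamma.1. Qed.

(** The total mass is the Fourier transform at the functional 0. *)
Lemma tilted_total g (tg : topdual g) : cov gamma g g = 1 -> tilted tg setT = 1%E.
Proof.
move=> g1; rewrite -[LHS]fineK; last exact: fin_num_measure.
have [L0 _ _] := @topdual_linear R X.
have := Rintegral_cos_tilt hgamma 0 L0 tg g1.
have -> : cov gamma (fun=> 0) g = 0.
  by rewrite /cov; under eq_Rintegral do rewrite mul0r; rewrite Rintegral_prob_cst.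
have -> : cov gamma (fun=> 0) (fun=> 0) = 0.
  by rewrite /cov; under eq_Rintegral do rewrite mul0r; rewrite Rintegral_prob_cst.
rewrite addr0 cos0 oppr0 mul0r expR0 mulr1 => <-; congr EFin.
by congr fine; apply: eq_integral => x _; rewrite mul1r.
Qed.

(** With a(l) = cov(l, g), gamma on the slice t = 1 stands for gamma translated by the vector still
    to be found, and the tilted measure is put on the slice t = 0. *)
Let ext_linear (a : (X -> R) -> R) : set (X * R -> R) :=
  [set k | exists2 l, topdual l & k = fun z => l z.1 + z.2 * a l].

Lemma Rintegral_le_off_compact (mu : {finite_measure set (borel X) -> \bar R}) (u : X -> R)
    (K : set X) (c d : R) : measurable_fun setT (u : borel X -> R) ->
  mu setT = 1%E -> compact K -> (mu (~` K) <= d%:E)%E -> 0 <= c ->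
  (forall x, 0 <= u x <= 1) -> (forall x, K x -> u x <= c) ->
  \int[mu]_x u x <= c + d.
Proof.
move=> mu_ mu1 cK muK c0 u01 uK.
have mK := compact_measurable hX cK; have mKc := measurableC mK.
have iu : mu.-integrable setT (EFin \o (u : borel X -> R)).
  apply: (@finite_bounded_integrable _ _ mu _ 1) => // x.
  by have /andP[? ?] := u01 x; rewrite ger0_norm.
have iK : mu.-integrable setT (EFin \o (\1_(~` K) : borel X -> R)).
  exact: integrable_indic.
have ic : mu.-integrable setT (EFin \o (fun _ : borel X => c)).
  exact: finite_measure_integrable_cst.
apply: (@le_trans _ _ (\int[mu]_x (c + \1_(~` K) x))).
  apply: le_Rintegral => //; first exact: (integrable_add ic iK).
  move=> x _; rewrite indicE; have [Kx|Kx] := pselect (K x).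
    by rewrite memNset ?addr0 ?uK//; apply.
  by rewrite mem_set//=; have /andP[_ ux] := u01 x; rewrite (le_trans ux)// lerDr.
rewrite RintegralD// Rintegral_cst//= mu1/= mulr1 lerD2l /Rintegral integral_indic// setIT.
by rewrite -lee_fin fineK//; exact: fin_num_measure.
Qed.

(** Without such an h, no difference y - x represents g, so the functionals of [ext_linear] separate
    K1 x {1} from K2 x {0}. Some u is then close to 1 on the first set and close to 0 on the second,
    although its integrals for gamma and for the tilted measure agree, their Fourier transforms
    being equal. *)
Lemma cameron_martin_vector g : topdual g -> cov gamma g g = 1 ->
  exists h : X, forall l, topdual l -> l h = cov gamma l g.
Proof.
move=> tg g1; apply: contrapT => nh.
have lin := @topdual_linear R X; have [L0 LD LZ] := lin.
pose a l := cov gamma l g.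
have elin : linear_family (ext_linear a).
  split.
  - exists (fun=> 0) => //; apply/funext => z.
    by rewrite /a /cov; under eq_Rintegral do rewrite mul0r; rewrite Rintegral_prob_cst mulr0 addr0.
  - move=> _ _ [l tl ->] [m tm ->]; exists (fun x => l x + m x); first exact: LD.
    by apply/funext => z; rewrite /a covDl//; ring.
  - move=> c _ [l tl ->]; exists (fun x => c * l x); first exact: LZ.
    by apply/funext => z; rewrite /a covZl//; ring.
pose nu := tilted tg; have nu1 := tilted_total tg g1.
(* The tolerance 1/8 is used for the mass outside each compact set and for u on it; the integrals
   end up within 1/4 of 1 and of 0. *)
have [K1 [cK1 _ gK1]] := hgamma.1 setT measurableT _ (ltac:(rewrite invr_gt0; exact: ltr0n) : 0 < 8^-1 :> R).
have [K2 [cK2 _ gK2]] := @tilted_inner_compact _ tg setT measurableT _ (ltac:(rewrite invr_gt0; exact: ltr0n) : 0 < 8^-1 :> R).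
rewrite setTD in gK1; rewrite setTD in gK2.
have cA : compact (K2 `*` [set 0 : R]) by apply: compact_setX => //; exact: compact_set1.
have cB : compact (K1 `*` [set 1 : R]) by apply: compact_setX => //; exact: compact_set1.
have q0 : 0 < 8^-1 :> R by rewrite invr_gt0.
have : exists w, [/\ utrig (ext_linear a) w, (forall z, 0 <= w z <= 1),
    (forall z, (K1 `*` [set 1 : R]) z -> 1 - 8^-1 <= w z) &
    forall z, (K2 `*` [set 0 : R]) z -> w z <= 8^-1].
  apply: (compact_separation _ _ _ _ cB cA) => //.
  - by move=> c; exact: utrig_cst.
  - by move=> u v; exact: utrigD.
  - by move=> u v; exact: utrigM.
  - by move=> u; exact: utrig_exp.
  move=> [x i] [y j] [_ /= ->] [_ /= ->].
  have [l tl lxy] : exists2 l, topdual l & l (y - x) <> a l.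
    apply: contrapT => h; apply: nh; exists (y - x) => l tl.
    by apply: contrapT => h'; apply: h; exists l.
  have lxy' : l x + 1 * a l - (l y + 0 * a l) != 0.
    apply/eqP => h; apply: lxy; have := topdualD (y - x) x tl.
    by rewrite subrK; move: h; lra.
  set D := _ - _ in lxy'.
  have DE : D = l x + a l - l y by rewrite /D; ring.
  clearbody D.
  have tm : topdual (fun x => pi / D * l x) by exact: LZ.
  (* The extension of (pi/D) l, scaled so that m(x, 1) - m(y, 0) = pi. *)
  pose m z := pi / D * l z.1 + z.2 * a (fun x => pi / D * l x).
  have em : ext_linear a m by exists (fun x => pi / D * l x).
  exists (fun z => cos (m z + (- m (y, 0)))); split.
  - by apply: utrig_trig; apply: trig_cos.
  - move=> z; apply: continuous_comp; last exact: continuous_cos.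
    apply: cvgD; last exact: cvg_cst.
    apply: cvgD; last by apply: cvgM; [exact: cvg_snd|exact: cvg_cst].
    apply: cvgM; first exact: cvg_cst.
    by apply: cvg_comp; [exact: cvg_fst|exact: tl.2].
  - have -> : m (x, 1) - m (y, 0) = pi.
      transitivity (pi / D * (l x + a l - l y)); last by rewrite -DE divfK.
    by rewrite /m /= /a covZl// -/(a l); ring.
    by rewrite subrr cos0 cospi; apply/eqP; rewrite lt_eqF// (lt_trans (ltrN10 _)).
move=> [u [uu u01 uA uB]].
have me l : ext_linear a l -> forall t : R, measurable_fun setT (l \o (fun x : borel X => (x : X, t)) : borel X -> R).
  by move=> [m tm ->] t; exact: (measurable_funD (topdual_measurable tm) (measurable_cst (t * a m))).
have mu_ t : measurable_fun setT ((fun x => u (x, t)) : borel X -> R).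
  apply: (@utrig_measurable R _ (ext_linear a) _ (borel X) (fun x : borel X => (x : X, t)) u) => //.
  by move=> l /me.
have i1 (m : {finite_measure set (borel X) -> \bar R}) :
    m.-integrable setT (EFin \o (fun _ : borel X => 1 : R)).
  exact: finite_measure_integrable_cst.
have E : \int[gamma]_x (u (x, 1) * 1) = \int[gamma]_x (u (x, 0) * expR (g x - 2^-1)).
  apply: (@utrig_integral_eq R _ (ext_linear a) _ (borel X) _ (borel X) gamma gamma
    (fun x => (x : X, 1)) (fun x => (x : X, 0)) (fun=> 1) (fun x => expR (g x - 2^-1)) u) => //.
  - by move=> l /me.
  - by move=> l /me.
  - exact: i1.
  - exact: tilt_integrable.
  move=> _ b [l tl ->] /=.
  rewrite mul1r; under eq_Rintegral do rewrite mulr1 -addrA.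
  under [RHS]eq_Rintegral do rewrite mul0r addr0.
  by rewrite (Rintegral_cos hgamma)// (Rintegral_cos_tilt hgamma).
have {}E : \int[gamma]_x u (x, 1) = \int[gamma]_x (u (x, 0) * expR (g x - 2^-1)).
  by rewrite -E; apply: eq_Rintegral => x _; rewrite mulr1.
rewrite -(Rintegral_tilted tg (mu_ 0)) in E.
have h2 : \int[tilted tg]_x u (x, 0) <= 8^-1 + 8^-1.
  apply: (@Rintegral_le_off_compact (tilted tg) (fun x => u (x, 0)) K2); [exact: mu_|exact: nu1|exact: cK2|exact: ltW|exact: ltW|by move=> x; exact: u01|].
  by move=> x Kx; exact: (uB (x, 0)).
have h1 : \int[gamma]_x (1 - u (x, 1)) <= 8^-1 + 8^-1.
  apply: (@Rintegral_le_off_compact gamma (fun x => 1 - u (x, 1)) K1).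
  - exact: measurable_funB.
  - exact: probability_setT.
  - exact: cK1.
  - exact: ltW.
  - exact: ltW.
  - by move=> x; have /andP[? ?] := u01 (x, 1); rewrite subr_ge0 gerBl; apply/andP.
  - by move=> x Kx; have := uA (x, 1) (conj Kx erefl); rewrite lerBlDr addrC -lerBlDr.
have iu : gamma.-integrable setT (EFin \o ((fun x => u (x, 1)) : borel X -> R)).
  apply: (@prob_bounded_integrable _ _ _ _ _ 1) => // x.
  by have /andP[? ?] := u01 (x, 1); rewrite ger0_norm.
rewrite (RintegralB measurableT (i1 gamma) iu) Rintegral_prob_cst E in h1.
exact: not_both_le_quarter h1 h2.
Qed.

Lemma topdualN (l : X -> R) x : topdual l -> l (- x) = - l x.
Proof. by move=> tl; rewrite -scaleN1r topdualZ// mulN1r. Qed.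

Let shift h (x : borel X) : borel X := (x : X) + h.

Let continuous_shift (h : X) : continuous (fun x : X => x + h).
Proof.
move=> x; apply: (@continuous2_cvg X X X _ _ _ idfun (cst h) _ x h) => //.
- exact: (@add_continuous X (x, h)).
- exact: cvg_cst.
Qed.

Let measurable_shift h : measurable_fun setT (shift h).
Proof.
apply: (@measurability _ _ (borel X) (borel X) setT (shift h) (@open X)) => //.
move=> _ [A oA <-]; rewrite setTI; apply: sub_sigma_algebra.
by move: A oA; apply/continuousP; exact: continuous_shift.
Qed.

Lemma shift_inner_compact h : inner_compact (image_measure gamma (measurable_shift h)).
Proof.
move=> B mB e e0.
have mB' : measurable (shift h @^-1` B) by rewrite -[X in measurable X]setTI; exact: measurable_shift.
have [K [cK KB gK]] := hgamma.1 _ mB' _ e0.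
exists ((fun x => x + h) @` K); split.
- by apply: continuous_compact => //; apply: continuous_subspaceT; exact: continuous_shift.
- by move=> _ [x Kx <-]; exact: KB.
rewrite /image_measure; congr (gamma _ < _)%E : gK.
apply/seteqP; split => x /= [Bx nK]; split => //.
  by move=> [y Ky /addIr yx]; apply: nK; rewrite -yx.
by move=> Kx; apply: nK; exists x.
Qed.

Lemma shift_tilted g h (tg : topdual g) : cov gamma g g = 1 ->
  (forall l, topdual l -> l h = cov gamma l g) ->
  forall A : set (borel X), measurable A -> shift_measure gamma h A = tilted tg A.
Proof.
move=> g1 hl A mA.
rewrite -[LHS]/(image_measure gamma (measurable_shift h) A).
apply: radon_unique => //; [exact: shift_inner_compact|exact: tilted_inner_compact|].
move=> l b tl; have ml := topdual_measurable tl.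
rewrite Rintegral_tilted; last exact: measurable_cos_comp.
rewrite (Rintegral_cos_tilt hgamma)//.
rewrite -(@Rintegral_law _ _ _ _ _ gamma _ _ (measurable_shift h) _ (fun x => cos (l x + b)))//.
- under eq_Rintegral do rewrite /shift topdualD// hl// -addrA.
  by rewrite (Rintegral_cos hgamma).
- exact: measurable_cos_comp.
Qed.

Lemma shift_dominated g h : topdual g -> cov gamma g g = 1 ->
  (forall l, topdual l -> l h = cov gamma l g) ->
  shift_measure gamma h `<< gamma.
Proof.
move=> tg g1 hl; apply/null_content_dominatesP => A mA gA.
rewrite (shift_tilted tg)//; apply: null_set_integral => //.
exact: measurable_funS (measurable_int _ (tilt_integrable tg)).
Qed.

(** For the second domination, -h represents -g, so gamma(. + h) is dominated by gamma. A set A that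
    is null for the translate has a gamma-null preimage under x -> x + h, and shifting this preimage
    back gives gamma(A) = 0. *)
Lemma cameron_martinP g h : topdual g -> cov gamma g g = 1 ->
  (forall l, topdual l -> l h = cov gamma l g) -> cameron_martin gamma h.
Proof.
move=> tg g1 hl; split; first exact: (shift_dominated tg).
have [_ _ LZ] := @topdual_linear R X.
have tg' := LZ (-1) _ tg.
have d : shift_measure gamma (- h) `<< gamma.
  apply: (shift_dominated tg'); first by rewrite covZl// covZr// g1; ring.
  by move=> l tl; rewrite topdualN// covZr// hl// mulN1r.
apply/(null_content_dominatesP _ (image_measure gamma (measurable_shift h))) => A mA gA.
have mB : measurable (shift h @^-1` A) by rewrite -[X in measurable X]setTI; exact: measurable_shift.
have /null_content_dominatesP/(_ _ mB) := d; rewrite /shift_measure /pushforward => <-//.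
congr (gamma _); apply/seteqP; split => x /=; rewrite /shift ?subrK//.
Qed.

Lemma cov_cauchy_schwarz l m : topdual l -> topdual m ->
  cov gamma l m ^+ 2 <= cov gamma l l * cov gamma m m.
Proof.
move=> tl tm; have lin := @topdual_linear R X; have [_ LD LZ] := lin.
have q t : 0 <= cov gamma l l + 2 * t * cov gamma l m + t ^+ 2 * cov gamma m m.
  by rewrite -covDD//; exact: cov_ge0.
have m0 := cov_ge0 gamma m; have l0 := cov_ge0 gamma l.
have [mE|mE] := eqVneq (cov gamma m m) 0.
  have [->|c0] := eqVneq (cov gamma l m) 0; first by rewrite expr0n/= mulr_ge0.
  (* When m has variance 0 the quadratic is affine in t; this t would give it the value -1. *)
  have := q (- (cov gamma l l + 1) / (2 * cov gamma l m)).
  rewrite mE mulr0 addr0.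
  have -> : 2 * (- (cov gamma l l + 1) / (2 * cov gamma l m)) * cov gamma l m =
    - (cov gamma l l + 1) by field.
  by lra.
have := q (- cov gamma l m / cov gamma m m).
have -> : cov gamma l l + 2 * (- cov gamma l m / cov gamma m m) * cov gamma l m +
  (- cov gamma l m / cov gamma m m) ^+ 2 * cov gamma m m =
  (cov gamma l l * cov gamma m m - cov gamma l m ^+ 2) / cov gamma m m by field.
by rewrite pmulr_lge0 ?invr_gt0 ?lt_def ?mE// subr_ge0.
Qed.

(** Cauchy-Schwarz bounds the supremum; the normalised g attains it, or l = 0 if g is degenerate. *)
Lemma cm_normE g h : topdual g -> (forall l, topdual l -> l h = cov gamma l g) ->
  cm_norm gamma h = (Num.sqrt (cov gamma g g))%:E.
Proof.
move=> tg hl; have [L0 _ LZ] := @topdual_linear R X.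
have iE l : topdual l -> (\int[gamma]_x ((l x) ^+ 2)%:E)%E = (cov gamma l l)%:E.
  move=> tl; rewrite /cov /Rintegral fineK; first exact: eq_integral.
  by apply: integrable_fin_num => //; exact: topdual_mul_integrable.
have c0 := cov_ge0 gamma g.
apply/eqP; rewrite eq_le; apply/andP; split.
  apply: ge_ereal_sup => _ [l [tl l1] <-]; rewrite iE// lee_fin in l1.
  rewrite lee_fin hl// (le_trans (ler_norm _))// -sqrtr_sqr ler_wsqrtr//.
  by rewrite (le_trans (cov_cauchy_schwarz tl tg))// ler_piMl.
apply: ereal_sup_ubound.
have [c|c] := eqVneq (cov gamma g g) 0.
  exists (fun=> 0); first by split => //; rewrite iE// lee_fin /cov Rintegral_cst// mul0r mul0r.
  by rewrite c sqrtr0.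
have s0 : Num.sqrt (cov gamma g g) != 0 by rewrite sqrtr_eq0 -ltNge lt_def c.
have ss := sqr_sqrtr c0.
have tm := LZ (Num.sqrt (cov gamma g g))^-1 _ tg.
exists (fun x => (Num.sqrt (cov gamma g g))^-1 * g x).
  split => //; rewrite iE// covZl// covZr// -{3}ss lee_fin; set s := Num.sqrt _ in s0 *.
  by rewrite le_eqVlt; apply/orP; left; apply/eqP; field.
rewrite (hl g tg) -{2}ss; congr EFin; set s := Num.sqrt _ in s0 *.
by field.
Qed.

Lemma cm_innerE g g' h h' : topdual g -> topdual g' ->
  (forall l, topdual l -> l h = cov gamma l g) ->
  (forall l, topdual l -> l h' = cov gamma l g') ->
  cm_inner gamma h h' = cov gamma g g'.
Proof.
move=> tg tg' hl hl'; have [_ LD LZ] := @topdual_linear R X.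
have tN := LZ (-1) _ tg'.
rewrite /cm_inner (@cm_normE (fun x => g x + 1 * g' x))/=; last 2 first.
- by apply: LD => //; exact: LZ.
- move=> l tl; rewrite topdualD// hl// hl'// covDr// ?covZr// ?mul1r//; exact: LZ.
rewrite (@cm_normE (fun x => g x + (-1) * g' x))/=; last 2 first.
- exact: LD.
- by move=> l tl; rewrite topdualD// topdualN// hl// hl'// covDr// covZr// mulN1r.
by rewrite !sqr_sqrtr ?cov_ge0// !covDD//; field.
Qed.

Lemma covBr l m m' : topdual l -> topdual m -> topdual m' ->
  cov gamma l (fun x => m x - m' x) = cov gamma l m - cov gamma l m'.
Proof.
move=> tl tm tm'; have [_ _ LZ] := @topdual_linear R X.
rewrite -[cov gamma l m']mul1r -mulNr -covZr// -covDr//; last exact: LZ.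
by apply: eq_Rintegral => x _; rewrite mulN1r.
Qed.

Lemma cov_sumr l n (c : 'I_n -> R) (g : 'I_n -> X -> R) : topdual l ->
  (forall i, topdual (g i)) ->
  cov gamma l (fun x => \sum_i c i * g i x) = \sum_i c i * cov gamma l (g i).
Proof.
move=> tl tg; rewrite {1}/cov.
under eq_Rintegral do rewrite mulr_sumr.
rewrite Rintegral_sum; last first.
  move=> i; apply: topdual_mul_integrable => //; have [_ _ LZ] := @topdual_linear R X.
  exact: LZ.
by apply: eq_bigr => i _; rewrite -[LHS]/(cov gamma l (fun x => c i * g i x)) covZr.
Qed.

(** Functionals are kept as functions rather than classes, so being in the span means that the
    residual has variance 0. A new g is added only when the current residual is not degenerate; the
    values of g from index n on are arbitrary functionals. *)
Lemma gram_schmidt (m : nat) (l : nat -> X -> R) : (forall i, topdual (l i)) ->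
  exists n (g : nat -> X -> R), [/\ forall j, topdual (g j),
    forall j k, (j < n)%N -> (k < n)%N -> cov gamma (g j) (g k) = (j == k)%:R &
    forall i, (i < m)%N -> let r := fun x => l i x - \sum_(j < n) cov gamma (l i) (g j) * g j x in
      cov gamma r r = 0].
Proof.
move=> tl; have lin := @topdual_linear R X; have [L0 LD LZ] := lin.
have LB (k k' : X -> R) : topdual k -> topdual k' -> topdual (fun x => k x - k' x).
  move=> tk tk'; have := LD _ _ tk (LZ (-1) _ tk').
  by congr topdual; apply/funext => x; rewrite mulN1r.
elim: m => [|m [n [g [tg og gr]]]].
  by exists 0%N, (fun _ _ => 0); split.
pose r := fun x => l m x - \sum_(j < n) cov gamma (l m) (g j) * g j x.
have tS k : topdual (fun x => \sum_(j < n) cov gamma k (g j) * g j x).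
  exact: (topdual_sum (fun j : 'I_n => cov gamma k (g j)) (fun j : 'I_n => tg j)).
have tr : topdual r by exact: LB.
have [r0|r0] := eqVneq (cov gamma r r) 0.
  exists n, g; split; [exact: tg|exact: og|move=> i].
  by rewrite ltnS leq_eqVlt => /orP[/eqP ->|im]; [exact: r0|exact: gr].
have s0 : Num.sqrt (cov gamma r r) != 0 by rewrite sqrtr_eq0 -ltNge lt_def r0 cov_ge0.
have ss := sqr_sqrtr (cov_ge0 gamma r).
set s := Num.sqrt _ in s0 ss.
pose e x := s^-1 * r x.
have te : topdual e by exact: LZ.
have ge k : (k < n)%N -> cov gamma (g k) e = 0.
  move=> kn; rewrite covZr// covBr// (cov_sumr (fun j : 'I_n => cov gamma (l m) (g j)) (tg k) (fun j : 'I_n => tg j)).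
  rewrite (bigD1 (Ordinal kn))//= og// eqxx mulr1 big1 ?addr0.
    by rewrite covC subrr mulr0.
  move=> j jk; rewrite og//.
  have /negbTE -> : (k != j)%N by apply: contra jk => /eqP kj; apply/eqP/val_inj.
  by rewrite mulr0.
have ee : cov gamma e e = 1 by rewrite covZl// covZr// -ss; field.
pose g' k := if (k < n)%N then g k else e.
have tg' k : topdual (g' k) by rewrite /g'; case: ifP.
have g'n (i : 'I_n) : g' i = g i by rewrite /g' ltn_ord.
have g'nn : g' n = e by rewrite /g' ltnn.
exists n.+1, g'; split; first exact: tg'.
  move=> j k; rewrite !ltnS (leq_eqVlt j) (leq_eqVlt k) /g' => /orP[/eqP->|jn] /orP[/eqP->|kn].
  - by rewrite ltnn ee eqxx.
  - by rewrite ltnn kn covC ge// eq_sym ltn_eqF.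
  - by rewrite ltnn jn ge// ltn_eqF.
  - by rewrite jn kn og.
move=> i; rewrite ltnS => im /=.
have split_sum x : l i x - \sum_(j < n.+1) cov gamma (l i) (g' j) * g' j x =
    (l i x - \sum_(j < n) cov gamma (l i) (g j) * g j x) - cov gamma (l i) e * e x.
  rewrite big_ord_recr/= g'nn opprD addrA; congr (_ - _ - _).
  by apply: eq_bigr => j _; rewrite g'n.
pose ri x := l i x - \sum_(j < n) cov gamma (l i) (g j) * g j x.
have -> : (fun x => l i x - \sum_(j < n.+1) cov gamma (l i) (g' j) * g' j x) =
  (fun x => ri x + (- cov gamma (l i) e) * e x).
  by apply/funext => x; rewrite split_sum mulNr.
have tri : topdual ri by exact: LB.
have rie : cov gamma (l i) e = cov gamma ri e.
  rewrite (covC _ ri) covBr// (cov_sumr (fun j : 'I_n => cov gamma (l i) (g j)) te (fun j : 'I_n => tg j)).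
  by rewrite big1 ?subr0 ?(covC _ e)// => j _; rewrite (covC _ e) ge// mulr0.
rewrite covDD// ee rie.
move: im; rewrite leq_eqVlt => /orP[/eqP im|im].
  have riE : ri = r by rewrite /ri /r im.
  have -> : cov gamma ri e = s.
    by rewrite riE /e covZr// -ss; field.
  by rewrite riE -ss; ring.
have ri0 : cov gamma ri ri = 0 by exact: gr.
(* An earlier residual has variance 0, hence is uncorrelated with e, and the extra term vanishes. *)
have := cov_cauchy_schwarz tri te; rewrite ri0 mul0r => h.
have -> : cov gamma ri e = 0.
  by apply/eqP; rewrite -sqrf_eq0 eq_le h sqr_ge0.
ring.
Qed.

End cameron_martin_vectors.

(** * Duality with trigonometric polynomials *)

Section density.
Context (R : realType) (X : tvsType R).
Hypothesis hX : hausdorff_space X.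
Context (mu : {finite_measure set (borel X) -> \bar R}).
Hypothesis imu : inner_compact mu.

(** T is rescaled to [0, 1], cut into N layers, and each layer's indicator is approximated by a
    function with values in [0, 1]. The approximant thus obeys the bound B at every point, as the
    dual exponent +oo requires. *)
Lemma utrig_dense (T : X -> R) (B e : R) : measurable_fun setT (T : borel X -> R) ->
  0 < B -> (forall x, `|T x| <= B) -> 0 < e ->
  exists u, [/\ utrig (@topdual R X) u, (forall x, `|u x| <= B) &
    \int[mu]_x `|T x - u x| <= e].
Proof.
move=> mT B0 TB e0.
set M := fine (mu setT); have M0 : 0 <= M by exact: fine_ge0.
(* Layering costs 2 B d M, and the N approximations of mean error d cost 2 B d. *)
have d0 : 0 < e / (2 * B * (M + 1)).
  by rewrite divr_gt0// mulr_gt0 ?ltr_wpDl// mulr_gt0.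
set d := e / _ in d0.
have [N N0 Nd] : exists2 N : nat, (0 < N)%N & N%:R^-1 <= d.
  exists (Num.truncn d^-1).+1 => //.
  rewrite -[leRHS]invrK lef_pV2 ?posrE ?invr_gt0 ?ltr0n//.
  by apply: ltW; apply: truncnS_gt.
pose y x := (T x + B) / (2 * B).
have y01 x : 0 <= y x <= 1.
  have := TB x; rewrite ler_norml => /andP[h1 h2].
  rewrite /y divr_ge0 ?mulr_ge0 ?(ltW B0)//=; last lra.
  by rewrite ler_pdivrMr ?mulr_gt0// mul1r; lra.
pose A (k : nat) : set (borel X) := [set x | k.+1%:R <= N%:R * y x].
have my : measurable_fun setT (y : borel X -> R).
  by apply: measurable_funM => //; exact: measurable_funD.
have mA k : measurable (A k).
  have h : measurable_fun setT (fun x : borel X => k.+1%:R <= N%:R * y x).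
    by apply: measurable_fun_ler => //; exact: measurable_funM.
  by have := h measurableT [set true] I; rewrite setTI.
have hu k := utrig_dense_indic hX imu (mA k) d0.
pose u k := projT1 (cid (hu k)).
have uu k : utrig (@topdual R X) (u k) by rewrite /u; case: cid => ? [].
have u01 k x : 0 <= u k x <= 1 by rewrite /u; case: cid => ? [].
have ud k : \int[mu]_x `|\1_(A k) x - u k x| <= d by rewrite /u; case: cid => ? [].
pose U x := - B + 2 * B / N%:R * \sum_(k < N) u k x.
have N0' : 0 < N%:R :> R by rewrite ltr0n.
exists U; split.
- apply: utrigD; first by apply: utrig_cst; exact: topdual_linear.
  apply: utrigM; first exact: topdual_linear.
    by apply: utrig_cst; exact: topdual_linear.
  exact: (utrig_sum (@topdual_linear R X) _ (fun k : 'I_N => uu k)).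
- move=> x; have S0 : 0 <= \sum_(k < N) u k x.
    by apply: sumr_ge0 => k _; have /andP[] := u01 k x.
  have S1 : \sum_(k < N) u k x <= N%:R.
    rewrite -[N in N%:R]card_ord -sum1_card natr_sum; apply: ler_sum => k _.
    by have /andP[] := u01 k x.
  have q0 : 0 <= 2 * B / N%:R * \sum_(k < N) u k x.
    by rewrite mulr_ge0// divr_ge0// mulr_ge0// ltW.
  have q1 : 2 * B / N%:R * \sum_(k < N) u k x <= 2 * B.
    by rewrite mulrAC ler_pdivrMr// ler_wpM2l// mulr_ge0// ltW.
  by rewrite ler_norml /U; apply/andP; split; lra.
have bnd x : `|T x - U x| <= 2 * B * d + 2 * B / N%:R * \sum_(k < N) `|\1_(A k) x - u k x|.
  have [j [_ hj]] := layer_approx N0 (y01 x).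
  have hA k : ((k.+1%:R <= N%:R * y x)%R)%:R = \1_(A k) x :> R.
    rewrite indicE; congr (nat_of_bool _)%:R.
    by apply/idP/idP => h; [apply: mem_set|move/set_mem : h].
  rewrite (eq_bigr (fun k : 'I_N => \1_(A k) x)) in hj; last by move=> k _; rewrite hA.
  set S := \sum_(k < N) \1_(A k) x in hj.
  have TE : T x = - B + 2 * B * y x.
    by rewrite /y; field; rewrite gt_eqF.
  have -> : T x - U x = 2 * B * (y x - N%:R^-1 * S) + 2 * B / N%:R * (S - \sum_(k < N) u k x).
    by rewrite TE /U; ring.
  have B2 : 0 <= 2 * B by rewrite mulr_ge0// ltW.
  apply: le_trans (ler_normD _ _) _; apply: lerD.
    rewrite normrM (ger0_norm B2); apply: ler_wpM2l => //.
    exact: le_trans hj Nd.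
  rewrite normrM (ger0_norm (_ : 0 <= 2 * B / N%:R)) ?divr_ge0//.
  apply: ler_wpM2l; first exact: divr_ge0.
  by rewrite /S -sumrB ler_norm_sum.
have mu_ k : measurable_fun setT (u k : borel X -> R) by exact: utrig_borel.
have mau k : measurable_fun setT (fun x : borel X => `|\1_(A k) x - u k x|).
  by apply: measurableT_comp => //; apply: measurable_funB.
have iau k : mu.-integrable setT (EFin \o (fun x : borel X => `|\1_(A k) x - u k x|)).
  apply: (@finite_bounded_integrable _ _ mu _ 1) => // x.
  rewrite normr_id ler_norml indicE; have /andP[? ?] := u01 k x.
  by case: (x \in A k) => /=; apply/andP; split; lra.
have mU : measurable_fun setT (U : borel X -> R).
  apply: measurable_funD => //; apply: measurable_funM => //.
  by apply: measurable_sum => k; exact: mu_.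
have is_ : mu.-integrable setT (EFin \o (fun x : borel X => 2 * B / N%:R * \sum_(k < N) `|\1_(A k) x - u k x|)).
  apply: integrable_scale.
  exact: (integrable_sumr _ (fun k : 'I_N => iau k)).
have ic : mu.-integrable setT (EFin \o (fun _ : borel X => 2 * B * d)).
  exact: finite_measure_integrable_cst.
apply: (@le_trans _ _ (\int[mu]_x (2 * B * d + 2 * B / N%:R * \sum_(k < N) `|\1_(A k) x - u k x|))).
  apply: le_Rintegral => //.
    apply: le_integrable_norm (integrable_add ic is_).
      by apply: measurableT_comp => //; exact: measurable_funB.
    by move=> x; rewrite normr_id; exact: bnd.
  exact: (integrable_add ic is_).
rewrite (RintegralD measurableT ic is_) Rintegral_cst//.
rewrite RintegralZl//; last exact: (integrable_sumr _ (fun k : 'I_N => iau k)).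
rewrite (Rintegral_sum _ (fun k : 'I_N => iau k)).
have S1 : \sum_(k < N) \int[mu]_x `|\1_(A k) x - u k x| <= N%:R * d.
  rewrite -[N in N%:R]card_ord -sum1_card natr_sum mulr_suml; apply: ler_sum => k _.
  by rewrite mul1r.
apply: (@le_trans _ _ (2 * B * d * M + 2 * B / N%:R * (N%:R * d))).
  by rewrite lerD2l; apply: ler_wpM2l => //; rewrite divr_ge0// mulr_ge0// ltW.
have -> : 2 * B * d * M + 2 * B / N%:R * (N%:R * d) = 2 * B * (M + 1) * d.
  by field; rewrite gt_eqF.
rewrite /d mulrC divfK// mulf_neq0//; last by rewrite gt_eqF// ltr_wpDl.
by rewrite mulf_neq0// gt_eqF.
Qed.

Lemma trig_dense (T : X -> R) (B e : R) : measurable_fun setT (T : borel X -> R) ->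
  0 < B -> (forall x, `|T x| <= B) -> 0 < e ->
  exists phi, [/\ trig (@topdual R X) phi, (forall x, `|phi x| <= B + e) &
    \int[mu]_x `|T x - phi x| <= e].
Proof.
move=> mT B0 TB e0.
set M := fine (mu setT); have M0 : 0 <= M by exact: fine_ge0.
have e2 : 0 < e / 2 by rewrite divr_gt0.
have [u [uu uB uT]] := utrig_dense mT B0 TB e2.
have d0 : 0 < e / (2 * (M + 1)) by rewrite divr_gt0// mulr_gt0// ltr_wpDl.
set d := e / _ in d0.
have [phi tphi up] := uu _ d0.
have dE : d * (2 * (M + 1)) = e.
  by rewrite /d divfK// mulf_neq0// gt_eqF// ltr_wpDl.
have dM : d * M <= e / 2.
  have -> : e / 2 = d * M + d by rewrite -dE; field.
  by rewrite lerDl ltW.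
have de : d <= e.
  rewrite -dE -[leLHS]mulr1 ler_pM2l// (le_trans (_ : 1 <= M + 1))// ?lerDr//.
  by rewrite ler_peMl// ?ler1n// addr_ge0.
have mu_ : measurable_fun setT (u : borel X -> R) by exact: utrig_borel.
have mphi : measurable_fun setT (phi : borel X -> R) by apply: utrig_borel; exact: utrig_trig.
have phib x : `|phi x| <= B + e.
  have -> : phi x = u x - (u x - phi x) by ring.
  by rewrite (le_trans (ler_normB _ _))// lerD// (le_trans (up x)).
exists phi; split => //.
have i1 : mu.-integrable setT (EFin \o (fun x : borel X => `|T x - u x|)).
  apply: (@finite_bounded_integrable _ _ mu _ (B + B)).
    by apply: measurableT_comp => //; exact: measurable_funB.
  by move=> x; rewrite normr_id (le_trans (ler_normB _ _))// lerD.
have ic : mu.-integrable setT (EFin \o (fun _ : borel X => d)).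
  exact: finite_measure_integrable_cst.
apply: (@le_trans _ _ (\int[mu]_x (`|T x - u x| + d))).
  have h x : `|T x - phi x| <= `|T x - u x| + d.
    have -> : T x - phi x = (T x - u x) + (u x - phi x) by ring.
    by rewrite (le_trans (ler_normD _ _))// lerD.
  apply: le_Rintegral => //.
    apply: le_integrable_norm (integrable_add i1 ic).
      by apply: measurableT_comp => //; exact: measurable_funB.
    by move=> x; rewrite normr_id.
  exact: (integrable_add i1 ic).
rewrite (RintegralD measurableT i1 ic) Rintegral_cst// [leRHS]splitr.
exact: lerD.
Qed.

End density.

(** Young's inequality for b and a^(q-1), with exponents q and q/(q-1), is the tangent inequality
    a^q - b^q <= q a^(q-1) (a - b). *)
Lemma powR_lipschitz (R : realType) (q B a b : R) : 1 < q -> 0 <= a <= B -> 0 <= b <= B ->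
  a `^ q - b `^ q <= q * B `^ (q - 1) * `|a - b|.
Proof.
move=> q1 /andP[a0 aB] /andP[b0 bB].
have q0 : 0 < q by lra.
have q10 : 0 < q - 1 by lra.
have B0 : 0 <= B by exact: le_trans aB.
have [ab|ab] := leP a b.
  apply: (@le_trans _ _ 0); last by rewrite !mulr_ge0 ?powR_ge0 ?(ltW q0).
  by rewrite subr_le0; apply: ge0_ler_powR; rewrite ?nnegrE ?(ltW q0).
have a0' : 0 < a by exact: le_lt_trans ab.
rewrite ger0_norm ?subr_ge0 ?(ltW ab)//.
apply: (@le_trans _ _ (q * a `^ (q - 1) * (a - b))); last first.
  apply: ler_wpM2r; first by rewrite subr_ge0 ltW.
  apply: ler_wpM2l; first exact: ltW.
  by apply: ge0_ler_powR; rewrite ?nnegrE ?(ltW q10).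
have p0 : 0 < q / (q - 1) by rewrite divr_gt0.
have := conjugate_powR b0 (powR_ge0 a (q - 1)) q0 p0.
have -> : q^-1 + (q / (q - 1))^-1 = 1.
  by field; rewrite !gt_eqF.
move=> /(_ erefl); rewrite -powRrM.
have -> : (q - 1) * (q / (q - 1)) = q by field; rewrite gt_eqF.
have aq : a `^ q = a * a `^ (q - 1) by rewrite mulr_powRB1.
rewrite -(ler_pM2l q0).
have -> : q * (b `^ q / q + a `^ q / (q / (q - 1))) = b `^ q + a `^ q * (q - 1).
  by field; rewrite !gt_eqF.
rewrite aq; lra.
Qed.

Lemma le_of_le_scale (R : realFieldType) (a M : R) : 0 <= M ->
  (forall t, 1 < t -> a <= M * t) -> a <= M.
Proof.
move=> M0 h; have [M1|M1] := eqVneq M 0.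
  by have := h 2 (ltr1n _ 2); rewrite M1 mul0r.
have M2 : 0 < M by rewrite lt_def M1.
apply/ler_addgt0Pr => e e0.
have -> : M + e = M * (1 + e / M) by rewrite mulrDr mulr1 mulrC divfK.
by apply: h; rewrite ltrDl divr_gt0.
Qed.

Section duality.
Context (R : realType) (X : tvsType R).
Hypothesis hX : hausdorff_space X.
Context (gamma : probability (borel X) R).
Hypothesis igamma : inner_compact gamma.

(* |phi|_q <= N for the conjugate exponent q = p / (p - 1), the bound being
   required everywhere, not almost everywhere, when p = 1. *)
Definition norm_dual_le (p : R) (phi : X -> R) (N : R) :=
  if p == 1 then forall x, `|phi x| <= N
  else \int[gamma]_x (`|phi x| `^ (p / (p - 1))) <= N `^ (p / (p - 1)).

(** T is approximated in L^1 of the measure (1 + |F|) gamma, which controls at once the pairing with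
    F and the dual norm. The strict inequality on T leaves the room needed for the approximant to
    satisfy the bound N itself. *)
Let bounded_duality p M F T B : 1 <= p -> 0 <= M ->
  measurable_fun setT (F : borel X -> R) ->
  gamma.-integrable setT (EFin \o (F : borel X -> R)) ->
  (forall phi N, trig (@topdual R X) phi -> 0 < N -> norm_dual_le p phi N ->
    \int[gamma]_x (F x * phi x) <= M * N) ->
  measurable_fun setT (T : borel X -> R) -> 0 < B -> (forall x, `|T x| <= B) ->
  forall N, 0 < N ->
  (if p == 1 then B < N else
     \int[gamma]_x (`|T x| `^ (p / (p - 1))) < N `^ (p / (p - 1))) ->
  \int[gamma]_x (F x * T x) <= M * N.
Proof.
move=> p1 M0 mF iF hF mT B0 TB N N0 hN.
have w0 (x : borel X) : 0 <= 1 + `|F x| by exact: addr_ge0.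
have i1 : gamma.-integrable setT (EFin \o (fun _ : borel X => 1 : R)).
  exact: finite_measure_integrable_cst.
have iabsF : gamma.-integrable setT (EFin \o (fun x : borel X => `|F x|)).
  exact: (integrable_norm iF).
have iw : gamma.-integrable setT (EFin \o (fun x : borel X => 1 + `|F x|)).
  exact: (integrable_add i1 iabsF).
pose mu := weighted w0 iw.
have imu : inner_compact mu by exact: inner_compact_weighted.
have mw : measurable_fun setT (fun x : borel X => 1 + `|F x|).
  by apply: measurable_funD => //; exact: measurableT_comp.
have muE (f : X -> R) : measurable_fun setT (f : borel X -> R) ->
    \int[mu]_x f x = \int[gamma]_x (f x * (1 + `|F x|)).
  move=> mf; exact: (@Rintegral_density _ _ _ gamma mu (fun x : borel X => 1 + `|F x|)).
apply/ler_addgt0Pr => e0 e00.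
(* L is the L^1 error that the strict inequality tolerates: the gap N - B if p = 1, otherwise the
   gap between the q-th powers divided by the Lipschitz constant of t^q on [0, B + 1]. *)
have [L [L0 hL]] : exists L : R, 0 < L /\ forall phi (e : R), trig (@topdual R X) phi -> 0 < e -> e <= 1 ->
    e <= L -> (forall x, `|phi x| <= B + e) -> \int[gamma]_x `|T x - phi x| <= e ->
    norm_dual_le p phi N.
  move: hN; rewrite /norm_dual_le; case: ifPn => [_ BN|pn1 hN].
    exists (N - B); split; first by rewrite subr_gt0.
    move=> phi e _ _ _ eL hp _ x; apply: le_trans (hp x) _; lra.
  have p1' : 1 < p by rewrite lt_def pn1.
  set q := p / (p - 1) in hN *.
  have q1 : 1 < q by rewrite /q ltr_pdivlMr; lra.
  have q0 : 0 < q by lra.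
  set I := \int[gamma]_x _ in hN.
  have C0 : 0 < q * (B + 1) `^ (q - 1) by rewrite mulr_gt0// powR_gt0// addr_gt0.
  set C := q * _ in C0.
  exists ((N `^ q - I) / C); split; first by rewrite divr_gt0// subr_gt0.
  move=> phi e tphi e_0 e1 eL hp he.
  have mphi : measurable_fun setT (phi : borel X -> R) by apply: utrig_borel; exact: utrig_trig.
  have mq (f : X -> R) : measurable_fun setT (f : borel X -> R) ->
      measurable_fun setT ((fun x => `|f x| `^ q) : borel X -> R).
    by move=> mf; exact: (measurableT_comp (measurable_norm_powR q) mf).
  have iq (f : X -> R) : measurable_fun setT (f : borel X -> R) -> (forall x, `|f x| <= B + 1) ->
      gamma.-integrable setT (EFin \o ((fun x => `|f x| `^ q) : borel X -> R)).
    move=> mf fB; apply: (@prob_bounded_integrable _ _ _ _ _ ((B + 1) `^ q)); first exact: mq.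
    move=> x; rewrite ger0_norm ?powR_ge0//; apply: ge0_ler_powR; rewrite ?nnegrE ?(ltW q0)//.
    by rewrite addr_ge0// ltW.
  have TB1 x : `|T x| <= B + 1 by rewrite (le_trans (TB x))// lerDl.
  have pB1 x : `|phi x| <= B + 1 by rewrite (le_trans (hp x))// lerD2l.
  have id_ : gamma.-integrable setT (EFin \o ((fun x => C * `|T x - phi x|) : borel X -> R)).
    apply: integrable_scale.
    apply: (@prob_bounded_integrable _ _ _ _ _ (B + 1 + (B + 1))).
      by apply: measurableT_comp => //; exact: measurable_funB.
    by move=> x; rewrite normr_id (le_trans (ler_normB _ _))// lerD.
  apply: (@le_trans _ _ (\int[gamma]_x (`|T x| `^ q + C * `|T x - phi x|))).
    apply: le_Rintegral => //.
    - exact: iq.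
    - exact: (integrable_add (iq _ mT TB1) id_).
    move=> x _; rewrite -lerBlDl; apply: (@le_trans _ _ (C * `| `|phi x| - `|T x| |)).
      by apply: powR_lipschitz => //; rewrite normr_ge0/=.
    by apply: ler_wpM2l; [exact: ltW|rewrite distrC ler_dist_dist].
  rewrite (RintegralD measurableT (iq _ mT TB1) id_) -/I.
  rewrite RintegralZl//; last first.
    apply: (@prob_bounded_integrable _ _ _ _ _ (B + 1 + (B + 1))).
      by apply: measurableT_comp => //; exact: measurable_funB.
    by move=> x; rewrite normr_id (le_trans (ler_normB _ _))// lerD.
  rewrite -lerBrDl mulrC -ler_pdivlMr//; exact: le_trans he eL.
pose e := Num.min 1 (Num.min L e0).
have e_gt0 : 0 < e by rewrite !lt_min ltr01 L0.
have e_1 : e <= 1 by rewrite ge_min lexx.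
have e_L : e <= L by rewrite !ge_min lexx orbT.
have e_e0 : e <= e0 by rewrite !ge_min lexx !orbT.
have [phi [tphi phiB hphi]] := trig_dense hX imu mT B0 TB e_gt0.
have mphi : measurable_fun setT (phi : borel X -> R) by apply: utrig_borel; exact: utrig_trig.
have md : measurable_fun setT ((fun x => `|T x - phi x|) : borel X -> R).
  by apply: measurableT_comp => //; exact: measurable_funB.
have db x : `| `|T x - phi x| | <= B + (B + e).
  by rewrite normr_id (le_trans (ler_normB _ _))// lerD.
have iwd : gamma.-integrable setT (EFin \o ((fun x => `|T x - phi x| * (1 + `|F x|)) : borel X -> R)).
  exact: (integrableM_bounded iw md db).
rewrite muE// in hphi.
have iTd : gamma.-integrable setT (EFin \o ((fun x => `|T x - phi x|) : borel X -> R)).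
  exact: prob_bounded_integrable md db.
have hle1 : \int[gamma]_x `|T x - phi x| <= e.
  apply: le_trans hphi; apply: le_Rintegral => // x _.
  by rewrite ler_peMr// lerDl.
have hn := hL phi e tphi e_gt0 e_1 e_L phiB hle1.
have hm := hF phi N tphi N0 hn.
have iFphi : gamma.-integrable setT (EFin \o ((fun x => F x * phi x) : borel X -> R)).
  apply: (@eq_integrable _ _ _ gamma setT measurableT (fun x : borel X => (phi x * F x)%:E)).
    by move=> x _ /=; rewrite mulrC.
  exact: (integrableM_bounded iF mphi phiB).
apply: (@le_trans _ _ (\int[gamma]_x (F x * phi x + `|T x - phi x| * (1 + `|F x|)))).
  apply: le_Rintegral => //.
  - apply: (@eq_integrable _ _ _ gamma setT measurableT (fun x : borel X => (T x * F x)%:E)).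
      by move=> x _ /=; rewrite mulrC.
    exact: (integrableM_bounded iF mT TB).
  - exact: (integrable_add iFphi iwd).
  move=> x _; rewrite -lerBlDl -mulrBr (le_trans (ler_norm _))// normrM mulrC.
  by apply: ler_wpM2l => //; rewrite lerDr.
rewrite (RintegralD measurableT iFphi iwd); apply: lerD => //.
exact: le_trans hphi e_e0.
Qed.

(** The converse of Hoelder's inequality. Truncating |F| at level N + 1 makes the test function
    bounded and the integral A finite, so that A <= M A^(1/q) can be divided; monotone convergence
    removes the truncation. *)
Lemma trig_duality p M F : 1 <= p -> 0 <= M ->
  measurable_fun setT (F : borel X -> R) ->
  gamma.-integrable setT (EFin \o (F : borel X -> R)) ->
  (forall phi N, trig (@topdual R X) phi -> 0 < N -> norm_dual_le p phi N ->
    \int[gamma]_x (F x * phi x) <= M * N) ->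
  (\int[gamma]_x (`|F x| `^ p)%:E <= (M `^ p)%:E)%E.
Proof.
move=> p1 M0 mF iF hF; have p0 : 0 < p by lra.
pose m (N : nat) x := Num.min `|F x| N.+1%:R.
have m0 N x : 0 <= m N x by rewrite le_min normr_ge0 ler0n.
have mN N x : m N x <= N.+1%:R by rewrite ge_min lexx orbT.
have mm N : measurable_fun setT (m N : borel X -> R).
  by apply: measurable_minr => //; exact: measurableT_comp.
have mmp N : measurable_fun setT ((fun x => m N x `^ p) : borel X -> R).
  exact: (measurableT_comp (measurable_powR p) (mm N)).
have imp N : gamma.-integrable setT (EFin \o ((fun x => m N x `^ p) : borel X -> R)).
  apply: (@prob_bounded_integrable _ _ _ _ _ (N.+1%:R `^ p)) => // x.
  by rewrite ger0_norm ?powR_ge0// ge0_ler_powR ?nnegrE ?(ltW p0).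
have key N : \int[gamma]_x (m N x `^ p) <= M `^ p.
  (* The extremal function of Hoelder's inequality. For p = 1 the power is 1 everywhere, including
     at 0, and T is the sign of F. *)
  pose T x := if 0 <= F x then m N x `^ (p - 1) else - m N x `^ (p - 1).
  have mT : measurable_fun setT (T : borel X -> R).
    have h : measurable_fun setT ((fun x => m N x `^ (p - 1)) : borel X -> R).
      exact: (measurableT_comp (measurable_powR (p - 1)) (mm N)).
    apply: measurable_fun_ifT => //; last exact: measurableT_comp.
    exact: measurable_fun_ler.
  set A := \int[gamma]_x _.
  have A0 : 0 <= A by apply: Rintegral_ge0 => x _; exact: powR_ge0.
  have p10 : 0 <= p - 1 by lra.
  have nT x : `|T x| <= m N x `^ (p - 1).
    by rewrite /T; case: ifP; rewrite ?normrN (ger0_norm (powR_ge0 _ _)).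
  have B0 : 0 < N.+1%:R `^ (p - 1) :> R by rewrite powR_gt0// ltr0n.
  have TB x : `|T x| <= N.+1%:R `^ (p - 1).
    by apply: le_trans (nT x) _; apply: ge0_ler_powR; rewrite ?nnegrE.
  have AT : A <= \int[gamma]_x (F x * T x).
    apply: le_Rintegral => //.
      apply: (@eq_integrable _ _ _ gamma setT measurableT (fun x : borel X => (T x * F x)%:E)).
        by move=> x _ /=; rewrite mulrC.
      exact: (integrableM_bounded iF mT TB).
    move=> x _.
    have -> : F x * T x = `|F x| * m N x `^ (p - 1).
      by rewrite /T; case: ger0P => Fx; rewrite ?mulrN ?mulNr.
    rewrite -(mulr_powRB1 (m0 N x) p0); apply: ler_wpM2r; [exact: powR_ge0|by rewrite ge_min lexx].
  have dual := bounded_duality p1 M0 mF iF hF mT B0 TB.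
  have [pe|pn1] := eqVneq p 1.
    have -> : M `^ p = M by rewrite pe powRr1.
    apply: le_of_le_scale => // t t1.
    apply: le_trans AT _; apply: dual; first lra.
    by rewrite pe eqxx subrr powRr0.
  have p1' : 1 < p by rewrite lt_def pn1.
  rewrite (negbTE pn1) in dual.
  set q := p / (p - 1) in dual.
  have q1 : 1 < q by rewrite /q ltr_pdivlMr; lra.
  have q0 : 0 < q by lra.
  have [AE|An] := eqVneq A 0; first by rewrite AE powR_ge0.
  have A0' : 0 < A by rewrite lt_def An.
  (* Since (p - 1) q = p, the integral of |T|^q is at most A; the factor t > 1 makes the inequality
     strict. *)
  have qA t : 1 < t -> A <= M * (A `^ q^-1 * t).
    move=> t1; apply: le_trans AT _; apply: dual.
      by rewrite mulr_gt0 ?powR_gt0//; lra.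
    rewrite powRM ?powR_ge0//; last lra.
    rewrite -powRrM mulVf ?gt_eqF// powRr1//.
    apply: (@le_lt_trans _ _ A); last first.
      rewrite ltr_pMr//.
      have : 1 `^ q < t `^ q by apply: gt0_ltr_powR => //; rewrite nnegrE; lra.
      by rewrite powR1.
    have mTq : measurable_fun setT ((fun x => `|T x| `^ q) : borel X -> R).
      exact: (measurableT_comp (measurable_norm_powR q) mT).
    have h x : `|T x| `^ q <= m N x `^ p.
      have -> : p = (p - 1) * q by rewrite /q; field; rewrite gt_eqF//; lra.
      by rewrite (powRrM _ (p - 1)); apply: ge0_ler_powR; rewrite ?nnegrE ?powR_ge0 ?(ltW q0).
    apply: le_Rintegral => //; apply: le_integrable_norm (imp N) => // x.
    by rewrite ger0_norm ?powR_ge0.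
  have Ap : A `^ p^-1 <= M.
    apply: le_of_le_scale => // t t1.
    have := qA t t1; rewrite mulrCA => h.
    have hA : A = A `^ p^-1 * A `^ q^-1.
      rewrite -powRD; last by rewrite An implybT.
      have -> : p^-1 + q^-1 = 1 by rewrite /q; field; rewrite !gt_eqF//; lra.
      by rewrite powRr1.
    rewrite {1}hA [X in X <= _]mulrC in h.
    by rewrite ler_pM2l ?powR_gt0 in h.
  have -> : A = (A `^ p^-1) `^ p by rewrite -powRrM mulVf ?powRr1// gt_eqF.
  by apply: ge0_ler_powR; rewrite ?nnegrE ?powR_ge0 ?(ltW p0).
have mp0 N x : setT x -> (0 <= (m N x `^ p)%:E)%E by move=> _; rewrite lee_fin powR_ge0.
have nd x : setT x -> nondecreasing_seq (fun N => (m N x `^ p)%:E).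
  move=> _ N N' NN'; rewrite lee_fin ge0_ler_powR ?nnegrE ?(ltW p0)//.
  by rewrite le_min ge_min lexx/= ge_min ler_nat ltnS NN' orbT.
have cv := @cvg_monotone_convergence _ _ _ gamma setT measurableT
  (fun N (x : borel X) => (m N x `^ p)%:E)
  (fun N => (measurable_EFinP _ _).2 (mmp N)) mp0 nd.
have limE : (fun x => limn (fun N => (m N x `^ p)%:E)) = (fun x => (`|F x| `^ p)%:E).
  apply/funext => x; apply/cvg_lim => //; apply: cvg_near_cst.
  exists (Num.truncn `|F x|) => // k /= hk; congr (_ `^ _)%:E; rewrite /m min_l//.
  by rewrite (le_trans (ltW (truncnS_gt _)))// ler_nat ltnS.
rewrite limE in cv.
rewrite -(cvg_lim _ cv)//; apply: lime_le; first exact: cvgP cv.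
apply: nearW => N; rewrite -[leLHS]fineK ?lee_fin; first exact: key.
exact: integrable_fin_num (imp N).
Qed.

End duality.

(** * Smooth functions and cut-offs *)

Lemma is_derive_line (R : realType) (V : normedModType R) (f : V -> R) (z v : V) (a : R) :
  is_derive z v f a <-> is_derive (0 : R) 1 (fun h => f (h *: v + z)) a.
Proof.
have e : (fun h : R => h^-1 *: ((f \o shift z) (h *: v) - f z)) =
    (fun h : R => h^-1 *: (((fun h => f (h *: v + z)) \o shift 0) (h *: 1) - f (0 *: v + z))).
  by apply/funext => h /=; rewrite addr0 scale0r add0r [_%:A]mulr1.
by split=> -[dr dv]; split; rewrite /derivable /derive ?e -?e//; move: dr dv; rewrite /derivable /derive ?e -?e.
Qed.

Lemma is_derive_comp_dir (R : realType) (V : normedModType R) (F : R -> R) (u : V -> R)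
    (z v : V) (a b : R) :
  is_derive (u z) 1 F a -> is_derive z v u b ->
  is_derive z v (fun y => F (u y)) (a * b).
Proof.
move=> dF /is_derive_line du; apply/is_derive_line.
by apply: (is_derive1_comp (f := F)) => //; rewrite scale0r add0r.
Qed.

Section smooth_expressions.
Context (R : realType).

(** Smoothness without iterated derivatives: F lies in some class of functions stable under
    differentiation. *)
Definition smooth_real (F : R -> R) := exists2 D : set (R -> R), D F &
  forall G, D G -> exists2 G', D G' & forall x : R, is_derive x 1 G (G' x).

Lemma smooth_realP F : smooth_real F ->
  continuous F /\ exists2 F', smooth_real F' & forall x : R, is_derive x 1 F (F' x).
Proof.
move=> [D DF hD]; have [F' DF' dF] := hD _ DF; split.
  by move=> x; apply: differentiable_continuous; apply/derivable1_diffP; case: (dF x).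
by exists F' => //; exists D.
Qed.

Context (n : nat).

(** The class is stable under partial derivatives, by the sum, product and chain rules, so
    membership alone yields the iterated partial derivatives that [smooth] speaks of. *)
Inductive smooth_expr : ('rV[R]_n -> R) -> Prop :=
| smooth_cst c : smooth_expr (fun=> c)
| smooth_coord i : smooth_expr (fun z => z 0 i)
| smooth_add u v : smooth_expr u -> smooth_expr v -> smooth_expr (fun z => u z + v z)
| smooth_mul u v : smooth_expr u -> smooth_expr v -> smooth_expr (fun z => u z * v z)
| smooth_comp F u : smooth_real F -> smooth_expr u -> smooth_expr (fun z => F (u z)).

Lemma is_derive_coord (z : 'rV[R]_n) (i j : 'I_n) :
  is_derive z (delta_mx 0 j) (fun z : 'rV[R]_n => z 0 i) (i == j)%:R.
Proof.
apply/is_derive_line.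
have -> : (fun h : R => (h *: delta_mx 0 j + z) 0 i) = (fun h => (i == j)%:R * h + z 0 i).
  by apply/funext => h; rewrite !mxE eqxx/= mulrC.
by apply: is_derive_eq; rewrite /GRing.scale/=; ring.
Qed.

Lemma smooth_exprP u : smooth_expr u -> continuous u /\ forall j, exists2 v, smooth_expr v &
  forall z, is_derive z (delta_mx 0 j) u (v z).
Proof.
elim=> {u} [c|i|u v su [cu du] sv [cv dv]|u v su [cu du] sv [cv dv]|F u sF su [cu du]].
- split=> [|j]; first exact: cst_continuous.
  by exists (fun=> 0); [exact: smooth_cst|move=> z; exact: is_derive_cst].
- split=> [|j]; first exact: coord_continuous.
  by exists (fun=> (i == j)%:R); [exact: smooth_cst|move=> z; exact: is_derive_coord].
- split=> [|j]; first by move=> z; exact: (cvgD (cu z) (cv z)).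
  have [u' su' du'] := du j; have [v' sv' dv'] := dv j.
  by exists (fun z => u' z + v' z); [exact: smooth_add|move=> z; exact: is_deriveD].
- split=> [|j]; first by move=> z; exact: (cvgM (cu z) (cv z)).
  have [u' su' du'] := du j; have [v' sv' dv'] := dv j.
  exists (fun z => u z * v' z + v z * u' z).
    by apply: smooth_add; exact: smooth_mul.
  by move=> z; exact: is_deriveM.
- have [cF [F' sF' dF]] := smooth_realP sF; split=> [|j].
    by move=> z; exact: (continuous_comp (cu z) (cF (u z))).
  have [u' su' du'] := du j; exists (fun z => F' (u z) * u' z).
    by apply: smooth_mul => //; exact: smooth_comp.
  by move=> z; exact: is_derive_comp_dir.
Qed.

Lemma smooth_expr_smooth u : smooth_expr u -> smooth u.
Proof.
move=> su; have h s : smooth_expr (iter_partial s u).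
  elim: s => //= j s /smooth_exprP[_ /(_ j)[v sv dv]].
  rewrite (_ : partial j _ = v)//; apply/funext => z.
  by have [_ e] := dv z; exact: e.
move=> s; have [ch dh] := smooth_exprP (h s); split => // j z.
by have [v _ dv] := dh j; case: (dv z).
Qed.

Lemma smooth_sum (I : Type) (r : seq I) (u : I -> 'rV[R]_n -> R) :
  (forall i, smooth_expr (u i)) -> smooth_expr (fun z => \sum_(i <- r) u i z).
Proof.
move=> su; elim: r => [|i r ih].
  rewrite (_ : (fun _ => _) = fun=> 0); first exact: smooth_cst.
  by apply/funext => z; rewrite big_nil.
rewrite (_ : (fun _ => _) = fun z => u i z + \sum_(i <- r) u i z).
  exact: smooth_add.
by apply/funext => z; rewrite big_cons.
Qed.

End smooth_expressions.

Section flat_functions.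
Context (R : realType).

(** The weights x^-m make the span of these functions stable under differentiation: the derivative
    of [flat m] combines [flat m.+1] and [flat m.+2]. *)
Definition flat (m : nat) (x : R) : R := if 0 < x then x ^- m * expR (- x^-1) else 0.

Lemma flat_ge0 m x : 0 <= flat m x.
Proof.
rewrite /flat; case: ifP => // x0.
by rewrite mulr_ge0 ?expR_ge0// invr_ge0 exprn_ge0// ltW.
Qed.

(** One term of the exponential series at 1/x, of order m + k + 1. With k = 1 the bound is quadratic
    and gives the derivative 0 at the origin. *)
Lemma flat_le (m k : nat) x : 0 <= x -> flat m x <= (m + k).+1`!%:R * x ^+ k.+1.
Proof.
move=> x0; rewrite /flat; case: ifP => [xp|_]; last by rewrite mulr_ge0// exprn_ge0.
have f0 : 0 < (m + k).+1`!%:R :> R by rewrite ltr0n fact_gt0.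
have := @expR_ge1Dxn R x^-1 (m + k) (ltac:(by rewrite invr_ge0)) => h.
have {}h : x^-1 ^+ (m + k).+1 / (m + k).+1`!%:R <= expR x^-1 by lra.
have xn k' : x ^+ k' != 0 by rewrite expf_neq0 ?gt_eqF.
rewrite expRN ler_pdivrMr ?expR_gt0// -ler_pdivrMl; last first.
  by rewrite mulr_gt0// exprn_gt0.
apply: le_trans h; rewrite exprVn -addnS exprD.
rewrite le_eqVlt; apply/orP; left; apply/eqP; field.
by rewrite !xn gt_eqF.
Qed.

Lemma flat2_le x : flat 2 x <= 2.
Proof.
rewrite /flat; case: ifP => // x0.
have := @expR_ge1Dxn R x^-1 1 (ltac:(by rewrite invr_ge0 ltW)) => h.
by rewrite expRN ler_pdivrMr ?expR_gt0// -exprVn; move: h; rewrite !factS fact0 muln1; lra.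
Qed.

Lemma flat0_le x : x <= 1 -> expR 1 * flat 0 x <= 1.
Proof.
rewrite /flat expr0 invr1 mul1r => x1; case: ifP => x0; last by rewrite mulr0.
by rewrite -expRD -[leRHS]expR0 ler_expR subr_le0 invf_ge1.
Qed.

Lemma is_derive_sqr_bound (F : R -> R) (C : R) : 0 <= C ->
  (forall h, `|F h| <= C * h ^+ 2) -> is_derive (0 : R) 1 F 0.
Proof.
move=> C0 hF.
have F0 : F 0 = 0 by apply/eqP; rewrite -normr_le0 (le_trans (hF 0))// expr0n mulr0.
have c : (fun h : R => h^-1 *: ((F \o shift 0) (h *: 1) - F 0)) h @[h --> 0^'] --> (0 : R).
  apply/cvgr0Pnorm_le => e e0; near=> h.
  have h0 : h != 0 by near: h; exact: nbhs_dnbhs_neq.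
  rewrite /= F0 subr0 addr0 [_%:A]mulr1 normrM normfV ler_pdivrMl ?normr_gt0//.
  apply: le_trans (hF h) _; rewrite -(real_normK (num_real h)) expr2 mulrCA.
  apply: ler_wpM2l => //.
  have hd : `|h| <= e / (C + 1) by near: h; apply: dnbhs0_le; rewrite divr_gt0// ltr_wpDl.
  apply: (@le_trans _ _ ((C + 1) * `|h|)); first by rewrite mulrDl lerDl mul1r.
  by rewrite mulrC -ler_pdivlMr// ltr_wpDl.
by split; [exact: cvgP c|exact: cvg_lim c].
Unshelve. all: by end_near. Qed.

Lemma is_derive_flat (m : nat) (x : R) : is_derive x 1 (flat m) (- m%:R * flat m.+1 x + flat m.+2 x).
Proof.
have [x0|x0|<-] := ltgtP 0 x; last first.
- rewrite /flat ltxx mulr0 addr0.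
  apply: (@is_derive_sqr_bound _ (m + 1).+1`!%:R) => // h.
  rewrite -/(flat m h) ger0_norm ?flat_ge0//.
  have [h0|h0] := leP 0 h; first exact: flat_le.
  by rewrite /flat ltNge (ltW h0)/= mulr_ge0// sqr_ge0.
- have -> : - m%:R * flat m.+1 x + flat m.+2 x = 0.
    by rewrite /flat ltNge (ltW x0)/= mulr0 addr0.
  have d := is_derive_cst (0 : R) x (1 : R); apply: near_eq_is_derive d.
  near=> y; have y0 : y < 0 by near: y; exact: lt_nbhsl.
  by rewrite /flat ltNge (ltW y0).
- have d : is_derive x (1 : R) (fun y : R => (y^-1) ^+ m * expR (- y^-1))
      (- m%:R * flat m.+1 x + flat m.+2 x).
    have d := @is_deriveV R id x 1 1 (ltac:(by rewrite gt_eqF)) (is_derive_id x 1).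
    have dF : is_derive x^-1 (1 : R) (fun t : R => t ^+ m * expR (- t))
        (m%:R * x^-1 ^+ m.-1 * expR (- x^-1) - x^-1 ^+ m * expR (- x^-1)).
      have d1 : is_derive x^-1 (1 : R) (fun t : R => t ^+ m) (m%:R * x^-1 ^+ m.-1).
        have := is_deriveX m (is_derive_id x^-1 (1 : R)); rewrite exprfctE.
        by rewrite /GRing.scale/= mulr1.
      have d2 : is_derive x^-1 (1 : R) (fun t : R => expR (- t)) (- expR (- x^-1)).
        by apply: is_derive_eq; rewrite /GRing.scale/=; ring.
      by apply: (is_derive_eq (is_deriveM d1 d2)); rewrite /GRing.scale/=; ring.
    apply: (is_derive_eq (is_derive1_comp dF d)).
    rewrite /flat x0 /GRing.scale/= -!exprVn.
    by clear d dF; move: x^-1 => y; case: m => [|m] /=; rewrite !exprS; ring.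
  apply: near_eq_is_derive d.
  near=> y; have y0 : 0 < y by near: y; exact: lt_nbhsr.
  by rewrite /flat y0 exprVn.
Unshelve. all: by end_near. Qed.

Inductive flat_span : (R -> R) -> Prop :=
| flat_base m : flat_span (flat m)
| flat_add F G : flat_span F -> flat_span G -> flat_span (fun x => F x + G x)
| flat_scale a F : flat_span F -> flat_span (fun x => a * F x).

Lemma smooth_flat m : smooth_real (flat m).
Proof.
exists flat_span; first exact: flat_base.
move=> G; elim=> {m G} [m|F G _ [F' sF dF] _ [G' sG dG]|a F _ [F' sF dF]].
- exists (fun x => - m%:R * flat m.+1 x + flat m.+2 x) => [|x]; last exact: is_derive_flat.
  by apply: flat_add; [apply: flat_scale|]; exact: flat_base.
- exists (fun x => F' x + G' x) => [|x]; first exact: flat_add.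
  exact: is_deriveD.
- exists (fun x => a * F' x) => [|x]; first exact: flat_scale.
  exact: is_deriveZ.
Qed.

End flat_functions.

Section cutoff.
Context (R : realType) (n : nat).
Implicit Types (z : 'rV[R]_n) (r : R).

(** The standard bump on the ball of radius r, normalised by e to be 1 at the centre. It equals 1
    only there, but tends to 1 pointwise as r grows. *)
Definition cutoff r z : R := expR 1 * flat 0 (1 - (\sum_i z 0 i ^+ 2) / r ^+ 2).

Let sumsq_ge0 z : 0 <= \sum_i z 0 i ^+ 2.
Proof. by apply: sumr_ge0 => i _; exact: sqr_ge0. Qed.

Lemma cutoff_smooth r : smooth_expr (cutoff r).
Proof.
apply: smooth_mul; first exact: smooth_cst.
apply: (smooth_comp (smooth_flat R 0)).
apply: smooth_add; first exact: smooth_cst.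
rewrite (_ : (fun _ => _) = fun z => (- (r ^+ 2)^-1) * \sum_i (z 0 i * z 0 i)); last first.
  by apply/funext => z; rewrite mulNr mulrC; congr (- (_ * _)); apply: eq_bigr => i _; rewrite expr2.
apply: smooth_mul; first exact: smooth_cst.
by apply: smooth_sum => i; apply: smooth_mul; exact: smooth_coord.
Qed.

Lemma cutoff_ge0 r z : 0 <= cutoff r z.
Proof. by rewrite mulr_ge0 ?expR_ge0 ?flat_ge0. Qed.

Lemma cutoff_le1 r z : cutoff r z <= 1.
Proof.
by apply: flat0_le; rewrite gerBl divr_ge0// ?sqr_ge0.
Qed.

Lemma cutoff_supp r z : 0 < r -> r ^+ 2 <= \sum_i z 0 i ^+ 2 -> cutoff r z = 0.
Proof.
move=> r0 h; rewrite /cutoff /flat ltNge.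
rewrite (_ : (1 - _ <= 0)) ?mulr0//= subr_le0.
by rewrite ler_pdivlMr ?mul1r// exprn_gt0.
Qed.

(** On the support |z_j| <= r, and [flat 2] is at most 2: the product e 2 (2 r / r^2) is 4 e / r. *)
Lemma cutoff_partial r j z : 0 < r -> `|partial j (cutoff r) z| <= 4 * expR 1 / r.
Proof.
move=> r0; have rn : r != 0 by rewrite gt_eqF.
have d : is_derive z (delta_mx 0 j) (cutoff r)
    (expR 1 * (flat 2 (1 - (\sum_i z 0 i ^+ 2) / r ^+ 2) * (- 2 * z 0 j / r ^+ 2))).
  apply: is_deriveZ; apply: is_derive_comp_dir.
    by apply: is_derive_eq (is_derive_flat 0 _) _; rewrite oppr0 mul0r add0r.
  apply/is_derive_line.
  have -> : (fun h : R => 1 - (\sum_i (h *: delta_mx 0 j + z) 0 i ^+ 2) / r ^+ 2) =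
    (fun h => 1 - (\sum_i z 0 i ^+ 2) / r ^+ 2 - (2 * h * z 0 j + h ^+ 2) / r ^+ 2).
    apply/funext => h; have -> : \sum_i (h *: delta_mx 0 j + z) 0 i ^+ 2 =
        \sum_i z 0 i ^+ 2 + (2 * h * z 0 j + h ^+ 2).
      rewrite (bigD1 j)//= [in RHS](bigD1 j)//= !mxE !eqxx/=.
      rewrite (eq_bigr (fun i => z 0 i ^+ 2)); first by ring.
      by move=> i ij; rewrite !mxE (negbTE ij) andbF mulr0 add0r.
    by rewrite mulrDl opprD addrA.
  by apply: is_derive_eq; rewrite /GRing.scale/=; field.
have [_ e] := d; rewrite [partial _ _ _]e {d e}.
set u := 1 - _; have [u0|u0] := leP u 0.
  by rewrite /flat ltNge u0/= mul0r mulr0 normr0 divr_ge0 ?mulr_ge0 ?expR_ge0// ltW.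
have zr : `|z 0 j| <= r.
  rewrite -(@ler_pXn2r _ 2)// ?nnegrE ?(ltW r0)// real_normK ?num_real//.
  rewrite /u subr_gt0 ltr_pdivrMr ?exprn_gt0// mul1r in u0; apply: le_trans (ltW u0).
  rewrite (bigD1 j)//= lerDl; by apply: sumr_ge0 => i _; exact: sqr_ge0.
rewrite !normrM (ger0_norm (expR_ge0 1)) (ger0_norm (flat_ge0 2 u)) normrN normr_nat.
rewrite (ger0_norm (_ : 0 <= (r ^+ 2)^-1)); last by rewrite invr_ge0 exprn_ge0// ltW.
apply: (@le_trans _ _ (expR 1 * (2 * (2 * r / r ^+ 2)))).
  apply: ler_wpM2l; first exact: expR_ge0.
  apply: ler_pM; [exact: flat_ge0| |exact: flat2_le|].
    by rewrite divr_ge0 ?exprn_ge0 ?mulr_ge0// ltW.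
  by apply: ler_wpM2r; [rewrite invr_ge0 exprn_ge0// ltW|exact: ler_wpM2l].
by rewrite le_eqVlt; apply/orP; left; apply/eqP; field.
Qed.

Lemma cutoff_cvg z : cutoff k.+1%:R z @[k --> \oo] --> (1 : R).
Proof.
have e : 1 = expR 1 * flat 0 (1 - (\sum_i z 0 i ^+ 2) * (0 * 0)).
  by rewrite mul0r mulr0 subr0 /flat ltr01 expr0 !invr1 mul1r expRN mulfV// gt_eqF// expR_gt0.
rewrite [X in _ --> X]e; apply: cvgM; first exact: cvg_cst.
have [cf _] := smooth_realP (smooth_flat R 0).
apply: continuous_cvg; first exact: cf.
apply: cvgB; first exact: cvg_cst.
apply: cvgM; first exact: cvg_cst.
have h := @cvg_harmonic R.
under eq_fun do rewrite expr2 invfM.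
exact: cvgM.
Qed.

Lemma cutoff_mul_compact r u : 0 < r -> smooth_expr u ->
  smooth_compact_support (fun z => cutoff r z * u z).
Proof.
move=> r0 su; split.
  by apply: smooth_expr_smooth; apply: smooth_mul => //; exact: cutoff_smooth.
have cl : closed [set z : 'rV[R]_n | \sum_i z 0 i ^+ 2 <= r ^+ 2].
  apply: (@closed_comp _ _ (fun z : 'rV[R]_n => \sum_i z 0 i ^+ 2) [set x | x <= r ^+ 2]).
    move=> z _; have ss : smooth_expr (fun z : 'rV[R]_n => \sum_i (z 0 i * z 0 i)).
      by apply: smooth_sum => i; apply: smooth_mul; exact: smooth_coord.
    have [cs _] := smooth_exprP ss; under eq_fun do under eq_bigr do rewrite expr2.
    exact: cs.
  exact: closed_le.
have sub : [set y | cutoff r y * u y != 0] `<=` [set z | \sum_i z 0 i ^+ 2 <= r ^+ 2].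
  move=> z /=; apply: contraR; rewrite -ltNge => /ltW h.
  by rewrite cutoff_supp// mul0r.
have csub := closure_subset sub; rewrite -(proj1 (closure_id _) cl) in csub.
have cbox : compact [set z : 'rV[R]_n | forall i, z ord0 i \in `[(- r), r]].
  apply: (@rV_compact _ _ (fun=> `[(- r), r]%classic)).
  by move=> _; exact: segment_compact.
apply: subclosed_compact (@closed_closure _ _) cbox _ => z /csub /= hz i.
suff : `|z 0 i| <= r by rewrite ler_norml in_itv.
rewrite -(@ler_pXn2r _ 2)// ?nnegrE ?(ltW r0)// real_normK ?num_real//.
apply: le_trans hz; rewrite (bigD1 i)//= lerDl.
by apply: sumr_ge0 => k _; exact: sqr_ge0.
Qed.

End cutoff.

(** * The vector field of a trigonometric polynomial *)

Section uniform.
Context (R : realType) (a b : R) (ab : a < b).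

(** The constant B is added to reduce to a nonnegative integrand, and B x to its primitive. *)
Lemma Rintegral_uniform_FTC (f F : R -> R) (B : R) : continuous f ->
  (forall x, `|f x| <= B) -> (forall x : R, is_derive x 1 F (f x)) ->
  \int[uniform_prob ab]_x f x = (F b - F a) / (b - a).
Proof.
move=> cf fB dF.
pose G x := F x + B * x.
have dG (x : R) : is_derive x 1 G (f x + B).
  apply: is_deriveD; have := is_deriveZ B (is_derive_id x (1 : R)).
  by rewrite /GRing.scale/= mulr1.
have cG : continuous G.
  by move=> x; apply: differentiable_continuous; apply/derivable1_diffP; case: (dG x).
have cfB : continuous (fun x => f x + B) by move=> x; apply: cvgD; [exact: cf|exact: cvg_cst].
have mf : measurable_fun setT (f : measurableTypeR R -> R) by exact: continuous_measurable_fun cf.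
have mfB : measurable_fun setT ((fun x => f x + B) : measurableTypeR R -> R).
  exact: continuous_measurable_fun cfB.
have i1 : (uniform_prob ab).-integrable setT (EFin \o f) by exact: prob_bounded_integrable mf fB.
have e1 : \int[uniform_prob ab]_x (f x + B) = \int[uniform_prob ab]_x f x + B.
  rewrite RintegralD// ?Rintegral_prob_cst//.
  exact: finite_measure_integrable_cst.
rewrite -[LHS](addrK B) -e1.
have -> : \int[uniform_prob ab]_x (f x + B) = (G b - G a) / (b - a).
  rewrite /Rintegral (@integral_uniform _ _ _ ab (EFin \o (fun x => f x + B))); last 2 first.
  - exact/measurable_EFinP.
  - by move=> x; rewrite lee_fin; have := fB x; rewrite ler_norml; lra.
  rewrite (@continuous_FTC2 _ _ G)//.
  - by rewrite /= mulrC.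
  - exact: continuous_subspaceT.
  - split; [by move=> x _; case: (dG x)|apply: cvg_at_right_filter; exact: cG|].
    apply: cvg_at_left_filter; exact: cG.
  - by move=> x _; rewrite derive1E; have [_ ->] := dG x.
rewrite /G; field; rewrite subr_eq0 gt_eqF//.
Qed.

End uniform.

Section interpolation_kernel.
Context (R : realType).

Let pihalf_gt0 : (0 : R) < pi / 2. Proof. by rewrite divr_gt0// pi_gt0. Qed.

(** The normalised range of th. Hoelder and Tonelli are then used with probabilities, and [vfield]
    carries the factor pi/2. *)
Definition angle : probability _ R := uniform_prob pihalf_gt0.

(** For t = l(x) and s = cov(l, l), the cosine times the exponential is E_y cos(l(x cos(theta) + y
    sin(theta)) + b). The factor sin(theta) comes from integrating by parts against g_c(y), and each
    derivative in t adds a power of cos(theta). *)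
Definition kernel (s b : R) (m : nat) (t theta : R) : R :=
  cos (t * cos theta + b) * (cos theta ^+ m * sin theta *
    expR (- (s * sin theta ^+ 2) / 2)).

Definition smoothed_cos s b m t := \int[angle]_theta kernel s b m t theta.

Let norm_cos (x : R) : `|cos x| <= 1.
Proof. by rewrite ler_norml cos_geN1 cos_le1. Qed.

Let norm_sin (x : R) : `|sin x| <= 1.
Proof. by rewrite ler_norml sin_geN1 sin_le1. Qed.

Let continuous_weight s m :
  continuous (fun theta : R => cos theta ^+ m * sin theta * expR (- (s * sin theta ^+ 2) / 2)).
Proof.
move=> x; apply: cvgM.
  apply: cvgM; last exact: continuous_sin.
  apply: (@continuous_comp _ _ _ cos (fun y : R => y ^+ m)); first exact: continuous_cos.
  exact: exprn_continuous.
apply: (@continuous_comp _ _ _ (fun x : R => - (s * sin x ^+ 2) / 2) expR); last exact: continuous_expR.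
apply: cvgM; last exact: cvg_cst.
apply: cvgN; apply: cvgM; first exact: cvg_cst.
apply: (@continuous_comp _ _ _ sin (fun y : R => y ^+ 2)); first exact: continuous_sin.
exact: exprn_continuous.
Qed.

Lemma continuous_kernel s b m t : continuous (kernel s b m t).
Proof.
move=> x; apply: cvgM; last exact: continuous_weight.
apply: (@continuous_comp _ _ _ (fun x : R => t * cos x + b) cos); last exact: continuous_cos.
by apply: cvgD; [apply: cvgM; [exact: cvg_cst|exact: continuous_cos]|exact: cvg_cst].
Qed.

Lemma norm_kernel s b m t theta : 0 <= s -> `|kernel s b m t theta| <= 1.
Proof.
move=> s0; rewrite !normrM normrX (ger0_norm (expR_ge0 _)).
rewrite mulr_ile1 ?mulr_ge0 ?exprn_ge0 ?expR_ge0//.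
rewrite mulr_ile1 ?mulr_ge0 ?exprn_ge0 ?expR_ge0//.
  by rewrite mulr_ile1 ?exprn_ge0// exprn_ile1.
by rewrite -expR0 ler_expR mulNr oppr_le0 divr_ge0// mulr_ge0// sqr_ge0.
Qed.

Lemma kernel_integrable s b m t : 0 <= s ->
  angle.-integrable setT (EFin \o kernel s b m t).
Proof.
move=> s0; apply: prob_bounded_integrable; last by move=> x; exact: norm_kernel.
have := continuous_measurable_fun (@continuous_kernel s b m t); exact.
Qed.

Lemma is_derive_smoothed_cos s b m (t : R) : 0 <= s ->
  is_derive t 1 (smoothed_cos s b m) (smoothed_cos s (b + pi / 2) m.+1 t).
Proof.
move=> s0.
apply: (@derive_under_Rintegral _ _ _ angle (kernel s b m) (kernel s (b + pi / 2) m.+1) (fun=> 1) t (t - 1) (t + 1)).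
- by apply/andP; split; lra.
- by move=> x _; exact: kernel_integrable.
- move=> x th _; apply: is_derive_eq.
  rewrite /GRing.scale/= /kernel addrA cosDpihalf (exprS (cos th) m).
  by ring.
- exact: finite_measure_integrable_cst.
- by move=> x th _; exact: norm_kernel.
Qed.

Lemma smooth_smoothed_cos s b m : 0 <= s -> smooth_real (smoothed_cos s b m).
Proof.
move=> s0; exists [set F | exists b m, F = smoothed_cos s b m]; first by exists b, m.
move=> _ [b' [m' ->]]; exists (smoothed_cos s (b' + pi / 2) m'.+1).
  by exists (b' + pi / 2), m'.+1.
by move=> x; exact: is_derive_smoothed_cos.
Qed.

(** The divergence identity for one frequency. The integrand on the left is the derivative in th of
    -cos(t cos(th) + b) exp(-s sin(th)^2 / 2), which interpolates between the cosine at th = 0 and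
    its mean at th = pi/2. *)
Lemma smoothed_cos_ode s b t : 0 <= s ->
  s * smoothed_cos s b 1 t - t * smoothed_cos s (b - pi / 2) 0 t =
  (cos (t + b) - cos b * expR (- s / 2)) / (pi / 2).
Proof.
move=> s0.
pose F th := - (cos (t * cos th + b) * expR (- (s * sin th ^+ 2) / 2)).
pose f th := s * kernel s b 1 t th - t * kernel s (b - pi / 2) 0 t th.
have dF (x : R) : is_derive x 1 F (f x).
  apply: is_derive_eq; rewrite /f /kernel /GRing.scale/= addrA cosBpihalf; by field.
have fB x : `|f x| <= s + `|t|.
  rewrite (le_trans (ler_normB _ _))// lerD// normrM.
    by rewrite (ger0_norm s0) ler_piMr// norm_kernel.
  by rewrite ler_piMr// norm_kernel.
have cf : continuous f.
  move=> x; apply: cvgB; apply: cvgM; (try exact: cvg_cst); exact: continuous_kernel.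
have := Rintegral_uniform_FTC pihalf_gt0 cf fB dF.
rewrite /f RintegralB//; last 2 first.
- by apply: integrable_scale; exact: kernel_integrable.
- by apply: integrable_scale; exact: kernel_integrable.
rewrite !RintegralZl//; [|exact: kernel_integrable..] => ->.
rewrite /F cos_pihalf sin_pihalf cos0 sin0 mulr0 add0r mulr1 expr1n expr0n/= mulr0 oppr0 mul0r expR0 mulr1.
by rewrite addr0 mulr1 opprK addrC.
Qed.

End interpolation_kernel.

Lemma Lnorm_le d (T : measurableType d) (R : realType) (mu : {measure set T -> \bar R})
    (q N : R) (f : T -> R) : 0 < q -> 0 <= N ->
  (\int[mu]_x (`|f x| `^ q)%:E <= (N `^ q)%:E)%E -> ('N[mu]_q%:E[EFin \o f] <= N%:E)%E.
Proof.
move=> q0 N0 h; rewrite unlock.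
have -> : N%:E = ((N `^ q)%:E `^ q^-1)%E.
  by rewrite poweR_EFin -powRrM mulfV ?powRr1// gt_eqF.
apply: gt0_ler_poweR => //.
- by rewrite invr_ge0 ltW.
- rewrite in_itv/= leey andbT; apply: integral_ge0 => x _; by rewrite lee_fin powR_ge0.
- by rewrite in_itv/= leey andbT lee_fin powR_ge0.
Qed.

Section product.
Context d (T : measurableType d) d' (T' : measurableType d') (R : realType)
  (P : probability T R) (Q : probability T' R).

Lemma product_snd_law (A : set T') : measurable A -> (P \x Q)%E (snd @^-1` A) = Q A.
Proof.
move=> mA; have -> : snd @^-1` A = (setT : set T) `*` A.
  by apply/seteqP; split=> [[x y]|[x y] []].
transitivity (P setT * Q A)%E; first exact: product_measure1E.
by rewrite probability_setT mul1e.
Qed.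

Lemma Rintegral_product (f : T * T' -> R) : (P \x Q)%E.-integrable setT (EFin \o f) ->
  (forall x, Q.-integrable setT (EFin \o (fun y => f (x, y)))) ->
  \int[(P \x Q)%E]_z f z = \int[P]_x \int[Q]_y f (x, y).
Proof.
move=> intf intx; rewrite /Rintegral -integral12_prod_meas1//; congr fine.
apply: eq_integral => x _; rewrite fineK//.
by apply: integrable_fin_num => //; exact: intx.
Qed.

End product.

Section field.
Context (R : realType) (X : tvsType R) (gamma : probability (borel X) R).
Hypothesis hgamma : radon_centered_gaussian gamma.
Context (n m : nat) (g : 'I_n -> X -> R) (a b : 'I_m -> R) (u : 'I_m -> 'I_n -> R).
Hypothesis tg : forall j, topdual (g j).
Hypothesis og : forall i j, cov gamma (g i) (g j) = (i == j)%:R.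

Definition combination (c : 'I_n -> R) (x : X) := \sum_j c j * g j x.

Definition trig_poly (x : X) : R := \sum_k a k * cos (combination (u k) x + b k).

Lemma combination_topdual c : topdual (combination c).
Proof. exact: topdual_sum. Qed.

Lemma cov_combination c c' :
  cov gamma (combination c) (combination c') = \sum_j c j * c' j.
Proof.
rewrite covC cov_sumr//; last exact: combination_topdual.
apply: eq_bigr => j _; rewrite covC cov_sumr// (bigD1 j)//= og eqxx mulr1 big1 ?addr0//.
by move=> i ij; rewrite og eq_sym (negbTE ij) mulr0.
Qed.

Let s k := \sum_j u k j ^+ 2.

Let s_ge0 k : 0 <= s k.
Proof. by apply: sumr_ge0 => j _; exact: sqr_ge0. Qed.

Let cov_u k : cov gamma (combination (u k)) (combination (u k)) = s k.
Proof. by rewrite cov_combination; apply: eq_bigr => j _; rewrite expr2. Qed.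

Let dot k (z : 'rV[R]_n) := \sum_j u k j * z 0 j.

Let dot_coords k x : dot k (coords g x) = combination (u k) x.
Proof. by apply: eq_bigr => j _; rewrite mxE. Qed.

(** The interpolation field with y already integrated out: the k-th frequency contributes, in the
    direction u_k, a function of the single variable u_k . z. *)
Definition vfield (j : 'I_n) (z : 'rV[R]_n) : R :=
  pi / 2 * \sum_k a k * u k j *
    smoothed_cos (\sum_j u k j ^+ 2) (b k - pi / 2) 0 (\sum_j u k j * z 0 j).

Let dot_smooth k : smooth_expr (dot k).
Proof.
by apply: smooth_sum => j; apply: smooth_mul; [exact: smooth_cst|exact: smooth_coord].
Qed.

Lemma vfield_smooth j : smooth_expr (vfield j).
Proof.
apply: smooth_mul; first exact: smooth_cst.
apply: smooth_sum => k; apply: smooth_mul; first exact: smooth_cst.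
by apply: smooth_comp (dot_smooth k); exact: smooth_smoothed_cos (s_ge0 k).
Qed.

Lemma is_derive_sumf (V : normedModType R) (I : Type) (r : seq I) (F : I -> V -> R) (dF : I -> R)
    (z v : V) : (forall i, is_derive z v (F i) (dF i)) ->
  is_derive z v (fun y => \sum_(i <- r) F i y) (\sum_(i <- r) dF i).
Proof.
move=> dFi; elim: r => [|i r ih].
  rewrite big_nil (_ : (fun _ => _) = cst 0); first exact: is_derive_cst.
  by apply/funext => y; rewrite big_nil.
rewrite big_cons (_ : (fun _ => _) = fun y => F i y + \sum_(j <- r) F j y).
  exact: is_deriveD.
by apply/funext => y; rewrite big_cons.
Qed.

Lemma is_derive_vfield i j z : is_derive z (delta_mx 0 i) (vfield j)
  (pi / 2 * \sum_k a k * u k j * (smoothed_cos (s k) (b k) 1 (dot k z) * u k i)).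
Proof.
apply: is_deriveZ; apply: is_derive_sumf => k; apply: is_deriveZ.
apply: (is_derive_comp_dir (F := smoothed_cos (s k) (b k - pi / 2) 0) (u := dot k)).
  by have := is_derive_smoothed_cos (b k - pi / 2) 0 (dot k z) (s_ge0 k); rewrite subrK.
have := is_derive_sumf (index_enum 'I_n) (F := fun j (z : 'rV[R]_n) => u k j * z 0 j) (dF := fun j => u k j * (j == i)%:R).
move=> /(_ z (delta_mx 0 i)) h.
have {}h := h (fun j => is_deriveZ (u k j) (is_derive_coord z j i)).
apply: is_derive_eq h _.
rewrite (bigD1 i)//= eqxx mulr1 big1 ?addr0// => j' ji.
by rewrite (negbTE ji) mulr0.
Qed.

Lemma Rintegral_trig_poly :
  \int[gamma]_x trig_poly x = \sum_k a k * (cos (b k) * expR (- s k / 2)).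
Proof.
rewrite Rintegral_sum; last first.
  move=> k; apply: integrable_scale; apply: integrable_cos.
  by apply: topdual_measurable; exact: combination_topdual.
apply: eq_bigr => k _; rewrite RintegralZl//; last first.
  apply: integrable_cos; apply: topdual_measurable; exact: combination_topdual.
by rewrite (Rintegral_cos hgamma _ (combination_topdual _)) cov_u.
Qed.

(** After exchanging the sums, each k is an instance of [smoothed_cos_ode] with s = |u_k|^2 and t =
    u_k . g(x). *)
Lemma vfield_div x :
  \sum_j (partial j (vfield j) (coords g x) - g j x * vfield j (coords g x)) =
  trig_poly x - \int[gamma]_y trig_poly y.
Proof.
rewrite Rintegral_trig_poly -sumrB.
have pi2 : pi / 2 != 0 :> R by rewrite gt_eqF// divr_gt0// pi_gt0.
transitivity (\sum_j \sum_k a k * (pi / 2) * (u k j ^+ 2 * smoothed_cos (s k) (b k) 1 (dot k (coords g x)) -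
    u k j * g j x * smoothed_cos (s k) (b k - pi / 2) 0 (dot k (coords g x)))).
  apply: eq_bigr => j _; have [_ e] := is_derive_vfield j j (coords g x).
  rewrite [partial _ _ _]e /vfield mulrCA -mulrBr mulr_sumr -sumrB mulr_sumr.
  by apply: eq_bigr => k _; rewrite -/(s k) -/(dot k _); ring.
rewrite exchange_big/=; apply: eq_bigr => k _.
rewrite -mulr_sumr sumrB -!mulr_suml -/(s k) dot_coords -/(combination (u k) x).
rewrite smoothed_cos_ode//.
by rewrite -mulrA [_ * (_ / _)]mulrC divfK// mulrBr.
Qed.

Let mu2 : probability _ R := (@angle R \x gamma)%E.

Definition rotated (x : X) (z : measurableTypeR R * borel X) : R :=
  trig_poly (cos z.1 *: x + sin z.1 *: (z.2 : X)).

Lemma rotatedE x z : rotated x z = \sum_k a k *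
  cos (sin z.1 * combination (u k) z.2 + (cos z.1 * combination (u k) x + b k)).
Proof.
apply: eq_bigr => k _; have tk := combination_topdual (u k).
rewrite (topdualD _ _ tk) (topdualZ _ _ tk) (topdualZ _ _ tk).
by congr (_ * cos _); ring.
Qed.

Let mcos : measurable_fun setT ((fun z => cos z.1) : measurableTypeR R * borel X -> R).
Proof.
have mc : measurable_fun setT (@cos R) by apply: continuous_measurable_fun; exact: continuous_cos.
exact: (measurableT_comp mc measurable_fst).
Qed.

Let msin : measurable_fun setT ((fun z => sin z.1) : measurableTypeR R * borel X -> R).
Proof.
have mc : measurable_fun setT (@sin R) by apply: continuous_measurable_fun; exact: continuous_sin.
exact: (measurableT_comp mc measurable_fst).
Qed.

Let msnd l : topdual l -> measurable_fun setT ((fun z => l z.2) : measurableTypeR R * borel X -> R).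
Proof. by move=> tl; exact: (measurableT_comp (topdual_measurable tl) measurable_snd). Qed.

Let mterm k x : measurable_fun setT ((fun z => cos (sin z.1 * combination (u k) z.2 +
  (cos z.1 * combination (u k) x + b k))) : measurableTypeR R * borel X -> R).
Proof.
have mc : measurable_fun setT (@cos R) by apply: continuous_measurable_fun; exact: continuous_cos.
apply: (measurableT_comp mc); apply: measurable_funD.
  by apply: measurable_funM; [exact: msin|apply: msnd; exact: combination_topdual].
apply: measurable_funD => //; apply: measurable_funM => //; exact: mcos.
Qed.

Lemma rotated_measurable x : measurable_fun setT (rotated x).
Proof.
rewrite (_ : rotated x = fun z => \sum_k a k * cos (sin z.1 * combination (u k) z.2 +
  (cos z.1 * combination (u k) x + b k))); last by apply/funext => z; exact: rotatedE.
by apply: measurable_sum => k; apply: measurable_funM => //; exact: mterm.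
Qed.

Let combination_integrable c :
  mu2.-integrable setT (EFin \o ((fun z => `|combination c z.2|) : measurableTypeR R * borel X -> R)).
Proof.
have tc := combination_topdual c.
have mc : measurable_fun setT ((fun x => `|combination c x|) : borel X -> R).
  by apply: measurableT_comp => //; exact: topdual_measurable.
apply/(integrable_law (nu := gamma) (l := snd) measurable_snd _ mc).
  by move=> A mA; exact: product_snd_law.
by apply: integrable_norm; exact: topdual_integrable.
Qed.

Let rotated_term_integrable c k x : mu2.-integrable setT (EFin \o
  ((fun z => combination c z.2 * cos (sin z.1 * combination (u k) z.2 +
    (cos z.1 * combination (u k) x + b k))) : measurableTypeR R * borel X -> R)).
Proof.
apply: le_integrable_norm (combination_integrable c).
  by apply: measurable_funM; [apply: msnd; exact: combination_topdual|exact: mterm].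
by move=> z; rewrite normrM ler_piMr// norm_cos_le1.
Qed.

(** For fixed angle the y-integral is Gaussian integration by parts. The explicit formula gives
    smoothness and divergence; this average over angle and y gives the norm estimates. *)
Lemma vfield_rotated c x : \sum_j c j * vfield j (coords g x) =
  - (pi / 2) * \int[mu2]_z (combination c z.2 * rotated x z).
Proof.
have [_ _ LZ] := @topdual_linear R X.
transitivity (- (pi / 2) * \int[mu2]_z (\sum_k a k * (combination c z.2 *
    cos (sin z.1 * combination (u k) z.2 + (cos z.1 * combination (u k) x + b k))))); last first.
  congr (_ * _); apply: eq_Rintegral => z _; rewrite rotatedE mulr_sumr.
  by apply: eq_bigr => k _; rewrite mulrCA.
rewrite Rintegral_sum; last first.
  by move=> k; apply: integrable_scale; exact: rotated_term_integrable.
have E k : \int[mu2]_z (combination c z.2 *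
    cos (sin z.1 * combination (u k) z.2 + (cos z.1 * combination (u k) x + b k))) =
    - (\sum_j u k j * c j) * smoothed_cos (s k) (b k - pi / 2) 0 (combination (u k) x).
  have tk := combination_topdual (u k); have tc := combination_topdual c.
  rewrite Rintegral_product; [|exact: rotated_term_integrable|]; last first.
    move=> th /=; apply: le_integrable_norm (integrable_norm (topdual_integrable hgamma tc)).
      apply: measurable_funM; first exact: topdual_measurable.
      apply: measurable_cos_comp; apply: topdual_measurable; exact: LZ.
    by move=> y; rewrite normrM ler_piMr// norm_cos_le1.
  rewrite /smoothed_cos -RintegralZl//; last exact: kernel_integrable (s_ge0 k).
  apply: eq_Rintegral => th _ /=.
  transitivity (\int[gamma]_y (combination c y * sin (sin th * combination (u k) y +
      (cos th * combination (u k) x + b k + pi / 2)))).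
    by apply: eq_Rintegral => y _; rewrite [in RHS]addrA sinDpihalf.
  rewrite (Rintegral_mul_sin hgamma _ (LZ (sin th) _ tk) tc).
  rewrite !covZl// ?covZr//; last exact: LZ.
  rewrite cov_u cov_combination cosDpihalf /kernel addrA cosBpihalf expr0.
  have -> : - (sin th * (sin th * s k)) / 2 = - (s k * sin th ^+ 2) / 2 by ring.
  have -> : combination (u k) x * cos th + b k = cos th * combination (u k) x + b k by ring.
  by ring.
rewrite mulr_sumr; transitivity (\sum_k (pi / 2) * a k * (\sum_j u k j * c j) *
    smoothed_cos (s k) (b k - pi / 2) 0 (combination (u k) x)); last first.
  apply: eq_bigr => k _; by rewrite (RintegralZl _ measurableT (rotated_term_integrable c k x)) E; ring.
transitivity (\sum_j \sum_k (pi / 2) * a k * (u k j * c j) *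
    smoothed_cos (s k) (b k - pi / 2) 0 (combination (u k) x)).
  apply: eq_bigr => j _; rewrite /vfield mulrCA mulr_sumr mulr_sumr; apply: eq_bigr => k _.
  by rewrite -/(s k) -/(dot k _) dot_coords; ring.
rewrite exchange_big/=; apply: eq_bigr => k _.
by rewrite mulr_sumr mulr_suml.
Qed.

Lemma trig_poly_measurable : measurable_fun setT (trig_poly : borel X -> R).
Proof.
apply: measurable_sum => k; apply: measurable_funM => //; apply: measurable_cos_comp.
by apply: topdual_measurable; exact: combination_topdual.
Qed.

Lemma trig_poly_utrig : utrig (@topdual R X) trig_poly.
Proof.
have lin := @topdual_linear R X.
apply: (utrig_sum lin) => k; apply: (utrigM lin); first exact: utrig_cst.
by apply: utrig_trig; apply: trig_cos => //; exact: combination_topdual.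
Qed.

(** On cosines, cos(th)^2 + sin(th)^2 = 1 in the exponent; [utrig_comp] brings F of a trigonometric
    polynomial within reach. Only functionals of the rotated vector are integrated, since addition
    need not be measurable for the product of the two Borel sigma-algebras. *)
Lemma rotation_invariance (F : R -> R) (th : R) : continuous F ->
  \int[(gamma \x gamma)%E]_z F (trig_poly (cos th *: (z.2 : X) + sin th *: (z.1 : X))) =
  \int[gamma]_x F (trig_poly x).
Proof.
move=> cF; have lin := @topdual_linear R X; have [L0 LD LZ] := lin.
have uF := utrig_comp lin trig_poly_utrig cF.
have m1 l : topdual l -> measurable_fun setT
    (l \o (fun z : borel X * borel X => cos th *: (z.2 : X) + sin th *: (z.1 : X)) : _ -> R).
  move=> tl; rewrite (_ : _ \o _ = fun z : borel X * borel X => cos th * l z.2 + sin th * l z.1); last first.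
    by apply/funext => z /=; rewrite (topdualD _ _ tl) (topdualZ _ _ tl) (topdualZ _ _ tl).
  have ml := topdual_measurable tl.
  apply: measurable_funD; apply: measurable_funM => //.
    exact: (measurableT_comp ml measurable_snd).
  exact: (measurableT_comp ml measurable_fst).
have i1 : (gamma \x gamma)%E.-integrable setT (EFin \o (fun _ : borel X * borel X => 1 : R)).
  by apply: (@prob_bounded_integrable _ _ _ (gamma \x gamma)%E (fun=> 1) 1) => // z; rewrite normr1.
have i2 : gamma.-integrable setT (EFin \o (fun _ : borel X => 1 : R)).
  exact: finite_measure_integrable_cst.
have := @utrig_integral_eq R X (@topdual R X) _ _ _ _ (gamma \x gamma)%E gamma
  (fun z : borel X * borel X => cos th *: (z.2 : X) + sin th *: (z.1 : X)) idfun
  (fun=> 1) (fun=> 1) _ m1 (@topdual_borel R X) i1 i2 _ uF.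
under [X in (_ -> X = _) -> _]eq_Rintegral do rewrite mulr1.
under [X in (_ -> _ = X) -> _]eq_Rintegral do rewrite mulr1.
apply=> l c tl; have ml := topdual_measurable tl.
under eq_Rintegral do rewrite mulr1.
under [RHS]eq_Rintegral do rewrite mulr1.
have mz : measurable_fun setT (fun z : borel X * borel X => cos (cos th * l z.2 + (sin th * l z.1 + c))).
  have mc : measurable_fun setT (@cos R) by apply: continuous_measurable_fun; exact: continuous_cos.
  apply: (measurableT_comp mc); apply: measurable_funD; first apply: measurable_funM => //.
    exact: (measurableT_comp ml measurable_snd).
  apply: measurable_funD => //; apply: measurable_funM => //.
  exact: (measurableT_comp ml measurable_fst).
transitivity (\int[(gamma \x gamma)%E]_z cos (cos th * l z.2 + (sin th * l z.1 + c))).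
  by apply: eq_Rintegral => z _ /=; rewrite (topdualD _ _ tl) (topdualZ _ _ tl) (topdualZ _ _ tl) addrA.
rewrite Rintegral_product; last 2 first.
- by apply: prob_bounded_integrable mz _ => z; exact: norm_cos_le1.
- by move=> x /=; apply: integrable_cos; apply: topdual_measurable; exact: LZ.
under eq_Rintegral => x _ do rewrite /= (Rintegral_cos hgamma _ (LZ (cos th) _ tl)).
rewrite RintegralZr//; last by apply: integrable_cos; apply: topdual_measurable; exact: LZ.
rewrite (Rintegral_cos hgamma _ (LZ (sin th) _ tl)) (Rintegral_cos hgamma _ tl).
rewrite !covZl// ?covZr//; [|exact: LZ..].
rewrite -mulrA -expRD; congr (_ * expR _).
transitivity (- ((cos th ^+ 2 + sin th ^+ 2) * cov gamma l l) / 2); first by field.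
by rewrite cos2Dsin2 mul1r.
Qed.

Let norm_q_continuous q : 1 < q -> continuous (fun t : R => `|t| `^ q).
Proof.
move=> q1 t; have q0 : 0 < q by lra.
have C0 : 0 < q * (`|t| + 1) `^ (q - 1) by rewrite mulr_gt0// powR_gt0// ltr_wpDl.
apply/cvgrPdist_le => e e0; near=> y.
have y1 : `|y| <= `|t| + 1.
  have : `|t - y| <= 1 by near: y; apply: (@cvgr_dist_le _ _ _ _ (nbhs_filter t) idfun t) => //; exact: cvg_id.
  by move=> h; rewrite -lerBlDl (le_trans (lerB_dist _ _))// distrC.
have t1 : `|t| <= `|t| + 1 by rewrite lerDl.
have ye : `|t - y| <= e / (q * (`|t| + 1) `^ (q - 1)).
  near: y; apply: (@cvgr_dist_le _ _ _ _ (nbhs_filter t) idfun t); last by rewrite divr_gt0.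
  exact: cvg_id.
have h1 := @powR_lipschitz R q (`|t| + 1) `|t| `|y| q1.
have h2 := @powR_lipschitz R q (`|t| + 1) `|y| `|t| q1.
have d : q * (`|t| + 1) `^ (q - 1) * `| `|t| - `|y| | <= e.
  rewrite mulrC -ler_pdivlMr//; apply: le_trans ye; exact: ler_dist_dist.
rewrite ler_norml; apply/andP; split; last first.
  by apply: le_trans d; apply: h1; rewrite normr_ge0/=.
rewrite lerNl opprB; apply: le_trans d; rewrite [X in _ * X]distrC.
by apply: h2; rewrite normr_ge0/=.
Unshelve. all: by end_near. Qed.

Let trig_poly_bound : exists B, forall x, `|trig_poly x| <= B.
Proof. by have [B _ hB] := utrig_bounded trig_poly_utrig; exists B. Qed.

Lemma rotated_joint_measurable q : measurable_fun setT
  (fun xz : borel X * (measurableTypeR R * borel X) => (`|rotated xz.1 xz.2| `^ q)%:E).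
Proof.
have mq := measurable_norm_powR q.
apply/measurable_EFinP; apply: (measurableT_comp mq).
rewrite (_ : (fun xz => _) = fun xz : borel X * (measurableTypeR R * borel X) =>
  \sum_k a k * cos (sin xz.2.1 * combination (u k) xz.2.2 +
  (cos xz.2.1 * combination (u k) xz.1 + b k))); last by apply/funext => xz; exact: rotatedE.
apply: measurable_sum => k; apply: measurable_funM => //.
have mc : measurable_fun setT (@cos R) by apply: continuous_measurable_fun; exact: continuous_cos.
have mk := topdual_measurable (combination_topdual (u k)).
apply: (measurableT_comp mc); apply: measurable_funD; first apply: measurable_funM.
- exact: (measurableT_comp msin measurable_snd).
- exact: (measurableT_comp mk (measurableT_comp measurable_snd measurable_snd)).
- apply: measurable_funD => //; apply: measurable_funM.
    exact: (measurableT_comp mcos measurable_snd).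
  exact: (measurableT_comp mk measurable_fst).
Qed.

(** By Tonelli the angle is integrated last; for a fixed angle the double Gaussian integral does not
    depend on it. *)
Lemma rotated_integral q : 1 < q ->
  (\int[gamma]_x \int[mu2]_z (`|rotated x z| `^ q)%:E = \int[gamma]_x (`|trig_poly x| `^ q)%:E)%E.
Proof.
move=> q1; have q0 : 0 < q by lra.
have mq := measurable_norm_powR q.
pose f (xz : borel X * (measurableTypeR R * borel X)) := (`|rotated xz.1 xz.2| `^ q)%:E.
have mf : measurable_fun setT f by exact: rotated_joint_measurable.
have f0 xz : (0 <= f xz)%E by rewrite lee_fin powR_ge0.
transitivity (\int[gamma]_x \int[mu2]_z f (x, z))%E; first by [].
rewrite (fubini_tonelli (m1 := gamma) (m2 := mu2) f)//.
have mG := measurable_fun_fubini_tonelli_G (m1 := gamma) f mf f0.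
have G0 z : (0 <= fubini_G gamma f z)%E by apply: integral_ge0.
transitivity (\int[mu2]_z fubini_G gamma f z)%E; first by [].
rewrite (fubini_tonelli1 (m1 := @angle R) (m2 := gamma))//.
have [B hB] := trig_poly_bound.
have B0 : 0 <= B by exact: le_trans (hB 0).
have bq x : `| `|trig_poly x| `^ q | <= B `^ q.
  by rewrite ger0_norm ?powR_ge0// ge0_ler_powR ?nnegrE// ltW.
have iq : gamma.-integrable setT (EFin \o ((fun x => `|trig_poly x| `^ q) : borel X -> R)).
  apply: (@prob_bounded_integrable _ _ _ gamma _ (B `^ q)) => //.
  exact: (measurableT_comp mq trig_poly_measurable).
have E th : fubini_F gamma (fubini_G gamma f) th = (\int[gamma]_x (`|trig_poly x| `^ q)%:E)%E.
  rewrite /fubini_F /fubini_G /f /=.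
  pose f' (z : borel X * borel X) := `|trig_poly (cos th *: (z.2 : X) + sin th *: (z.1 : X))| `^ q.
  have mf' : measurable_fun setT f'.
    apply: (measurableT_comp mq).
    rewrite (_ : (fun z => _) = fun z => \sum_k a k * cos (sin th * combination (u k) z.1 +
      (cos th * combination (u k) z.2 + b k))); last first.
      by apply/funext => z; rewrite -(rotatedE z.2 (th, z.1)).
    apply: measurable_sum => k; apply: measurable_funM => //.
    have mc : measurable_fun setT (@cos R) by apply: continuous_measurable_fun; exact: continuous_cos.
    have mk := topdual_measurable (combination_topdual (u k)).
    apply: (measurableT_comp mc); apply: measurable_funD; first apply: measurable_funM => //.
      exact: (measurableT_comp mk measurable_fst).
    apply: measurable_funD => //; apply: measurable_funM => //.
    exact: (measurableT_comp mk measurable_snd).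
  have if' : (gamma \x gamma)%E.-integrable setT (EFin \o f').
    by apply: prob_bounded_integrable mf' _ => z; exact: bq.
  have RE : (\int[(gamma \x gamma)]_z (f' z)%:E = \int[gamma]_x (`|trig_poly x| `^ q)%:E)%E.
    rewrite -[LHS]fineK; last exact: (integrable_fin_num measurableT if').
    rewrite -[RHS]fineK; last exact: integrable_fin_num iq.
    by congr EFin; exact: (rotation_invariance th (norm_q_continuous q1)).
  rewrite -RE (fubini_tonelli1 (m1 := gamma) (m2 := gamma) (EFin \o f'))//.
  - exact/measurable_EFinP.
  - by move=> z; rewrite lee_fin powR_ge0.
under eq_integral => th _ do rewrite E.
by rewrite integral_cst//= probability_setT mule1.
Qed.

Definition vfield_norm (x : X) := Num.sqrt (\sum_j vfield j (coords g x) ^+ 2).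

Let vfield_norm_sqr x : vfield_norm x ^+ 2 = \sum_j vfield j (coords g x) ^+ 2.
Proof. by rewrite sqr_sqrtr// sumr_ge0// => j _; exact: sqr_ge0. Qed.

Let cov_vfield x : Num.sqrt (cov gamma (combination (fun j => vfield j (coords g x)))
  (combination (fun j => vfield j (coords g x)))) = vfield_norm x.
Proof. by rewrite cov_combination /vfield_norm; congr Num.sqrt; apply: eq_bigr => j _; rewrite expr2. Qed.

(** The field is paired with its own value c at x: |c|^2 is at most pi/2 times an integral bounded
    by |c| D, and |c| cancels. The factor |c| arises as the standard deviation of g_c. *)
Let vfield_norm_le x (D : R) : 0 <= D ->
  (\int[mu2]_z `|combination (fun j => vfield j (coords g x)) z.2 * rotated x z|%:E <=
    (vfield_norm x * D)%:E)%E ->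
  vfield_norm x <= pi / 2 * D.
Proof.
move=> D0; set c := fun j => vfield j (coords g x) => h.
have v0 : 0 <= vfield_norm x by exact: sqrtr_ge0.
have pi2 : 0 <= pi / 2 :> R by rewrite divr_ge0// pi_ge0.
have [B hB] := trig_poly_bound.
have B0 : 0 <= B by exact: le_trans (hB 0).
have ic : mu2.-integrable setT (EFin \o (fun z => combination c z.2 * rotated x z)).
  apply: le_integrable_norm (integrable_scale B (combination_integrable c)).
    apply: measurable_funM; last exact: rotated_measurable.
    by apply: msnd; exact: combination_topdual.
  by move=> z; rewrite normrM mulrC ler_wpM2r// hB.
have e : vfield_norm x ^+ 2 = - (pi / 2) * \int[mu2]_z (combination c z.2 * rotated x z).
  by rewrite vfield_norm_sqr -vfield_rotated; apply: eq_bigr => j _; rewrite expr2.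
have le : vfield_norm x ^+ 2 <= pi / 2 * (vfield_norm x * D).
  rewrite e mulNr -mulrN; apply: ler_wpM2l => //.
  rewrite (le_trans (ler_norm _))// normrN.
  apply: le_trans (le_normr_Rintegral measurableT ic) _.
  rewrite -lee_fin /Rintegral fineK//.
  apply: integrable_fin_num => //; exact: integrable_norm ic.
have [->|v1] := eqVneq (vfield_norm x) 0; first by rewrite mulr_ge0.
rewrite expr2 mulrCA ler_pM2l// in le.
by rewrite lt_def v1.
Qed.

Lemma vfield_norm_bounded N x : (forall y, `|trig_poly y| <= N) ->
  vfield_norm x <= pi / 2 * (gauss_C 1 * N).
Proof.
move=> hN; have N0 : 0 <= N by exact: le_trans (hN 0).
apply: vfield_norm_le.
  by rewrite mulr_ge0// powR_ge0.
set c := fun j => vfield j (coords g x); have tc := combination_topdual c.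
have mcz := msnd tc.
apply: (@le_trans _ _ (\int[mu2]_z (N * `|combination c z.2|)%:E)%E).
  apply: ge0_le_integral => //.
  - apply/measurable_EFinP; apply: measurableT_comp => //.
    by apply: measurable_funM => //; exact: rotated_measurable.
  - by apply/measurable_EFinP; apply: measurable_funM => //; exact: measurableT_comp.
  - by move=> z _; rewrite lee_fin normrM mulrC ler_wpM2r// hN.
under eq_integral do rewrite EFinM.
rewrite ge0_integralZl//; last first.
  by apply/measurable_EFinP; exact: measurableT_comp.
rewrite (ge0_integral_law (nu := gamma) (l := snd) measurable_snd _ (F := fun y => (`|combination c y|)%:E)); last 3 first.
- by move=> A mA; exact: product_snd_law.
- by apply/measurable_EFinP; apply: measurableT_comp => //; exact: topdual_measurable.
- by move=> y; rewrite lee_fin.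
have E1 : (\int[gamma]_y (`|combination c y|)%:E = \int[gamma]_y (`|combination c y| `^ 1)%:E)%E.
  by apply: eq_integral => y _; rewrite powRr1.
rewrite E1 integral_powR_topdual// cov_vfield powRr1; last first.
  by rewrite mulr_ge0 ?sqrtr_ge0// powR_ge0.
by rewrite -EFinM lee_fin mulrC mulrA.
Qed.

Lemma vfield_norm_measurable : measurable_fun setT (vfield_norm : borel X -> R).
Proof.
have ms : measurable_fun setT (@Num.sqrt R).
  by apply: continuous_measurable_fun; exact: sqrt_continuous.
apply: (measurableT_comp ms); apply: measurable_sum => j; apply: measurable_funX.
apply: measurable_funM => //; apply: measurable_sum => k; apply: measurable_funM => //.
have [cs _] := smooth_realP (smooth_smoothed_cos (b k - pi / 2) 0 (s_ge0 k)).
apply: (measurableT_comp (continuous_measurable_fun cs)).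
have h : (fun x : borel X => \sum_j u k j * coords g x 0 j) = combination (u k).
  by apply/funext => x; exact: dot_coords.
rewrite h; exact: topdual_measurable (combination_topdual (u k)).
Qed.

(** Hoelder in (angle, y) for fixed x bounds the field by (pi/2) C(p) K(x)^(1/q); integrating the
    q-th power in x brings in rotation invariance. *)
Lemma vfield_norm_Lq p : 1 < p -> let q := p / (p - 1) in
  (\int[gamma]_x (vfield_norm x `^ q)%:E <=
   ((pi / 2 * gauss_C p) `^ q)%:E * \int[gamma]_x (`|trig_poly x| `^ q)%:E)%E.
Proof.
move=> p1 /=; have p0 : 0 < p by lra.
set q := p / (p - 1).
have q1 : 1 < q by rewrite /q ltr_pdivlMr; lra.
have q0 : 0 < q by lra.
have pq : p^-1 + q^-1 = 1 by rewrite /q; field; rewrite !gt_eqF//; lra.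
have mq := measurable_norm_powR q.
have [B hB] := trig_poly_bound.
have B0 : 0 <= B by exact: le_trans (hB 0).
have mr x : measurable_fun setT (fun z => `|rotated x z| `^ q).
  exact: (measurableT_comp mq (rotated_measurable x)).
have ir x : mu2.-integrable setT (EFin \o (fun z => `|rotated x z| `^ q)).
  apply: (@prob_bounded_integrable _ _ _ _ _ (B `^ q)) => // z.
  rewrite ger0_norm ?powR_ge0// ge0_ler_powR ?nnegrE ?(ltW q0)//; exact: hB.
pose K x := \int[mu2]_z (`|rotated x z| `^ q).
have K0 x : 0 <= K x by apply: Rintegral_ge0 => z _; exact: powR_ge0.
have KE x : (\int[mu2]_z (`|rotated x z| `^ q)%:E = (K x)%:E)%E.
  by rewrite /K /Rintegral fineK//; exact: integrable_fin_num (ir x).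
have key x : vfield_norm x `^ q <= (pi / 2 * gauss_C p) `^ q * K x.
  have C0 : 0 <= gauss_C p :> R by exact: powR_ge0.
  have pi2 : 0 <= pi / 2 :> R by rewrite divr_ge0// pi_ge0.
  have h : vfield_norm x <= pi / 2 * (gauss_C p * K x `^ q^-1).
    apply: vfield_norm_le; first by rewrite mulr_ge0// powR_ge0.
    set c := fun j => vfield j (coords g x); have tc := combination_topdual c.
    have := hoelder mu2 (msnd tc) (rotated_measurable x) p0 q0 pq.
    rewrite Lnorm1 => /le_trans; apply.
    have -> : (vfield_norm x * (gauss_C p * K x `^ q^-1))%:E =
        ((vfield_norm x * gauss_C p)%:E * (K x `^ q^-1)%:E)%E by rewrite -EFinM mulrA.
    apply: lee_pmul; [exact: Lnorm_ge0|exact: Lnorm_ge0| |].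
    - apply: Lnorm_le => //; first by rewrite mulr_ge0// sqrtr_ge0.
      rewrite (ge0_integral_law (nu := gamma) (l := snd) measurable_snd _ (F := fun y => (`|combination c y| `^ p)%:E)); last 3 first.
      + by move=> A mA; exact: product_snd_law.
      + apply/measurable_EFinP; apply: (measurableT_comp (measurable_norm_powR p)).
        exact: topdual_measurable.
      + by move=> y; rewrite lee_fin powR_ge0.
      by rewrite integral_powR_topdual// cov_vfield.
    - apply: Lnorm_le => //; first exact: powR_ge0.
      by rewrite KE -powRrM mulVf ?powRr1// gt_eqF.
  apply: (@le_trans _ _ ((pi / 2 * (gauss_C p * K x `^ q^-1)) `^ q)).
    apply: ge0_ler_powR => //; [exact: ltW|by rewrite nnegrE sqrtr_ge0|].
    by rewrite nnegrE; exact: (mulr_ge0 pi2 (mulr_ge0 C0 (powR_ge0 _ _))).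
  rewrite mulrA (powRM _ (mulr_ge0 pi2 C0) (powR_ge0 _ _)) -(powRrM (K x)).
  by rewrite mulVf ?powRr1// gt_eqF.
have f0 (xz : borel X * (measurableTypeR R * borel X)) :
    (0 <= (`|rotated xz.1 xz.2| `^ q)%:E)%E by rewrite lee_fin powR_ge0.
have mJ := measurable_fun_fubini_tonelli_F (m2 := mu2) _ (rotated_joint_measurable q) f0.
have J0 x : (0 <= \int[mu2]_z (`|rotated x z| `^ q)%:E)%E.
  by apply: integral_ge0 => z _; rewrite lee_fin powR_ge0.
have c0 : (0 <= ((pi / 2 * gauss_C p) `^ q)%:E)%E by rewrite lee_fin powR_ge0.
rewrite -(rotated_integral q1) -ge0_integralZl//.
apply: ge0_le_integral => //.
- by move=> x _; rewrite lee_fin powR_ge0.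
- apply/measurable_EFinP; exact: (measurableT_comp (measurable_powR q) vfield_norm_measurable).
- exact: measurable_funeM.
by move=> x _; rewrite KE -EFinM lee_fin.
Qed.

End field.

(** * The Besov condition on trigonometric polynomials *)

Section Lnorm_facts.
Context d (T : measurableType d) (R : realType) (mu : {measure set T -> \bar R}).

Lemma Lnorm_infty_le (N : R) (f : T -> R) : 0 <= N -> (forall x, `|f x| <= N) ->
  ('N[mu]_+oo[EFin \o f] <= N%:E)%E.
Proof.
move=> N0 fN; rewrite unlock; case: ifPn => [_|]; last by rewrite lee_fin.
by apply/ess_sup_inf.ess_supP; apply: nearW => x; rewrite lee_fin.
Qed.

Lemma Lnorm_monotone (r : R) (f g : T -> R) : 0 < r ->
  measurable_fun setT f -> measurable_fun setT g -> (forall x, `|f x| <= g x) ->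
  ('N[mu]_r%:E[EFin \o f] <= 'N[mu]_r%:E[EFin \o g])%E.
Proof.
move=> r0 mf mg fg; have mr := measurable_norm_powR r.
rewrite unlock; apply: gt0_ler_poweR => //.
- by rewrite invr_ge0 ltW.
- by rewrite in_itv/= leey andbT; apply: integral_ge0 => x _; rewrite lee_fin powR_ge0.
- by rewrite in_itv/= leey andbT; apply: integral_ge0 => x _; rewrite lee_fin powR_ge0.
apply: ge0_le_integral => //.
- by move=> x _; rewrite lee_fin powR_ge0.
- by apply/measurable_EFinP; exact: (measurableT_comp mr mf).
- by apply/measurable_EFinP; exact: (measurableT_comp mr mg).
move=> x _; rewrite lee_fin; apply: ge0_ler_powR; rewrite ?nnegrE ?(ltW r0)//.
by rewrite (le_trans (fg x))// ler_norm.
Qed.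

End Lnorm_facts.

Lemma smoothed_cos_le1 (R : realType) (s b t : R) m : 0 <= s -> `|smoothed_cos s b m t| <= 1.
Proof.
move=> s0; apply: le_trans (le_normr_Rintegral measurableT (kernel_integrable b m t s0)) _.
rewrite -(@Rintegral_prob_cst _ _ _ (@angle R) 1); apply: le_Rintegral => //.
- by apply: integrable_norm; exact: kernel_integrable.
- exact: finite_measure_integrable_cst.
- by move=> x _; exact: norm_kernel.
Qed.

Lemma topdual_sum_vectors (R : realType) (X : tvsType R) (l : X -> R) n (c : 'I_n -> R)
  (h : 'I_n -> X) : topdual l -> l (\sum_j c j *: h j) = \sum_j c j * l (h j).
Proof.
move=> tl; elim: n c h => [|n ih] c h; first by rewrite !big_ord0 topdual0.
by rewrite !big_ord_recl topdualD// topdualZ// ih.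
Qed.

Section cutoff_field.
Context (R : realType) (X : tvsType R) (gamma : probability (borel X) R).
Hypothesis hX : hausdorff_space X.
Hypothesis hgamma : radon_centered_gaussian gamma.
Context (n m : nat) (g : 'I_n -> X -> R) (a b : 'I_m -> R) (u : 'I_m -> 'I_n -> R).
Hypothesis tg : forall j, topdual (g j).
Hypothesis og : forall i j, cov gamma (g i) (g j) = (i == j)%:R.
Context (h : 'I_n -> X).
Hypothesis hg : forall j l, topdual l -> l (h j) = cov gamma l (g j).

Local Notation phi := (trig_poly g a b u).
Local Notation V := (vfield a b u).
Local Notation integrable f := (gamma.-integrable setT (EFin \o (f : borel X -> R))).

Definition cut_field r j z := cutoff r z * V j z.

Lemma cut_field_cyl r : 0 < r -> cyl_data gamma (cut_field r) g h.
Proof.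
move=> r0; split.
- by move=> j; apply: cutoff_mul_compact => //; exact: vfield_smooth.
- split => // i j; rewrite -og /cov /Rintegral fineK//.
  by apply: integrable_fin_num => //; exact: topdual_mul_integrable.
- split=> [i|i j].
    by apply: (cameron_martinP hX hgamma (tg i)); [rewrite og eqxx|exact: hg].
  by rewrite (cm_innerE hgamma (tg i) (tg j)); [exact: og|exact: hg|exact: hg].
- by move=> i j; rewrite hg.
Qed.

Lemma smooth_expr_coords v : smooth_expr v -> continuous (fun x => v (coords g x)).
Proof.
elim=> {v} [c|i|v w _ cv _ cw|v w _ cv _ cw|F v sF _ cv].
- exact: cst_continuous.
- rewrite (_ : (fun x => _) = g i); first by have [] := tg i.
  by apply/funext => x; rewrite mxE.
- by move=> x; exact: (cvgD (cv x) (cw x)).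
- by move=> x; exact: (cvgM (cv x) (cw x)).
- have [cF _] := smooth_realP sF.
  by move=> x; exact: (continuous_comp (cv x) (cF (v (coords g x)))).
Qed.

Lemma smooth_expr_partial (v : 'rV[R]_n -> R) j : smooth_expr v -> smooth_expr (partial j v).
Proof.
move=> /smooth_exprP[_ /(_ j)[w sw dw]].
by rewrite (_ : partial j v = w)//; apply/funext => z; have [_ e] := dw z; exact: e.
Qed.

Lemma partial_mul (v w : 'rV[R]_n -> R) j z : smooth_expr v -> smooth_expr w ->
  partial j (fun z => v z * w z) z = v z * partial j w z + w z * partial j v z.
Proof.
move=> /smooth_exprP[_ /(_ j)[v' _ dv]] /smooth_exprP[_ /(_ j)[w' _ dw]].
have [_ ev] := dv z; have [_ ew] := dw z.
have [_ e] := is_deriveM (dv z) (dw z).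
by rewrite /partial ev ew; exact: e.
Qed.

(** The term that the cut-off adds to the divergence; it is O(1/r) uniformly in x because the field
    is bounded. *)
Let remainder r x := \sum_j V j (coords g x) * partial j (cutoff r) (coords g x).

Lemma gauss_div_cut_field r x : gauss_div (cut_field r) g x =
  cutoff r (coords g x) * (phi x - \int[gamma]_y phi y) + remainder r x.
Proof.
rewrite -(vfield_div hgamma a b u tg og) mulr_sumr -big_split/=; apply: eq_bigr => j _.
rewrite /cut_field (partial_mul _ _ (cutoff_smooth _ r) (vfield_smooth a b u j)); ring.
Qed.

(** The supremum bound on each component of the field times the constant 4 e of [cutoff_partial]. *)
Definition remainder_bound : R :=
  \sum_j (pi / 2 * \sum_k `|a k * u k j|) * (4 * expR 1).

Lemma remainder_bound_ge0 : 0 <= remainder_bound.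
Proof.
have pi2 : 0 <= pi / 2 :> R by rewrite divr_ge0// pi_ge0.
apply: sumr_ge0 => j _; apply: mulr_ge0; last by rewrite mulr_ge0// expR_ge0.
by apply: mulr_ge0 => //; exact: sumr_ge0.
Qed.

Let vfield_le j z : `|V j z| <= pi / 2 * \sum_k `|a k * u k j|.
Proof.
have pi2 : 0 <= pi / 2 :> R by rewrite divr_ge0// pi_ge0.
rewrite normrM (ger0_norm pi2); apply: ler_wpM2l => //.
apply: le_trans (ler_norm_sum _ _ _) _; apply: ler_sum => k _.
rewrite normrM ler_piMr// smoothed_cos_le1//.
by apply: sumr_ge0 => i _; exact: sqr_ge0.
Qed.

Let remainder_le r x : 0 < r -> `|remainder r x| <= remainder_bound / r.
Proof.
move=> r0; apply: le_trans (ler_norm_sum _ _ _) _.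
rewrite /remainder_bound mulr_suml; apply: ler_sum => j _.
by rewrite normrM -mulrA; apply: ler_pM => //; exact: cutoff_partial.
Qed.

Lemma gauss_div_cut_field_le r x : 0 < r ->
  `|gauss_div (cut_field r) g x| <= `|phi x| + (`|\int[gamma]_y phi y| + remainder_bound / r).
Proof.
move=> r0; rewrite gauss_div_cut_field addrA; apply: le_trans (ler_normD _ _) _.
apply: lerD; last exact: remainder_le.
rewrite normrM (ger0_norm (cutoff_ge0 _ _)).
apply: le_trans (ler_normB _ _).
by rewrite ler_piMl// cutoff_le1.
Qed.

Lemma gauss_div_cut_field_measurable r :
  measurable_fun setT (gauss_div (cut_field r) g : borel X -> R).
Proof.
have mV v : smooth_expr v -> measurable_fun setT ((fun x => v (coords g x)) : borel X -> R).
  by move=> sv; apply: continuous_measurable_borel; exact: smooth_expr_coords.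
have sc j : smooth_expr (cut_field r j).
  by apply: smooth_mul; [exact: cutoff_smooth|exact: vfield_smooth].
apply: measurable_sum => j; apply: measurable_funB.
  by apply: mV; exact: smooth_expr_partial.
by apply: measurable_funM; [exact: topdual_measurable|exact: mV].
Qed.

Lemma gauss_div_cut_field_cvg x :
  gauss_div (cut_field k.+1%:R) g x @[k --> \oo] --> phi x - \int[gamma]_y phi y.
Proof.
have -> : phi x - \int[gamma]_y phi y = 1 * (phi x - \int[gamma]_y phi y) + 0 by ring.
under eq_fun do rewrite gauss_div_cut_field.
apply: cvgD; first by apply: cvgM; [exact: cutoff_cvg|exact: cvg_cst].
apply: norm_cvg0; apply: (@squeeze_cvgr _ _ _ _ (fun=> 0) (fun k => remainder_bound * k.+1%:R^-1)).
- by apply: nearW => k; rewrite normr_ge0/= remainder_le// ltr0n.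
- exact: cvg_cst.
- rewrite -[X in _ --> X](mulr0 remainder_bound); apply: cvgM; first exact: cvg_cst.
  exact: cvg_harmonic.
Qed.

(** For fixed x the value of the field represents the functional g_c with c the cut-off components,
    and its norm is the standard deviation of g_c. *)
Lemma cm_norm_cut_field r x : cm_norm gamma (cyl_field (cut_field r) g h x) =
  (cutoff r (coords g x) * vfield_norm g a b u x)%:E.
Proof.
pose c j := cut_field r j (coords g x).
rewrite (@cm_normE _ _ _ hgamma (combination g c)); last 2 first.
- exact: combination_topdual.
- by move=> l tl; rewrite topdual_sum_vectors// cov_sumr//; apply: eq_bigr => j _; rewrite hg.
congr EFin; rewrite (cov_combination hgamma tg og).
have -> : \sum_j c j * c j = cutoff r (coords g x) ^+ 2 * \sum_j V j (coords g x) ^+ 2.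
  by rewrite mulr_sumr; apply: eq_bigr => j _; rewrite /c /cut_field; ring.
by rewrite sqrtrM ?sqr_ge0// sqrtr_sqr ger0_norm ?cutoff_ge0.
Qed.

Let phi_measurable : measurable_fun setT (phi : borel X -> R).
Proof. exact: trig_poly_measurable. Qed.

Let phi_bound : exists B, forall x, `|phi x| <= B.
Proof. by have [B _ hB] := utrig_bounded (trig_poly_utrig a b u tg); exists B. Qed.

Let phi_integrable : integrable phi.
Proof. by have [B hB] := phi_bound; exact: prob_bounded_integrable phi_measurable hB. Qed.

Section dual_norm.
Context (p N : R) (p1 : 1 <= p) (N0 : 0 < N) (hN : norm_dual_le gamma p phi N).
Local Notation q := (hoelder_conjugate p%:E).

Let conj_p : p != 1 -> [/\ 1 < p, 1 < p / (p - 1) & q = (p / (p - 1))%:E].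
Proof.
move=> pn1; have p1' : 1 < p by rewrite lt_def pn1.
split => //; first by rewrite ltr_pdivlMr; lra.
rewrite /hoelder_conjugate /= eqe (gt_eqF (lt_trans ltr01 p1')) inver.
by rewrite subr_eq0 (negbTE pn1).
Qed.

Let phi_Lq : p != 1 ->
  (\int[gamma]_x (`|phi x| `^ (p / (p - 1)))%:E <= (N `^ (p / (p - 1)))%:E)%E.
Proof.
move=> pn1; have := hN; rewrite /norm_dual_le (negbTE pn1) -lee_fin /Rintegral fineK//.
have [_ q1 _] := conj_p pn1; have q0 : 0 < p / (p - 1) by lra.
have [B hB] := phi_bound; have B0 : 0 <= B by exact: le_trans (hB 0).
apply: integrable_fin_num => //.
apply: (@prob_bounded_integrable _ _ _ gamma _ (B `^ (p / (p - 1)))).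
  exact: (measurableT_comp (measurable_norm_powR _) phi_measurable).
by move=> x; rewrite ger0_norm ?powR_ge0// ge0_ler_powR ?nnegrE// ltW.
Qed.

(** Hoelder against the constant 1. This second N is the origin of the factor 2 in the bound on the
    divergence. *)
Lemma dual_norm_mean : `|\int[gamma]_y phi y| <= N.
Proof.
have [B hB] := phi_bound.
apply: le_trans (le_normr_Rintegral measurableT phi_integrable) _.
have [pe|pn1] := eqVneq p 1.
  rewrite -(@Rintegral_prob_cst _ _ _ gamma N); apply: le_Rintegral => //.
  - exact: integrable_norm phi_integrable.
  - exact: finite_measure_integrable_cst.
  - by move=> x _; move: hN; rewrite /norm_dual_le pe eqxx.
have [p1' q1 _] := conj_p pn1; have p0 : 0 < p by lra.
have q0 : 0 < p / (p - 1) by lra.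
have pq : p^-1 + (p / (p - 1))^-1 = 1 by field; rewrite !gt_eqF//; lra.
have := hoelder gamma (measurable_cst (1 : R)) phi_measurable p0 q0 pq.
rewrite Lnorm1 => hh.
have e1 : (\int[gamma]_x `|(EFin \o (cst 1%R \* phi)%R) x| = (\int[gamma]_x `|phi x|)%:E)%E.
  rewrite /Rintegral fineK.
    by apply: eq_integral => x _ /=; rewrite mul1r.
  apply: integrable_fin_num => //; exact: integrable_norm phi_integrable.
rewrite e1 in hh; rewrite -lee_fin; apply: le_trans hh _.
have -> : N%:E = (1%:E * N%:E)%E by rewrite mul1e.
apply: lee_pmul; [exact: Lnorm_ge0|exact: Lnorm_ge0| |].
  apply: Lnorm_le => //; under eq_integral do rewrite normr1 powR1.
  by rewrite integral_cst//= probability_setT mule1 powR1.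
by apply: Lnorm_le => //; [exact: ltW|exact: phi_Lq].
Qed.

Lemma Lnorm_cm_cut_field r : 0 < r ->
  ('N[gamma]_q [(fun x => cm_norm gamma (cyl_field (cut_field r) g h x))] <=
   (pi / 2 * gauss_C p * N)%:E)%E.
Proof.
move=> r0; have C0 : 0 <= gauss_C p :> R by exact: powR_ge0.
have pi2 : 0 <= pi / 2 :> R by rewrite divr_ge0// pi_ge0.
have M0 : 0 <= pi / 2 * gauss_C p * N := mulr_ge0 (mulr_ge0 pi2 C0) (ltW N0).
rewrite (_ : (fun x => _) = EFin \o (fun x => cutoff r (coords g x) * vfield_norm g a b u x)); last first.
  by apply/funext => x; exact: cm_norm_cut_field.
have cle x : `|cutoff r (coords g x) * vfield_norm g a b u x| <= vfield_norm g a b u x.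
  have v0 : 0 <= vfield_norm g a b u x by exact: sqrtr_ge0.
  by rewrite (ger0_norm (mulr_ge0 (cutoff_ge0 _ _) v0)); exact: (ler_piMl v0 (cutoff_le1 _ _)).
have [pe|pn1] := eqVneq p 1.
  rewrite pe hoelder_conjugate1; apply: Lnorm_infty_le; first by rewrite pe in M0.
  move=> x; apply: le_trans (cle x) _; rewrite -mulrA.
  apply: (vfield_norm_bounded hgamma tg og) => y.
  by move: hN; rewrite /norm_dual_le pe eqxx.
have [p1' q1 ->] := conj_p pn1; have q0 : 0 < p / (p - 1) by lra.
have mv := vfield_norm_measurable a b u tg.
apply: (@le_trans _ _ ('N[gamma]_(p / (p - 1))%:E[EFin \o vfield_norm g a b u])%E).
  apply: Lnorm_monotone => //; apply: measurable_funM => //.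
  by apply: continuous_measurable_borel; apply: smooth_expr_coords; exact: cutoff_smooth.
apply: Lnorm_le => //.
under eq_integral do rewrite ger0_norm ?sqrtr_ge0//.
apply: le_trans (vfield_norm_Lq hgamma a b u tg og p1') _.
rewrite (powRM _ (mulr_ge0 pi2 C0) (ltW N0)) EFinM; apply: lee_pmul => //.
- by rewrite lee_fin powR_ge0.
- by apply: integral_ge0 => x _; rewrite lee_fin powR_ge0.
- exact: phi_Lq.
Qed.

Lemma Lnorm_gauss_div_cut_field r : 0 < r ->
  ('N[gamma]_q [(fun x => (gauss_div (cut_field r) g x)%:E)] <=
   (2 * N + remainder_bound / r)%:E)%E.
Proof.
move=> r0; set c := `|\int[gamma]_y phi y| + remainder_bound / r.
have D0 : 0 <= remainder_bound / r by rewrite divr_ge0 ?remainder_bound_ge0// ltW.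
have c0 : 0 <= c by rewrite addr_ge0.
have cN : c <= N + remainder_bound / r by rewrite lerD2r dual_norm_mean.
have [pe|pn1] := eqVneq p 1.
  rewrite pe hoelder_conjugate1.
  apply: (@Lnorm_infty_le _ _ _ gamma _ (gauss_div (cut_field r) g)).
    by rewrite addr_ge0// mulr_ge0// ltW.
  move=> x; apply: le_trans (gauss_div_cut_field_le x r0) _.
  rewrite mulr2n mulrDl mul1r -addrA; apply: lerD => //.
  by move: hN; rewrite /norm_dual_le pe eqxx.
have [p1' q1 ->] := conj_p pn1; have q0 : 0 < p / (p - 1) by lra.
set Q := p / (p - 1) in q1 q0 *.
have mn : measurable_fun setT ((fun x => `|phi x|) : borel X -> R) by exact: measurableT_comp.
apply: (@le_trans _ _ ('N[gamma]_Q%:E[EFin \o ((fun x : borel X => `|phi x|) \+ cst c)%R])%E).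
  apply: (@Lnorm_monotone _ _ _ gamma _ (gauss_div (cut_field r) g)) => //.
  - exact: gauss_div_cut_field_measurable.
  - exact: measurable_funD.
  - by move=> x; exact: gauss_div_cut_field_le.
apply: le_trans (minkowski_EFin gamma mn (measurable_cst c) (ltW q1)) _.
have -> : (2 * N + remainder_bound / r)%:E = (N%:E + (N + remainder_bound / r)%:E)%E.
  by rewrite -EFinD; congr EFin; ring.
apply: leeD.
  apply: Lnorm_le => //; first exact: ltW.
  by under eq_integral do rewrite normr_id; exact: phi_Lq.
apply: (@le_trans _ _ c%:E); last by rewrite lee_fin.
apply: Lnorm_le => //; under eq_integral do rewrite /= ger0_norm//.
by rewrite integral_cst//= probability_setT mule1.
Qed.

(** The hypothesis on f is applied to the cut-off fields of radius k + 1; their divergences are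
    bounded uniformly in k, so dominated convergence yields the limit on the left-hand side. *)
Lemma besov_trig_poly (alpha C : R) (f : X -> R) : 0 < alpha <= 1 -> 0 <= C ->
  measurable_fun setT (f : borel X -> R) -> integrable f -> besov_bound gamma p alpha f C ->
  \int[gamma]_x ((f x - \int[gamma]_y f y) * phi x) <=
  2 `^ (1 - 2 * alpha) * pi `^ alpha * gauss_C p `^ alpha * C * N.
Proof.
move=> /andP[a0 a1] C0 mf intf hf.
have [B hB] := phi_bound; have B0 : 0 <= B by exact: le_trans (hB 0).
set c := \int[gamma]_y phi y.
pose E k x := gauss_div (cut_field k.+1%:R) g x.
have k0 (k : nat) : 0 < k.+1%:R :> R by rewrite ltr0n.
have mE k : measurable_fun setT (E k : borel X -> R) by exact: gauss_div_cut_field_measurable.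
have EB k x : `|E k x| <= B + (`|c| + remainder_bound).
  apply: le_trans (gauss_div_cut_field_le x (k0 k)) _; apply: lerD => //; rewrite lerD2l.
  by rewrite ler_pdivrMr// ler_peMr ?remainder_bound_ge0// ler1n.
set D := B + _ in EB.
have ifE k : integrable (fun x => f x * E k x).
  apply: (@eq_integrable _ _ _ gamma setT measurableT (fun x : borel X => (E k x * f x)%:E)).
    by move=> x _ /=; rewrite mulrC.
  exact: (integrableM_bounded intf (mE k) (EB k)).
have iD : integrable (fun x => D * `|f x|).
  by apply: integrable_scale; exact: integrable_norm intf.
have [iL cL] := @Rintegral_dominated_cvg _ _ _ gamma (fun k x => f x * E k x)
  (fun x => f x * (phi x - c)) (fun x => D * `|f x|)
  (fun k => measurable_funM mf (mE k))
  (fun x => cvgM (cvg_cst (f x)) (@gauss_div_cut_field_cvg x)) iD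
  (fun k x => ltac:(by rewrite normrM mulrC ler_wpM2r)).
(* Centering moves from f to phi, because the limit of the divergences is phi - E phi. *)
have eL : \int[gamma]_x ((f x - \int[gamma]_y f y) * phi x) = \int[gamma]_x (f x * (phi x - c)).
  have i1 : integrable (fun x => f x * phi x).
    apply: (@eq_integrable _ _ _ gamma setT measurableT (fun x : borel X => (phi x * f x)%:E)).
      by move=> x _ /=; rewrite mulrC.
    exact: (integrableM_bounded intf phi_measurable hB).
  set e := \int[gamma]_y f y.
  transitivity (\int[gamma]_x (f x * phi x) - e * c).
    under eq_Rintegral do rewrite mulrBl.
    rewrite RintegralB//; last by apply: integrable_scale; exact: phi_integrable.
    by rewrite RintegralZl//; exact: phi_integrable.
  under [RHS]eq_Rintegral do rewrite mulrBr [_ * c]mulrC.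
  rewrite RintegralB//; last exact: integrable_scale.
  by rewrite RintegralZl// [c * _]mulrC.
rewrite eL.
set K := _ * C * N.
have C0' : 0 <= gauss_C p :> R by exact: powR_ge0.
have pi0 : 0 <= pi :> R by exact: pi_ge0.
have pi2 : 0 <= pi / 2 :> R by rewrite divr_ge0.
have K0 : 0 <= K by rewrite !mulr_ge0 ?powR_ge0// ltW.
(* A factor t > 1 leaves room for the remainder of the cut-off, which is absorbed for large k. *)
apply: le_of_le_scale => // t t1.
have bound k : \int[gamma]_x (f x * E k x) <=
    C * (pi / 2 * gauss_C p * N) `^ alpha * (2 * N + remainder_bound / k.+1%:R) `^ (1 - alpha).
  have := hf _ _ _ _ (cut_field_cyl (k0 k)).
  have -> : (\int[gamma]_x (f x * gauss_div (cut_field k.+1%:R) g x)%:E =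
      (\int[gamma]_x (f x * E k x))%:E)%E.
    by rewrite /Rintegral fineK//; exact: integrable_fin_num (ifE k).
  move=> hk; rewrite -lee_fin; apply: le_trans hk _; rewrite !EFinM.
  have mono (Y : \bar R) (y s : R) : 0 <= s -> 0 <= y -> (0 <= Y)%E -> (Y <= y%:E)%E ->
      (Y `^ s <= (y `^ s)%:E)%E.
    move=> s0 y0 Y0 Yy; rewrite -poweR_EFin; apply: gt0_ler_poweR => //.
    - by rewrite in_itv/= leey andbT.
    - by rewrite in_itv/= leey andbT lee_fin.
  apply: lee_pmul.
  - by apply: mule_ge0; [rewrite lee_fin|exact: poweR_ge0].
  - exact: poweR_ge0.
  - apply: lee_pmul; [by rewrite lee_fin|exact: poweR_ge0|exact: lexx|].
    apply: mono; [exact: ltW| |exact: Lnorm_ge0|exact: Lnorm_cm_cut_field].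
    exact: (mulr_ge0 (mulr_ge0 pi2 C0') (ltW N0)).
  - apply: mono; [by rewrite subr_ge0| |exact: Lnorm_ge0|exact: Lnorm_gauss_div_cut_field].
    exact: (addr_ge0 (mulr_ge0 (ler0n _ 2) (ltW N0)) (divr_ge0 remainder_bound_ge0 (ltW (k0 k)))).
rewrite -(cvg_lim _ cL)//; apply: limr_le; first exact: cvgP cL.
have t10 : 0 < 2 * N * (t - 1) by rewrite !mulr_gt0// subr_gt0.
near=> k.
apply: le_trans (bound k) _.
have hk : 2 * N + remainder_bound / k.+1%:R <= 2 * N * t.
  have -> : 2 * N * t = 2 * N + 2 * N * (t - 1) by ring.
  rewrite lerD2l ler_pdivrMr// -ler_pdivrMl//.
  near: k; exists (Num.truncn ((2 * N * (t - 1))^-1 * remainder_bound)) => // k /= hk.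
  by rewrite (le_trans (ltW (truncnS_gt _)))// ler_nat ltnS.
have t0 : 0 <= t by lra.
have N2 : 0 <= 2 * N by rewrite mulr_ge0// ltW.
apply: (@le_trans _ _ (C * (pi / 2 * gauss_C p * N) `^ alpha * (2 * N * t) `^ (1 - alpha))).
  apply: ler_wpM2l; first by rewrite mulr_ge0// powR_ge0.
  apply: ge0_ler_powR; rewrite ?nnegrE ?subr_ge0//.
  - exact: (addr_ge0 (mulr_ge0 (ler0n _ 2) (ltW N0)) (divr_ge0 remainder_bound_ge0 (ltW (k0 k)))).
  - exact: mulr_ge0.
rewrite (powRM _ N2 t0).
(* The slack enters only through the divergence, with exponent 1 - alpha <= 1. *)
have tt : t `^ (1 - alpha) <= t by apply: ler1_powR; [exact: ltW|rewrite gerBl ltW].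
(* The powers of 2 combine as -alpha + (1 - alpha) = 1 - 2 alpha, and those of N as alpha + (1 -
   alpha) = 1. *)
have e : C * (pi / 2 * gauss_C p * N) `^ alpha * (2 * N) `^ (1 - alpha) = K.
  have e2 : 2^-1 `^ alpha = 2 `^ (- alpha) :> R.
    by rewrite -(powR_inv1 (ler0n R 2)) -powRrM mulN1r.
  have e3 : 2 `^ (1 - 2 * alpha) = 2 `^ (- alpha) * 2 `^ (1 - alpha) :> R.
    by rewrite -powRD ?pnatr_eq0 ?implybT//; congr (_ `^ _); ring.
  have NE : N `^ alpha * N `^ (1 - alpha) = N.
    rewrite -powRD ?(gt_eqF N0) ?implybT//.
    have -> : alpha + (1 - alpha) = 1 by ring.
    by rewrite powRr1// ltW.
  have h2 : 0 <= 2^-1 :> R by rewrite invr_ge0.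
  rewrite (powRM _ (mulr_ge0 pi2 C0') (ltW N0)) (powRM _ pi2 C0') (powRM _ pi0 h2) e2.
  rewrite (powRM _ (ler0n R 2) (ltW N0)) /K e3 -[in RHS]NE; ring.
rewrite mulrA e; exact: ler_wpM2l.
Unshelve. all: by end_near. Qed.

End dual_norm.

End cutoff_field.

Lemma trig_expansion (R : realType) (T : Type) (L : set (T -> R)) (phi : T -> R) :
  L (fun=> 0) -> trig L phi -> exists m (a b : nat -> R) (l : nat -> T -> R),
  (forall i, L (l i)) /\ phi = fun x => \sum_(i < m) a i * cos (l i x + b i).
Proof.
move=> L0; elim=> {phi} [|c l d v Ll _ [m [a [b [l' [Ll' ->]]]]]].
  exists 0%N, (fun=> 0), (fun=> 0), (fun=> fun=> 0); split => //.
  by apply/funext => x; rewrite big_ord0.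
exists m.+1, (fun i => if i is j.+1 then a j else c),
  (fun i => if i is j.+1 then b j else d), (fun i => if i is j.+1 then l' j else l).
split; first by case.
by apply/funext => x; rewrite big_ord_recl.
Qed.

(** * Arbitrary trigonometric polynomials and the final estimate *)

Section besov_trig.
Context (R : realType) (X : tvsType R) (gamma : probability (borel X) R).
Hypothesis hX : hausdorff_space X.
Hypothesis hgamma : radon_centered_gaussian gamma.

Lemma ae_eq_Rintegral_borel (F G : X -> R) :
  measurable_fun setT (F : borel X -> R) -> measurable_fun setT (G : borel X -> R) ->
  {ae gamma, forall x, F x = G x} -> \int[gamma]_x F x = \int[gamma]_x G x.
Proof.
move=> mF mG FG; congr fine; apply: ae_eq_integral => //.
- exact/measurable_EFinP.
- exact/measurable_EFinP.
apply: filterS FG; first exact: (ae_filter_ringOfSetsType gamma).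
by move=> x e _ /=; rewrite e.
Qed.

Lemma ae_forall_ord (m : nat) (Q : 'I_m -> X -> Prop) :
  (forall i, {ae gamma, forall x, Q i x}) -> {ae gamma, forall x, forall i, Q i x}.
Proof.
move=> h; have ff := ae_filter_ringOfSetsType gamma.
exact: (@filter_forall _ _ Q _ ff h).
Qed.

(** Each l_k is replaced by its projection on the span of the g_j. The two agree almost everywhere,
    which is enough for the integrals but not for the pointwise dual bound of the case p = 1. *)
Lemma besov_trig (p N alpha C : R) (phi f : X -> R) : 1 <= p -> 0 < N ->
  trig (@topdual R X) phi -> norm_dual_le gamma p phi N -> 0 < alpha <= 1 -> 0 <= C ->
  measurable_fun setT (f : borel X -> R) ->
  gamma.-integrable setT (EFin \o (f : borel X -> R)) ->
  besov_bound gamma p alpha f C ->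
  \int[gamma]_x ((f x - \int[gamma]_y f y) * phi x) <=
  2 `^ (1 - 2 * alpha) * pi `^ alpha * gauss_C p `^ alpha * C * N.
Proof.
move=> p1 N0 tphi hN halpha C0 mf intf hf.
have [L0 LD LZ] := @topdual_linear R X.
have [m [a [b [l [tl phiE]]]]] := trig_expansion L0 tphi.
have [n [g0 [tg0 og0 res0]]] := gram_schmidt hgamma m tl.
pose g (j : 'I_n) := g0 j.
have tg j : topdual (g j) by exact: tg0.
have og i j : cov gamma (g i) (g j) = (i == j)%:R by exact: og0.
have hv j : exists h : X, forall l, topdual l -> l h = cov gamma l (g j).
  by apply: (cameron_martin_vector hX hgamma (tg j)); rewrite og eqxx.
pose h j := projT1 (cid (hv j)).
have hg j k : topdual k -> k (h j) = cov gamma k (g j).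
  by rewrite /h; case: (cid (hv j)) => v hvj; exact: hvj.
pose u (k : 'I_m) (j : 'I_n) := cov gamma (l k) (g j).
pose a' (k : 'I_m) := a k; pose b' (k : 'I_m) := b k.
(* The projected polynomial is phi evaluated at another point of X, so a bound on phi at every point
   carries over. *)
have psiE x : trig_poly g a' b' u x = phi (\sum_j g j x *: h j).
  rewrite phiE; apply: eq_bigr => k _; congr (_ * cos (_ + _)).
  rewrite topdual_sum_vectors//; apply: eq_bigr => j _.
  by rewrite hg// mulrC.
have ae1 : {ae gamma, forall x, forall k : 'I_m, l k x = combination g (u k) x}.
  apply: ae_forall_ord => k.
  have tr : topdual (fun x => l k x - \sum_(j < n) cov gamma (l k) (g0 j) * g0 j x).
    have := LD _ _ (tl k) (LZ (-1) _ (combination_topdual tg (u k))).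
    by congr topdual; apply/funext => x; rewrite mulN1r.
  have := cov_eq0 hgamma tr (res0 k (ltn_ord k)).
  apply: filterS; first exact: (ae_filter_ringOfSetsType gamma).
  by move=> x /eqP; rewrite subr_eq0 => /eqP.
have ae2 : {ae gamma, forall x, trig_poly g a' b' u x = phi x}.
  apply: filterS ae1; first exact: (ae_filter_ringOfSetsType gamma).
  by move=> x e; rewrite phiE; apply: eq_bigr => k _; rewrite e.
have mphi : measurable_fun setT (phi : borel X -> R).
  by apply: utrig_borel; exact: utrig_trig.
have mpsi := trig_poly_measurable a' b' u tg.
have hN' : norm_dual_le gamma p (trig_poly g a' b' u) N.
  move: hN; rewrite /norm_dual_le; case: ifP => _ hN; first by move=> x; have := hN (\sum_j g j x *: h j); rewrite -psiE.
  apply: le_trans hN; rewrite le_eqVlt; apply/orP; left; apply/eqP.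
  have mq := measurable_norm_powR (p / (p - 1)).
  apply: ae_eq_Rintegral_borel.
  - exact: (measurableT_comp mq mpsi).
  - exact: (measurableT_comp mq mphi).
  apply: filterS ae2; first exact: (ae_filter_ringOfSetsType gamma).
  by move=> x ->.
have -> : \int[gamma]_x ((f x - \int[gamma]_y f y) * phi x) =
    \int[gamma]_x ((f x - \int[gamma]_y f y) * trig_poly g a' b' u x).
  apply: ae_eq_Rintegral_borel.
  - by apply: measurable_funM => //; exact: measurable_funB.
  - by apply: measurable_funM => //; exact: measurable_funB.
  apply: filterS ae2; first exact: (ae_filter_ringOfSetsType gamma).
  by move=> x ->.
exact: (besov_trig_poly hX hgamma tg og hg).
Qed.

End besov_trig.

Theorem corollary6p6 (R : realType) (X : tvsType R) (hX : hausdorff_space X)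
    (gamma : probability (borel X) R) (hgamma : radon_centered_gaussian gamma)
    (p alpha : R) (hp : 1 <= p) (halpha : 0 < alpha <= 1)
    (f : X -> R) (hf : besov gamma p alpha f) :
  ('N[gamma]_p%:E [(fun x => (f x - \int[gamma]_y f y)%:E)] <=
   (2 `^ (1 - 2 * alpha) * pi `^ alpha * gauss_C p `^ alpha
    * besov_V gamma p alpha f)%:E)%E.
Proof.
have [fL [C1 [C10 hC1]]] := hf.
have mf : measurable_fun setT (f : borel X -> R).
  by have /set_mem := sub_Lfun_mfun fL.
have intf : gamma.-integrable setT (EFin \o (f : borel X -> R)).
  apply/Lfun1_integrable; apply: (Lfun_subset _ _ _ _ fL) => //.
  exact: fin_num_measure.
have iF : gamma.-integrable setT (EFin \o ((fun x => f x - \int[gamma]_y f y) : borel X -> R)).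
  by apply: integrable_sub => //; exact: finite_measure_integrable_cst.
have mF : measurable_fun setT ((fun x => f x - \int[gamma]_y f y) : borel X -> R).
  exact: measurable_funB.
set k := 2 `^ _ * _ * _; have k0 : 0 <= k by rewrite !mulr_ge0 ?powR_ge0.
have p0 : 0 < p by exact: lt_le_trans hp.
set Np := ('N[gamma]_p%:E[_])%E.
(* The estimate is proved for every admissible C; the infimum is taken only at the end. *)
have key C : 0 <= C -> besov_bound gamma p alpha f C -> (Np <= (k * C)%:E)%E.
  move=> C0 hC; have kC0 : 0 <= k * C by exact: mulr_ge0.
  apply: (Lnorm_le (f := (fun x => f x - \int[gamma]_y f y) : borel X -> R) p0 kC0).
  apply: (trig_duality hX hgamma.1 hp kC0 mF iF) => phi N tphi N0 hN.
  have := besov_trig hX hgamma hp N0 tphi hN halpha C0 mf intf hC; exact.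
have Nfin : Np \is a fin_num.
  rewrite ge0_fin_numE ?Lnorm_ge0//; apply: le_lt_trans (key C1 C10 hC1) _.
  exact: ltry.
rewrite -(fineK Nfin) lee_fin.
have keyr C : 0 <= C -> besov_bound gamma p alpha f C -> fine Np <= k * C.
  by move=> C0 hC; rewrite -lee_fin fineK//; exact: key.
(* Reaching the infimum requires division by k; for k = 0 any single admissible C already gives the
   bound 0. *)
have [kE|kn0] := eqVneq k 0.
  by rewrite kE mul0r -(mul0r C1) -kE; exact: keyr.
have kp : 0 < k by rewrite lt_def kn0.
rewrite -ler_pdivrMl//; apply: lb_le_inf; first by exists C1.
by move=> C [C0 hC]; rewrite ler_pdivrMl//; exact: keyr.
Qed.
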